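(* Let $\xi\in L^2(\Omega,\mathcal F_T,\mathbb P;\mathbb R)$. There exists a unique couple $(Y,Z)$ which is a solution, with data $(\xi,\mathbb H)$ under partial information, of the backward stochastic differential equation $$Y_t=\xi-\int_t^T Z_s\,\mathrm dM_s-(O_T-O_t),\quad 0\le t\le T.$$
   Context: Fix $T>0$ and a probability space $(\Omega,\mathcal F,\mathbb P)$ with a filtration $\mathbb F=(\mathcal F_t)_{0\le t\le T}$, $\mathcal F_T=\mathcal F$, and a subfiltration $\mathbb H=(\mathcal H_t)_{0\le t\le T}$ of $\mathbb F$, i.e. $\mathcal H_t\subseteq\mathcal F_t$ for each $t\in[0,T]$. Both filtrations satisfy the usual hypotheses of completeness and right-continuity. $M=(M_t)_{0\le t\le T}$ is a real-valued square-integrable càdlàg $\mathbb F$-martingale with $\mathbb F$-predictable quadratic variation $\langle M\rangle$. $L^2(\Omega,\mathcal F_T,\mathbb P;\mathbb R)$ is the space of real $\mathcal F_T$-measurable random variables with finite second moment. A solution of the BSDE with data $(\xi,\mathbb H)$ under partial information is a couple $(Y,Z)$ of real-valued processes such that: $Y=(Y_t)_{0\le t\le T}$ is càdlàg and $\mathbb F$-adapted; $Z=(Z_t)_{0\le t\le T}$ is $\mathbb H$-predictable with $\mathbb E[\int_0^T|Z_t|^2\,\mathrm d\langle M\rangle_t]<\infty$; and the displayed equation holds, where $O=(O_t)_{0\le t\le T}$ is a square-integrable $\mathbb F$-martingale with $O_0=0$ satisfying the orthogonality condition $$\mathbb E\Big[O_T\int_0^T\varphi_t\,\mathrm dM_t\Big]=0$$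 for all $\mathbb H$-predictable processes $\varphi$ with $\mathbb E[\int_0^T|\varphi_t|^2\,\mathrm d\langle M\rangle_t]<\infty$. (The martingale $O$ is not given in advance; it is part of what has to exist.) Uniqueness is understood with $Y$ identified up to indistinguishability and $Z$ identified up to $\mathrm d\langle M\rangle\otimes\mathrm d\mathbb P$-null sets. *)

(* Defs.v *)
From HB Require Import structures.
From mathcomp Require Export all_boot all_order all_algebra.
From mathcomp Require Export all_classical all_reals all_analysis.
Set Implicit Arguments.
Unset Strict Implicit.
Unset Printing Implicit Defensive.
Import Order.TTheory GRing.Theory Num.Theory.
Import numFieldNormedType.Exports.
Local Open Scope classical_set_scope.
Local Open Scope ring_scope.

(* Processes are functions X : R -> Omega -> R, first argument time; only their
   values at times in `[0, T] are ever constrained or used. *)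

Section processes.
Context d (Omega : measurableType d) (R : realType).
Variables (P : probability Omega R) (T : R).
Implicit Types (F : R -> set_system Omega) (X Y Z M : R -> Omega -> R).
Implicit Types A : Omega -> cumulative R R.

Definition filtration F : Prop :=
  [/\ forall t, t \in `[0, T] -> sigma_algebra [set: Omega] (F t),
      forall t, t \in `[0, T] -> F t `<=` measurable &
      forall s t, 0 <= s -> s <= t -> t <= T -> F s `<=` F t].

(* [P.-negligible] sets are the subsets of the measurable null sets, measurable
   or not. *)
Definition usual_hypotheses F : Prop :=
  (forall N, P.-negligible N -> F 0 N) /\
  (forall t, t \in `[0, T[ -> \bigcap_(s in `]t, T]) F s = F t).

Definition adapted F X : Prop :=
  forall t, t \in `[0, T] -> preimage_set_system setT (X t) measurable `<=` F t.

Definition cadlag X : Prop :=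
  forall w, (forall t, t \in `[0, T[ -> X s w @[s --> t^'+] --> X t w) /\
            (forall t, t \in `]0, T] -> cvg (X s w @[s --> t^'-])).

Definition indistinguishable X Y : Prop :=
  {ae P, forall w, forall t, t \in `[0, T] -> X t w = Y t w}.

(* V is a version of the conditional expectation of U given G *)
Definition is_cond_exp (G : set_system Omega) (U V : Omega -> R) : Prop :=
  [/\ preimage_set_system setT V measurable `<=` G,
      P.-integrable setT (EFin \o V) &
      forall B, G B ->
        (\int[P]_(w in B) (V w)%:E = \int[P]_(w in B) (U w)%:E)%E].

Definition martingale F M : Prop :=
  [/\ adapted F M,
      forall t, t \in `[0, T] -> P.-integrable setT (EFin \o M t) &
      forall s t, 0 <= s -> s <= t -> t <= T -> is_cond_exp (F s) (M t) (M s)].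

Definition square_integrable_martingale F M : Prop :=
  martingale F M /\ forall t, t \in `[0, T] -> M t \in Lfun P 2%:E.

Definition predictable_rectangle F : set_system (R * Omega) :=
  [set D | (exists2 B, F 0 B & D = [set 0] `*` B) \/
           (exists s t B, [/\ 0 <= s, s <= t, t <= T, F s B &
                              D = `]s, t]%classic `*` B])].

(* the predictable sigma-algebra on [0, T] x Omega *)
Definition predictable_sigma F : set_system (R * Omega) :=
  <<s `[0, T]%classic `*` [set: Omega], predictable_rectangle F >>.

Definition predictable F X : Prop :=
  preimage_set_system (`[0, T]%classic `*` [set: Omega])
    (fun tw : R * Omega => X tw.1 tw.2) measurable `<=` predictable_sigma F.

(* The bracket is given by its paths [A w], each a nondecreasing right-continuous
   function on R, so that d<M>(w) is the Lebesgue-Stieltjes measure of [A w].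
   A path on [0, T] is extended to R by constants, say: integrals below are over
   ]0, T], hence do not see the extension. *)
Definition is_predictable_bracket F M A : Prop :=
  [/\ predictable F (fun t w => A w t),
      {ae P, forall w, A w 0 = 0} &
      martingale F (fun t w => M t w ^+ 2 - A w t)].

(* E [ \int_0^T f t w d<M>_t ] for f >= 0 *)
Definition bracket_expectation A (f : R -> Omega -> R) : \bar R :=
  (\int[P]_w \int[lebesgue_stieltjes_measure (A w)]_(t in `]0%R, T]) (f t w)%:E)%E.

Definition L2_bracket A Z : Prop :=
  (bracket_expectation A (fun t w => (Z t w ^+ 2)%R) < +oo)%E.

(* Z = Z' up to a null set of the measure d<M> (x) dP on ]0, T] x Omega *)
Definition bracket_ae_eq A Z Z' : Prop :=
  bracket_expectation A (fun t w => \1_[set tw | Z tw.1 tw.2 != Z' tw.1 tw.2] (t, w))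
  = 0%E.

(* the data of the process \sum_i h_i 1_(]l_i, r_i]) *)
Record simple_process := SimpleProcess {
  sp_size : nat ;
  sp_left : 'I_sp_size -> R ;
  sp_right : 'I_sp_size -> R ;
  sp_coef : 'I_sp_size -> Omega -> R }.

Definition simple_predictable F (S : simple_process) : Prop :=
  forall i : 'I_(sp_size S),
    [/\ 0 <= sp_left i, sp_left i <= sp_right i, sp_right i <= T,
        preimage_set_system setT (sp_coef i) measurable `<=` F (sp_left i) &
        exists K : R, forall w, `|sp_coef i w| <= K].

Definition simple_val (S : simple_process) (t : R) (w : Omega) : R :=
  \sum_(i < sp_size S) sp_coef i w * \1_(`]sp_left i, sp_right i]%classic) t.

Definition simple_int M (S : simple_process) (t : R) (w : Omega) : R :=
  \sum_(i < sp_size S) sp_coef i w *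
    (M (Num.min (sp_right i) t) w - M (Num.min (sp_left i) t) w).

(* The Ito integral of Z against M: simple processes S n converge to Z in
   L2(d<M> (x) dP) and their elementary integrals converge to X in L2(P) at each
   time.  For Z predictable in L2(d<M> (x) dP), such an X exists and is unique up
   to indistinguishability. *)
Definition is_stoch_int F M A Z X : Prop :=
  [/\ cadlag X, adapted F X &
      exists S : nat -> simple_process,
      [/\ forall n, simple_predictable F (S n),
          bracket_expectation A (fun t w => (Z t w - simple_val (S n) t w) ^+ 2)
            @[n --> \oo] --> 0%E &
          forall t, t \in `[0, T] ->
            (\int[P]_w ((X t w - simple_int M (S n) t w) ^+ 2)%R%:E)%E
              @[n --> \oo] --> 0%E]].

(* a version of t |-> \int_0^t Z_s dM_s (0 when there is none) *)
Definition stoch_int F M A Z : R -> Omega -> R :=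
  xget (fun _ _ => 0) [set X | is_stoch_int F M A Z X].

Definition orthogonality F (H : R -> set_system Omega) M A (O : R -> Omega -> R) :=
  forall phi, predictable H phi -> L2_bracket A phi ->
    'E_P[fun w => (O T w * stoch_int F M A phi T w)%R]%E = 0%E.

Definition bsde_solution F (H : R -> set_system Omega) M A (xi : Omega -> R) Y Z
    : Prop :=
  [/\ cadlag Y, adapted F Y, predictable H Z, L2_bracket A Z &
      exists O : R -> Omega -> R,
      [/\ square_integrable_martingale F O,
          {ae P, forall w, O 0 w = 0},
          orthogonality F H M A O &
          {ae P, forall w, forall t, t \in `[0, T] ->
             Y t w = xi w - (stoch_int F M A Z T w - stoch_int F M A Z t w)
                     - (O T w - O t w)}]].

End processes.

(* Main.v *)
(* The integrals I_T(phi) of the H-predictable integrands phi form a closed subspace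
   of L2(P), because the integral is an isometry on L2(d<M> (x) dP) and the
   H-predictable processes are complete there.  Projecting xi on it gives
   xi = I_T(Z) + r with r orthogonal to every I_T(phi) (a Kunita-Watanabe
   decomposition with respect to a subfiltration).  If N is the cadlag martingale
   E[r | F_t], then O = N - N_0 and Y = I(Z) + N solve the equation; O is still
   orthogonal, as I_T(phi) has conditional expectation 0 given F_0.
   Conversely every solution has Y_t = E[xi | F_t], so that Y is unique.  Subtracting
   the equations of two solutions at time 0, I_T(Z - Z') equals the difference of
   two terms orthogonal to all I_T(phi), hence 0; the isometry gives Z = Z'. *)

From HB Require Import structures.
Require Import Defs.
From mathcomp Require Import ring lra zify measurable_realfun.
Set Implicit Arguments.
Unset Strict Implicit.
Unset Printing Implicit Defensive.
Import Order.TTheory GRing.Theory Num.Theory.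
Import numFieldNormedType.Exports.
Local Open Scope classical_set_scope.
Local Open Scope ring_scope.

(** * Square-integrable functions and projections *)

Section square_integrable.
Context d (E : measurableType d) (R : realType).
Variable mu : {measure set E -> \bar R}.
Implicit Types (f g h : E -> R) (c : R).

(** Conditional expectations and stochastic integrals are treated as projections and isometries
    between L2 spaces of functions, not of classes. The delicate point is measurability for a
    smaller sigma-algebra: the integrand obtained by completeness must be H-predictable although
    d<M> (x) dP is a measure on F-predictable sets, and a conditional expectation must be measurable
    for F_t itself. So the limit of a Cauchy sequence is always the limsup of a subsequence, a
    formula that preserves the measurability shared by the terms. The other obstacle is time. A
    projection gives one random variable for each t, whereas Y and the integral must be adapted with
    all paths càdlàg. Both come from a regularization of t -> E[X | F_t]: an L2 bound on the number
    of moves larger than e along dyadic grids gives almost every path one-sided limits along dyadic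
    times, and under the usual hypotheses the right limits are adapted versions. An integral is thus
    built from its terminal value, obtained by density of simple processes; its earlier values are
    projections of that one. *)

Definition sqint f :=
  measurable_fun setT f /\ mu.-integrable setT (fun x => (f x ^+ 2)%:E).

Definition dot f g : R := \int[mu]_x (f x * g x).

Lemma sqint_mul f g : sqint f -> sqint g ->
  mu.-integrable setT (fun x => (f x * g x)%:E).
Proof.
move=> [mf f2] [mg g2].
apply: (@le_integrable _ _ _ mu setT measurableT _ (fun x => (f x ^+ 2)%:E + (g x ^+ 2)%:E)%E).
- by apply/measurable_EFinP; exact: measurable_funM.
- move=> x _; rewrite -EFinD /= lee_fin normrM [leRHS]ger0_norm; last first.
    by rewrite addr_ge0 ?sqr_ge0.
  rewrite -[f x ^+ 2]real_normK ?num_real// -[g x ^+ 2]real_normK ?num_real//.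
  have := sqr_ge0 (`|f x| - `|g x|); rewrite sqrrB.
  have := mulr_ge0 (normr_ge0 (f x)) (normr_ge0 (g x)).
  lra.
- exact: integrableD.
Qed.

Lemma sqint_lin f g c : sqint f -> sqint g -> sqint (fun x => f x + c * g x).
Proof.
move=> sf sg; have [mf f2] := sf; have [mg g2] := sg; split.
  by apply: measurable_funD => //; exact: measurable_funM.
have fg := sqint_mul sf sg.
rewrite (_ : (fun x => _) = (fun x => (f x ^+ 2)%:E + ((2 * c)%:E * (f x * g x)%:E
   + (c ^+ 2)%:E * (g x ^+ 2)%:E))%E); last first.
  apply/funext => x; rewrite -!EFinM -!EFinD; congr EFin; ring.
by apply: integrableD => //; apply: integrableD => //; exact: integrableZl.
Qed.

Lemma sqint0 : sqint (fun=> 0).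
Proof.
split; first exact: measurable_cst.
by rewrite (_ : (fun x => _) = cst 0%E) ?integrable0//; apply/funext => x /=; rewrite expr0n.
Qed.

Lemma sqintZ c f : sqint f -> sqint (fun x => c * f x).
Proof.
move=> /(sqint_lin c sqint0); congr sqint.
by apply/funext => x; rewrite add0r.
Qed.

Lemma sqintD f g : sqint f -> sqint g -> sqint (fun x => f x + g x).
Proof.
move=> sf /(sqint_lin 1 sf); congr sqint.
by apply/funext => x; rewrite mul1r.
Qed.

Lemma sqintB f g : sqint f -> sqint g -> sqint (fun x => f x - g x).
Proof.
move=> sf /(sqint_lin (-1) sf); congr sqint.
by apply/funext => x; rewrite mulN1r.
Qed.

Lemma sqint_sum n (F : 'I_n -> E -> R) : (forall i, sqint (F i)) ->
  sqint (fun x => \sum_(i < n) F i x).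
Proof.
elim: n F => [|n IH] F sF.
  under eq_fun do rewrite big_ord0; exact: sqint0.
under eq_fun do rewrite big_ord_recr /=.
by apply: sqintD => //; exact: IH.
Qed.

Lemma dotE f g : sqint f -> sqint g ->
  (dot f g)%:E = (\int[mu]_x (f x * g x)%:E)%E.
Proof.
move=> sf sg; rewrite fineK//.
by apply: integrable_fin_num => //; exact: sqint_mul.
Qed.

Lemma dotC f g : dot f g = dot g f.
Proof. by apply: eq_Rintegral => x _; rewrite mulrC. Qed.

Lemma dot_linl f g h c : sqint f -> sqint g -> sqint h ->
  dot (fun x => f x + c * g x) h = dot f h + c * dot g h.
Proof.
move=> sf sg sh; rewrite /dot.
rewrite -RintegralZl//; last exact: sqint_mul.
rewrite -RintegralD//; last 2 first.
- exact: sqint_mul.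
- rewrite (_ : _ \o _ = (fun x => c%:E * (g x * h x)%:E)%E).
    by apply: integrableZl => //; exact: sqint_mul.
  by apply/funext => x.
by apply: eq_Rintegral => x _; rewrite mulrDl mulrA.
Qed.

Lemma dot_linr f g h c : sqint f -> sqint g -> sqint h ->
  dot h (fun x => f x + c * g x) = dot h f + c * dot h g.
Proof. by move=> sf sg sh; rewrite dotC dot_linl// dotC (dotC g). Qed.

Lemma dot0l h : dot (fun=> 0) h = 0.
Proof.
rewrite /dot (@eq_Rintegral _ _ _ _ _ (cst 0)); last by move=> x _ /=; rewrite mul0r.
by rewrite /Rintegral integral0.
Qed.

Lemma dotZl f h c : sqint f -> sqint h ->
  dot (fun x => c * f x) h = c * dot f h.
Proof.
move=> sf sh; have := dot_linl c sqint0 sf sh; rewrite dot0l add0r => <-.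
by congr dot; apply/funext => x; rewrite add0r.
Qed.

Lemma dotDl f g h : sqint f -> sqint g -> sqint h ->
  dot (fun x => f x + g x) h = dot f h + dot g h.
Proof.
move=> sf sg sh; have := dot_linl 1 sf sg sh; rewrite mul1r => <-.
by congr dot; apply/funext => x; rewrite mul1r.
Qed.

Lemma dotDr f g h : sqint f -> sqint g -> sqint h ->
  dot h (fun x => f x + g x) = dot h f + dot h g.
Proof. by move=> sf sg sh; rewrite dotC dotDl// dotC (dotC g). Qed.

Lemma dotBl f g h : sqint f -> sqint g -> sqint h ->
  dot (fun x => f x - g x) h = dot f h - dot g h.
Proof.
move=> sf sg sh; have := dot_linl (-1) sf sg sh; rewrite mulN1r => <-.
by congr dot; apply/funext => x; rewrite mulN1r.
Qed.

Lemma dotBr f g h : sqint f -> sqint g -> sqint h ->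
  dot h (fun x => f x - g x) = dot h f - dot h g.
Proof. by move=> sf sg sh; rewrite dotC dotBl// dotC (dotC g). Qed.

Lemma dot_suml n (F : 'I_n -> E -> R) h : (forall i, sqint (F i)) -> sqint h ->
  dot (fun x => \sum_(i < n) F i x) h = \sum_(i < n) dot (F i) h.
Proof.
elim: n F => [|n IH] F sF sh.
  by under eq_fun do rewrite big_ord0; rewrite dot0l big_ord0.
under eq_fun do rewrite big_ord_recr /=.
rewrite dotDl//; last exact: sqint_sum.
by rewrite IH// big_ord_recr.
Qed.

Lemma dot_ge0 f : 0 <= dot f f.
Proof. by apply: Rintegral_ge0 => x _; rewrite -expr2 sqr_ge0. Qed.

Lemma dot_eq0 f : sqint f -> dot f f = 0 -> {ae mu, forall x, f x = 0}.
Proof.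
move=> sf f0.
have : (\int[mu]_x `|(f x ^+ 2)%:E|)%E = 0%E.
  under eq_integral do rewrite gee0_abs ?lee_fin ?sqr_ge0// expr2.
  by rewrite -dotE// f0.
move/ae_eq_integral_abs => /=.
have m2 : measurable_fun setT (fun x => (f x ^+ 2)%:E) by case: sf => _ /integrableP[].
move=> /(_ measurableT m2); apply: filterS => x /= /(_ I).
by case=> /eqP; rewrite sqrf_eq0 => /eqP.
Qed.

Lemma eq_ae_sqint f g : sqint f -> measurable_fun setT g ->
  {ae mu, forall x, f x = g x} -> sqint g.
Proof.
move=> [mf f2] mg fg; split => //.
have m2 (h : E -> R) : measurable_fun setT h -> measurable_fun setT (fun x => (h x ^+ 2)%:E).
  by move=> mh; apply/measurable_EFinP; exact: measurable_funX.
have /integrableP[_ fi] := f2.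
apply/integrableP; split; first exact: m2.
rewrite -(@ge0_ae_eq_integral _ _ _ mu _ (fun x => `|(f x ^+ 2)%:E|%E))//.
- by apply: measurableT_comp => //; exact: m2.
- by apply: measurableT_comp => //; exact: m2.
- by apply: filterS fg => x /= -> _.
Qed.

Lemma eq_ae_dot f g h : sqint f -> sqint g -> sqint h ->
  {ae mu, forall x, f x = g x} -> dot f h = dot g h.
Proof.
move=> sf sg sh fg; apply: EFin_inj; rewrite !dotE//; apply: ae_eq_integral => //.
- by apply/measurable_EFinP; apply: measurable_funM; [case: sf|case: sh].
- by apply/measurable_EFinP; apply: measurable_funM; [case: sg|case: sh].
- by apply: filterS fg => x /= -> _.
Qed.

(** The quadratic polynomial c -> <f - c g, f - c g> is nonnegative; it is evaluated at its minimum
    <f, g> / <g, g>. *)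
Lemma cauchy_schwarz f g : sqint f -> sqint g ->
  dot f g ^+ 2 <= dot f f * dot g g.
Proof.
move=> sf sg.
have key c : 0 <= dot f f - 2 * c * dot f g + c ^+ 2 * dot g g.
  have := dot_ge0 (fun x => f x + - c * g x).
  have sfg : sqint (fun x => f x + - c * g x) by exact: sqint_lin.
  rewrite dot_linl// !dot_linr// (dotC g f); congr (_ <= _); ring.
have [g0|g0] := eqVneq (dot g g) 0.
  have [->|fg0] := eqVneq (dot f g) 0; first by rewrite expr0n g0 mulr0.
  (* With <g, g> = 0 the polynomial is affine in c, and this c gives it the value -1. *)
  have := key ((dot f f + 1) / (2 * dot f g)).
  rewrite g0 mulr0 addr0 => {}key; exfalso; move: key.
  rewrite (_ : 2 * _ * _ = dot f f + 1); last by field.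
  by lra.
have gp : 0 < dot g g by rewrite lt_def g0 dot_ge0.
have := key (dot f g / dot g g).
rewrite (_ : _ + _ = (dot f f * dot g g - dot f g ^+ 2) / dot g g); last by field.
by rewrite pmulr_lge0 ?invr_gt0// subr_ge0.
Qed.

End square_integrable.

Section geometric_increments.
Variable R : realType.

Lemma cvg_geometric_increments (g : R^nat) (C : R) : 0 <= C ->
  (forall k, `|g k.+1 - g k| <= C * 2^-1 ^+ k) -> cvgn g.
Proof.
move=> C0 gC.
suff : cvgn (series (telescope g)).
  move=> h; rewrite (_ : g = (fun n => g 0 + series (telescope g) n)).
    by apply: is_cvgD => //; exact: is_cvg_cst.
  by apply/funext => n; rewrite -eq_sum_telescope.
apply: normed_cvg; apply: (@series_le_cvg _ _ (geometric C 2^-1)) => //.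
- by move=> n /=.
- by move=> n; rewrite /geometric/= mulr_ge0// exprn_ge0.
- apply: is_cvg_geometric_series; rewrite ger0_norm//.
  lra.
Qed.

Lemma limn_einf_le (u : (\bar R)^nat) (e : \bar R) :
  (\forall n \near \oo, (u n <= e)%E) -> (limn_einf u <= e)%E.
Proof.
move=> ue; rewrite limn_einf_lim; apply: lime_le; first exact: is_cvg_einfs.
apply: filterS ue => n; apply: le_trans.
by rewrite /einfs; apply: ereal_inf_lbound; exists n => /=.
Qed.

Lemma limn_einf_ge (u : (\bar R)^nat) (e : \bar R) :
  (\forall n \near \oo, (e <= u n)%E) -> (e <= limn_einf u)%E.
Proof.
move=> [N _ ue]; rewrite limn_einf_lim; apply: lime_ge; first exact: is_cvg_einfs.
by exists N => // n /= Nn; apply: le_ereal_inf_tmp => _ [k /= nk <-]; apply/ue/(leq_trans Nn).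
Qed.

Lemma measurable_fun_limn_einf d (E : measurableType d) (D : set E)
    (u : nat -> E -> \bar R) : (forall n, measurable_fun D (u n)) ->
  measurable_fun D (fun x => limn_einf (u^~ x)).
Proof.
move=> mu; rewrite (_ : (fun x => _) = (fun x => - limn_esup (fun k => - u k x))%E).
  apply: measurableT_comp => //; apply: measurable_fun_limn_esup => k.
  exact: measurableT_comp.
by apply/funext => x; rewrite -limn_einfN; congr limn_einf; apply/funext => k /=; rewrite oppeK.
Qed.

End geometric_increments.

(** * Completeness of L2 and orthogonal projection *)

Section completeness.
Context d (E : measurableType d) (R : realType).
Variable mu : {measure set E -> \bar R}.
Implicit Types (f g h : E -> R) (c : R).

(** The square of the L2 distance. Working without roots keeps all estimates polynomial, at the
    price of a factor 2 in the triangle inequality. *)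
Definition dist2 f g : R := dot mu (fun x => f x - g x) (fun x => f x - g x).

Definition L2cauchy (u : nat -> E -> R) := forall e : R, 0 < e ->
  exists N, forall m n, (N <= m)%N -> (N <= n)%N -> dist2 (u m) (u n) <= e.

Definition L2cvg (u : nat -> E -> R) f := forall e : R, 0 < e ->
  exists N, forall n, (N <= n)%N -> dist2 (u n) f <= e.

Lemma dist2C f g : dist2 f g = dist2 g f.
Proof. by rewrite /dist2; apply: eq_Rintegral => x _; ring. Qed.

Lemma dist2E f g : sqint mu f -> sqint mu g ->
  dist2 f g = dot mu f f - 2 * dot mu f g + dot mu g g.
Proof.
move=> sf sg; have sfg := sqintB sf sg.
rewrite /dist2 dotBl// !dotBr// (dotC _ g f); ring.
Qed.

(** The difference of the two sides is the squared norm of f + h - 2 g. *)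
Lemma dist2_tri f g h : sqint mu f -> sqint mu g -> sqint mu h ->
  dist2 f h <= 2 * dist2 f g + 2 * dist2 g h.
Proof.
move=> sf sg sh; have := dot_ge0 mu (fun x => (f x + h x) + -2 * g x).
have sfh := sqintD sf sh.
have s3 := sqint_lin (-2) sfh sg.
rewrite dot_linl// !dot_linr// !dotDl// !dotDr// !dist2E//.
rewrite (dotC _ h f) (dotC _ h g) (dotC _ g f).
move: (dot _ f f) (dot _ g g) (dot _ h h) (dot _ f g) (dot _ g h) (dot _ f h) => *.
nra.
Qed.

(** The limit is exposed as a formula in the [u n], so that it is measurable for every sigma-algebra
    for which all the [u n] are. The subsequence also converges almost everywhere, which later
    identifies this limit with pathwise limits. *)
Lemma riesz_fischer (u : nat -> E -> R) : (forall n, sqint mu (u n)) ->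
  L2cauchy u -> exists phi : nat -> nat,
  let f := fun x => fine (limn_esup (fun k => (u (phi k) x)%:E)) in
  [/\ (forall k, k <= phi k)%N, sqint mu f, L2cvg u f &
      {ae mu, forall x, u (phi k) x @[k --> \oo] --> f x}].
Proof.
move=> su uc.
have e8 k : 0 < (8^-1 ^+ k : R) by rewrite exprn_gt0.
have /choice[N NP] : forall k, exists N, forall m n, (N <= m)%N -> (N <= n)%N ->
  dist2 (u m) (u n) <= 8^-1 ^+ k by move=> k; exact: uc.
(* Summing the moduli makes [phi k] exceed k and every [N i] with i at most k, hence [phi k] and
   [phi k.+1] both lie beyond [N k]. *)
pose phi k := (\sum_(i < k.+1) (N i).+1)%N; exists phi => f.
have phi_ge k : (k <= phi k)%N.
  rewrite /phi; elim: k => // k IH; rewrite big_ord_recr /=.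
  by rewrite (leq_ltn_trans IH)// addnS ltnS leq_addr.
have phiN k : (N k <= phi k)%N by rewrite /phi big_ord_recr/=; lia.
have phiS k : (N k <= phi k.+1)%N.
  by rewrite (leq_trans (phiN k))// /phi [X in (_ <= X)%N]big_ord_recr/= leq_addr.
(* The weight 4^k against squared distances 8^-k leaves integrals at most 2^-k, whose sum is finite.
   Where the series of the [dl k] converges, the increments of the subsequence are O(2^-k). *)
pose dl k x := 4 ^+ k * (u (phi k.+1) x - u (phi k) x) ^+ 2.
have dl0 k x : 0 <= dl k x by rewrite /dl mulr_ge0 ?sqr_ge0 ?exprn_ge0//.
have mdl k : measurable_fun setT (fun x => (dl k x)%:E).
  apply/measurable_EFinP; apply: measurable_funM => //; apply: measurable_funX.
  by apply: measurable_funB; have [] := su (phi k.+1); have [] := su (phi k).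
have idl k : (\int[mu]_x (dl k x)%:E <= (2^-1 ^+ k)%:E)%E.
  under eq_integral do rewrite /dl EFinM expr2.
  rewrite ge0_integralZl//; last 2 first.
  - apply/measurable_EFinP; apply: measurable_funM;
    by apply: measurable_funB; have [] := su (phi k.+1); have [] := su (phi k).
  - by move=> x _; rewrite lee_fin -expr2 sqr_ge0.
  rewrite -dotE; try exact: sqintB.
  rewrite -EFinM lee_fin (_ : 2^-1 = 4 * 8^-1 :> R); last by field.
  by rewrite exprMn ler_pM2l ?exprn_gt0//; exact: NP.
have aeS : {ae mu, forall x, (\sum_(0 <= k <oo) (dl k x)%:E)%E \is a fin_num}.
  have : mu.-integrable setT (fun x => (\sum_(0 <= k <oo) (dl k x)%:E)%E).
    apply/integrableP; split.
      apply: ge0_emeasurable_sum => // k x _ _; by rewrite lee_fin.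
    under eq_integral.
      move=> x _; rewrite gee0_abs; last by apply: nneseries_ge0 => k _ _; rewrite lee_fin.
      over.
    rewrite integral_nneseries//; last by move=> k x _; rewrite lee_fin.
    apply: (@le_lt_trans _ _ (\sum_(0 <= k <oo) (2^-1 ^+ k)%:E)%E).
      by apply: lee_nneseries => k *; [apply: integral_ge0 => x _; rewrite lee_fin|exact: idl].
    rewrite (@cvg_lim _ _ _ _ _ _ (2 : R)%:E)//; first by rewrite ltry.
    rewrite (_ : (fun n => _) = EFin \o series (geometric 1 2^-1)); last first.
      apply/funext => n /=; rewrite /series/= sumEFin; congr EFin.
      by apply: eq_bigr => i _; rewrite mul1r.
    apply: cvg_EFin; first by near=> n.
    rewrite (_ : _ \o _ = series (geometric 1 2^-1))//.
    have -> : nbhs (2 : R) = nbhs (1 / (1 - 2^-1) : R) by congr nbhs; field.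
    by apply: cvg_geometric_series; rewrite ger0_norm//; lra.
  by move=> /integrable_ae => /(_ measurableT); apply: filterS => x /(_ I).
have aecvg : {ae mu, forall x, u (phi k) x @[k --> \oo] --> f x}.
  apply: filterS aeS => x Sfin.
  have S0 : (0 <= \sum_(0 <= k <oo) (dl k x)%:E)%E.
    by apply: nneseries_ge0 => k _ _; rewrite lee_fin.
  pose S := fine (\sum_(0 <= k <oo) (dl k x)%:E)%E.
  have dlS k : dl k x <= S.
    rewrite -lee_fin fineK//.
    apply: le_trans (nneseries_lim_ge k.+1 _); last by move=> *; rewrite lee_fin.
    rewrite big_nat_recr//= leeDr// sume_ge0// => i _; by rewrite lee_fin.
  have S0' : 0 <= S by rewrite -lee_fin fineK.
  have cv : cvgn (fun k => u (phi k) x).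
    (* If y^2 is at most S then y is at most S + 1, which avoids the square root of S. *)
    apply: (@cvg_geometric_increments _ _ (S + 1)); first by rewrite addr_ge0.
    move=> k.
    have h4 : 4 ^+ k * `|u (phi k.+1) x - u (phi k) x| ^+ 2 <= S.
      by rewrite real_normK ?num_real//; exact: dlS.
    have p2 : 0 < (2 ^+ k : R) by rewrite exprn_gt0.
    rewrite exprVn ler_pdivlMr// mulrC.
    have : (2 ^+ k * `|u (phi k.+1) x - u (phi k) x|) ^+ 2 <= S.
      by rewrite exprMn -exprM mulnC exprM (_ : 2 ^+ 2 = 4 :> R)//; ring.
    set y := _ * `|_|; nra.
  have [l ul] := (cvg_ex _).1 cv.
  rewrite /f.
  have -> : limn_esup (fun k => (u (phi k) x)%:E) = l%:E.
    by apply: (cvg_limn_einf_sup _).2; apply: cvg_EFin => //; near=> k.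
  exact: ul.
have mf : measurable_fun setT f.
  apply: measurableT_comp; first exact: fine_measurable.
  by apply: measurable_fun_limn_esup => k; apply/measurable_EFinP; have [] := su (phi k).
(* Fatou's lemma in the second index of the Cauchy condition, along [phi]. It yields both the square
   integrability of [f] and the convergence in L2. *)
have lim_le (e : R) N0 : 0 < e ->
    (forall m n, (N0 <= m)%N -> (N0 <= n)%N -> dist2 (u m) (u n) <= e) ->
    forall m, (N0 <= m)%N -> (\int[mu]_x ((u m x - f x) ^+ 2)%:E <= e%:E)%E.
  move=> e0 He m Nm.
  pose v k x := ((u m x - u (phi k) x) ^+ 2)%:E.
  have mv k : measurable_fun setT (v k).
    apply/measurable_EFinP; apply: measurable_funX.
    by apply: measurable_funB; have [] := su (phi k); have [] := su m.
  have v0 k x : (0 <= v k x)%E by rewrite lee_fin sqr_ge0.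
  apply: (@le_trans _ _ (\int[mu]_x limn_einf (v^~ x))%E).
    apply: ae_ge0_le_integral => //.
    - by move=> x _; rewrite lee_fin sqr_ge0.
    - apply/measurable_EFinP; apply: measurable_funX.
      by apply: measurable_funB => //; have [] := su m.
    - by move=> x _; apply: limn_einf_ge; exact: nearW.
    - exact: measurable_fun_limn_einf.
    - apply: filterS aecvg => x ux _.
      rewrite (_ : limn_einf _ = ((u m x - f x) ^+ 2)%:E)//.
      apply: (cvg_limn_einf_sup _).1; apply: cvg_EFin; first by near=> k.
      rewrite /v/=; apply: (@cvg_comp _ _ _ _ (fun y => y ^+ 2)); last exact: exprn_continuous.
      by apply: cvgB => //; exact: cvg_cst.
  apply: le_trans (fatou mu measurableT mv _) _ => //.
  apply: limn_einf_le; exists N0 => // k /= N0k.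
  have := He m (phi k) Nm (leq_trans N0k (phi_ge k)).
  rewrite -lee_fin /dist2 dotE; try exact: sqintB.
  by under eq_integral do rewrite -expr2.
have sdf m : measurable_fun setT (fun x => ((u m x - f x) ^+ 2)%:E).
  by apply/measurable_EFinP; apply: measurable_funX; apply: measurable_funB => //; case: (su m).
have sf : sqint mu f.
  have [N0 HN0] := uc 1 ltr01.
  have sd : sqint mu (fun x => u N0 x - f x).
    split; first by apply: measurable_funB => //; case: (su N0).
    apply/integrableP; split; first exact: sdf.
    under eq_integral do rewrite gee0_abs ?lee_fin ?sqr_ge0//.
    by apply: le_lt_trans (lim_le _ _ ltr01 HN0 N0 (leqnn _)) _; rewrite ltry.
  have := sqintB (su N0) sd; congr sqint; apply/funext => x; ring.
split => // e e0.
have [N0 HN0] := uc e e0; exists N0 => n N0n.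
rewrite -lee_fin /dist2 dotE; try exact: sqintB.
under eq_integral do rewrite -expr2.
exact: lim_le HN0 _ N0n.
Unshelve. all: end_near.
Qed.

Definition subspace (V : set (E -> R)) :=
  [/\ V (fun=> 0), (forall f, V f -> sqint mu f) &
      forall f g c, V f -> V g -> V (fun x => f x + c * g x)].

Definition L2complete (V : set (E -> R)) :=
  forall u : nat -> E -> R, (forall n, V (u n)) -> L2cauchy u ->
    exists2 f, V f & L2cvg u f.

(** A minimizing sequence for the distance from [xi] to [V] is Cauchy, and its limit inherits
    orthogonality from the approximate minimality of the terms. *)
Theorem projection (V : set (E -> R)) xi : subspace V -> L2complete V ->
  sqint mu xi -> exists2 v, V v & forall g, V g -> dot mu (fun x => xi x - v x) g = 0.
Proof.
move=> [V0 Vs Vl] Vc sxi.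
pose D := [set dist2 xi f | f in V].
have Dlb : lbound D 0 by move=> _ [f _ <-]; exact: dot_ge0.
have D0 : D !=set0 by exists (dist2 xi (fun=> 0)); exists (fun=> 0).
have Dinf : has_inf D by split => //; exists 0.
pose dl := inf D.
have dlle f : V f -> dl <= dist2 xi f.
  by move=> Vf; apply: ge_inf; [case: Dinf|exists f].
have ndl n : 0 < (n.+1%:R^-1 : R) by rewrite invr_gt0.
have /choice[u uP] : forall n, exists f, V f /\ dist2 xi f < dl + n.+1%:R^-1.
  move=> n; have [_ [f Vf <-] fl] := inf_adherent (ndl n) Dinf; by exists f.
have uV n : V (u n) by case: (uP n).
(* The parallelogram law: the midpoint of f and g is in [V], hence at squared distance at least [dl]
   from [xi]. *)
have par f g : V f -> V g -> dist2 f g <= 2 * (dist2 xi f - dl) + 2 * (dist2 xi g - dl).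
  move=> Vf Vg.
  have Vm : V (fun x => 0 + 2^-1 * (f x + 1 * g x)) by apply: (@Vl (fun=> 0)) => //; exact: Vl.
  have := dlle _ Vm.
  have [sf sg] := (Vs _ Vf, Vs _ Vg).
  rewrite dist2E//; last exact: Vs.
  have sm := sqint_lin 1 sf sg; have s0 := sqint0 mu.
  rewrite !dot_linl// ?dot_linr//; try by do ?apply: sqint_lin.
  rewrite !(dotC mu _ (fun=> 0)) !dot0l dist2E// (dotC mu g f) !dist2E//.
  move: (dot _ f f) (dot _ g g) (dot _ xi xi) (dot _ f g) (dot _ xi g) (dot _ xi f) => *.
  lra.
have uc : L2cauchy u.
  move=> e e0.
  have [N _ HN] : \forall n \near \oo, n.+1%:R^-1 < e / 4.
    by apply: near_infty_natSinv_lt (PosNum (_ : 0 < e / 4)); rewrite divr_gt0.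
  exists N => m n Nm Nn; apply: le_trans (par _ _ (uV m) (uV n)) _.
  have := HN m Nm; have := HN n Nn; have [_] := uP m; have [_] := uP n => /=.
  move: (dist2 _ (u m)) (dist2 _ (u n)) (m.+1%:R^-1) (n.+1%:R^-1) => *; lra.
have [v Vv uv] := Vc u uV uc.
exists v => // g Vg.
have [sv sg] := (Vs _ Vv, Vs _ Vg).
have [g0|g0] := eqVneq (dot mu g g) 0.
  apply/eqP; rewrite -sqrf_eq0 eq_le sqr_ge0 andbT.
  by apply: le_trans (cauchy_schwarz (sqintB sxi sv) sg) _; rewrite g0 mulr0.
have gp : 0 < dot mu g g by rewrite lt_def g0 dot_ge0.
(* Passing from [u n] to [u n + c g] with the optimal c lowers the squared distance by <xi - u_n,
   g>^2 / <g, g>, and it cannot drop by more than 1/(n+1). *)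
have un_g n : dot mu (fun x => xi x - u n x) g ^+ 2 <= dot mu g g * n.+1%:R^-1.
  pose c := dot mu (fun x => xi x - u n x) g / dot mu g g.
  have [_ un] := uP n; have sun := Vs _ (uV n).
  have := dlle _ (Vl _ _ c (uV n) Vg); move: un.
  have svg := sqint_lin c sun sg.
  rewrite !dist2E// !dot_linl// !dot_linr// (dotC mu g (u n)).
  have cE : dot mu xi g - dot mu (u n) g = c * dot mu g g by rewrite -dotBl// /c divfK.
  have -> : dot mu (fun x => xi x - u n x) g = c * dot mu g g by rewrite /c divfK.
  move: cE (n.+1%:R^-1) => /=.
  clear svg; clearbody c; move: c (dot mu g g) (dot mu xi g) (dot mu (u n) g) gp => c G a b G0 cE t h1 h2.
  have : c ^+ 2 * G <= t by nra.
  by move=> h3; rewrite exprMn (expr2 G) mulrA mulrC ler_pM2l.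
apply/eqP; rewrite -sqrf_eq0 eq_le sqr_ge0 andbT.
apply/ler_addgt0Pr => e e0; rewrite add0r.
have e'0 : 0 < e / (4 * dot mu g g) by rewrite divr_gt0// mulr_gt0.
have [N HN] := uv _ e'0.
have [N' _ HN'] := near_infty_natSinv_lt (PosNum e'0).
pose n := maxn N N'.
have {}HN := HN n (leq_maxl _ _); have {}HN' := HN' n (leq_maxr _ _).
have sun := Vs _ (uV n).
have := cauchy_schwarz (sqintB sun sv) sg; rewrite -/(dist2 (u n) v).
move: HN HN'; rewrite /= ler_pdivlMr ?mulr_gt0// ltr_pdivlMr ?mulr_gt0//.
have := un_g n; rewrite !dotBl//.
move: (dist2 (u n) v) (n.+1%:R^-1) (dot mu xi g) (dot mu v g) (dot mu (u n) g) => D' t a b c *.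
have -> : (a - b) ^+ 2 = ((a - c) + (c - b)) ^+ 2 by congr (_ ^+ 2); ring.
have := sqr_ge0 ((a - c) - (c - b)); nra.
Qed.

End completeness.

Section sqint_extra.
Context d (E : measurableType d) (R : realType).

Lemma sqint_if (mu : {measure set E -> \bar R}) (b : E -> bool) (f g : E -> R) :
  measurable_fun setT b -> sqint mu f -> sqint mu g ->
  sqint mu (fun x => if b x then f x else g x).
Proof.
move=> mb [mf f2] [mg g2]; have mi := measurable_fun_ifT mb mf mg; split => //.
apply: (@le_integrable _ _ _ mu setT measurableT _ (fun x => (f x ^+ 2)%:E + (g x ^+ 2)%:E)%E).
- by apply/measurable_EFinP; exact: measurable_funX.
- move=> x _; rewrite -EFinD /= lee_fin !ger0_norm ?addr_ge0 ?sqr_ge0//.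
  by case: ifP; rewrite (lerDl, lerDr) sqr_ge0.
- exact: integrableD.
Qed.

Lemma sqint_bounded (mu : {finite_measure set E -> \bar R}) (h f : E -> R) (K : R) :
  measurable_fun setT h -> (forall x, `|h x| <= K) -> sqint mu f ->
  sqint mu (fun x => h x * f x).
Proof.
move=> mh hK [mf f2]; split; first exact: measurable_funM.
apply: (@le_integrable _ _ _ mu setT measurableT _ (fun x => (K ^+ 2)%:E * (f x ^+ 2)%:E)%E).
- by apply/measurable_EFinP; apply: measurable_funX; exact: measurable_funM.
- move=> x _.
  have := hK x; have := normr_ge0 (h x) => h0 h1.
  rewrite -EFinM /= lee_fin [leLHS]ger0_norm ?sqr_ge0// [leRHS]ger0_norm; last first.
    by rewrite mulr_ge0 ?sqr_ge0.
  rewrite exprMn -[h x ^+ 2]real_normK ?num_real//.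
  by rewrite ler_wpM2r ?sqr_ge0// ler_sqr ?nnegrE// (le_trans h0).
- exact: integrableZl.
Qed.

Lemma sqint_cst (mu : {finite_measure set E -> \bar R}) (c : R) : sqint mu (fun=> c).
Proof.
split; first exact: measurable_cst.
exact: (finite_measure_integrable_cst mu (c ^+ 2) measurableT).
Qed.

Lemma dot_indic (mu : {finite_measure set E -> \bar R}) (f : E -> R) B : measurable B ->
  sqint mu f -> (\int[mu]_(x in B) (f x)%:E)%E = (dot mu f (\1_B))%:E.
Proof.
move=> mB sf; have s1 : sqint mu (\1_B : E -> R).
  have := sqint_bounded (measurable_indic mB) _ (sqint_cst mu 1).
  have -> : (fun x => \1_B x * 1) = (\1_B : E -> R) by apply/funext => x; rewrite mulr1.
  by apply => x; rewrite indicE; case: (_ \in _) => /=; rewrite ?normr1 ?normr0.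
rewrite dotE// [LHS]integral_mkcond; apply: eq_integral => x _.
by rewrite patchE indicE; case: ifPn => _; rewrite (mulr1, mulr0).
Qed.

End sqint_extra.

(** * Conditional expectations as projections *)

Section sub_sigma_algebra.
Context d (Omega : measurableType d) (R : realType) (P : probability Omega R).
Implicit Types (G : set_system Omega) (f g : Omega -> R).

Definition adm G := sigma_algebra setT G /\ G `<=` measurable.

Definition meas G f := preimage_set_system setT f measurable `<=` G.

(** The bridge between sigma-algebras given as sets of sets, the form of filtrations, and measurable
    functions on a type generated by [G], where closure under arithmetic and limits is available. *)
Lemma measP G f : sigma_algebra setT G ->
  meas G f <-> measurable_fun setT (f : g_sigma_algebraType G -> R).
Proof.
move=> sG; split.
  move=> mf _ Y mY; rewrite /measurable /= sigma_algebra_id//.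
  by apply: mf; exists Y.
move=> mf _ [Y mY <-]; rewrite -(sigma_algebra_id sG).
exact: (mf measurableT Y mY).
Qed.

Lemma meas_measurable G f : G `<=` measurable -> meas G f -> measurable_fun setT f.
Proof. by move=> Gm mf _ Y mY; apply: Gm; apply: mf; exists Y. Qed.

Lemma measS G G' f : G `<=` G' -> meas G f -> meas G' f.
Proof. by move=> GG mf B /mf; exact: GG. Qed.

Lemma meas_set1 G f : adm G -> meas G f -> forall Y, measurable Y -> G (f @^-1` Y).
Proof. by move=> _ mf Y mY; apply: mf; exists Y => //; rewrite setTI. Qed.

Definition L2of G : set (Omega -> R) := [set f | sqint P f /\ meas G f].

Lemma L2of_sqint G f : L2of G f -> sqint P f. Proof. by case. Qed.

Lemma L2ofS G G' f : G `<=` G' -> L2of G f -> L2of G' f.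
Proof. by move=> GG [sf mf]; split => //; exact: measS mf. Qed.

Lemma L2of_subspace G : adm G -> subspace P (L2of G).
Proof.
move=> [sG Gm]; split.
- by split; [exact: sqint0|apply/measP => //; exact: measurable_cst].
- by move=> f [].
- move=> f g c [sf /measP mf] [sg /measP mg]; split; first exact: sqint_lin.
  apply/measP => //; apply: measurable_funD; first exact: mf.
  by apply: measurable_funM => //; exact: mg.
Qed.

(** The limit must be [G]-measurable itself and not merely equal almost everywhere to such a
    function; the limsup of [G]-measurable functions is. *)
Lemma L2of_complete G : adm G -> L2complete P (L2of G).
Proof.
move=> [sG Gm] u uG uc.
have [phi /= [_ sf uf _]] := riesz_fischer (fun n => L2of_sqint (uG n)) uc.
eexists; last exact: uf.
split => //; apply/measP => //.
apply: measurableT_comp; first exact: fine_measurable.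
apply: measurable_fun_limn_esup => k; apply/measurable_EFinP.
by have [_ /measP] := uG (phi k); exact.
Qed.

Lemma L2of_lin G f g c : adm G -> L2of G f -> L2of G g -> L2of G (fun x => f x + c * g x).
Proof. by move=> aG; have [_ _] := L2of_subspace aG; exact. Qed.

Lemma L2ofD G f g : adm G -> L2of G f -> L2of G g -> L2of G (fun x => f x + g x).
Proof.
move=> aG Gf Gg; have := L2of_lin 1 aG Gf Gg.
by under eq_fun do rewrite mul1r.
Qed.

Lemma L2ofB G f g : adm G -> L2of G f -> L2of G g -> L2of G (fun x => f x - g x).
Proof.
move=> aG Gf Gg; have := L2of_lin (-1) aG Gf Gg.
by under eq_fun do rewrite mulN1r.
Qed.

Lemma L2of_cst G c : adm G -> L2of G (fun=> c).
Proof.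
move=> [sG Gm]; split; first exact: sqint_cst.
by apply/measP => //; exact: measurable_cst.
Qed.

Lemma L2of_bounded G h f K : adm G -> meas G h -> (forall x, `|h x| <= K) ->
  L2of G f -> L2of G (fun x => h x * f x).
Proof.
move=> [sG Gm] mh hK [sf mf]; split.
  by apply: sqint_bounded hK sf; exact: meas_measurable mh.
by move/measP : mh => mh; move/measP : mf => mf; apply/measP => //; apply: measurable_funM; [exact: mh|exact: mf].
Qed.

Lemma L2of_indic G B : adm G -> G B -> L2of G (\1_B).
Proof.
move=> aG GB; have [sG Gm] := aG.
have := @L2of_bounded G (\1_B) (fun=> 1) 1 aG.
have -> : (fun x => \1_B x * 1) = (\1_B : Omega -> R) by apply/funext => x; rewrite mulr1.
apply; [|by move=> x; rewrite indicE; case: (_ \in _) => /=; rewrite ?normr1 ?normr0|exact: L2of_cst].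
by apply/measP => //; apply: measurable_indic; rewrite /measurable/= sigma_algebra_id.
Qed.

(* For square-integrable X this says that V is a version of E[X | G]. *)
Definition L2proj G X V := L2of G V /\
  forall U, L2of G U -> dot P (fun x => X x - V x) U = 0.

Lemma L2proj_ex G X : adm G -> sqint P X -> exists V, L2proj G X V.
Proof.
move=> aG sX; have [V GV VU] := projection (L2of_subspace aG) (L2of_complete aG) sX.
by exists V.
Qed.

Lemma L2proj_uniq G X X' V V' : adm G -> sqint P X -> sqint P X' ->
  {ae P, forall w, X w = X' w} ->
  L2proj G X V -> L2proj G X' V' -> {ae P, forall w, V w = V' w}.
Proof.
move=> aG sX sX' XX' [GV VU] [GV' VU'].
have [sV sV'] := (L2of_sqint GV, L2of_sqint GV').
have GD := L2ofB aG GV GV'; have sD := L2of_sqint GD.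
have : dot P (fun w => V w - V' w) (fun w => V w - V' w) = 0.
  have := VU _ GD; have := VU' _ GD; rewrite dotBl// dotBl// dotBl//.
  by rewrite (eq_ae_dot sX sX' sD XX'); lra.
move=> /(dot_eq0 sD); apply: filterS => w /= /eqP; rewrite subr_eq0 => /eqP.
exact.
Qed.

(** By Pythagoras, the right side exceeds the left one by the squared norm of (X - V) - (X' -
    V'). *)
Lemma L2proj_contract G X X' V V' : adm G -> sqint P X -> sqint P X' ->
  L2proj G X V -> L2proj G X' V' -> dist2 P V V' <= dist2 P X X'.
Proof.
move=> aG sX sX' [GV VU] [GV' VU'].
have [sV sV'] := (L2of_sqint GV, L2of_sqint GV').
have := VU _ GV; have := VU _ GV'; have := VU' _ GV; have := VU' _ GV'.
have := dot_ge0 P (fun w => (X w - V w) - (X' w - V' w)).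
rewrite !dotBl//; try (by do ?apply: sqintB).
rewrite !dotBr//; try (by do ?apply: sqintB).
rewrite !dist2E// (dotC _ V X) (dotC _ V X') (dotC _ V' X) (dotC _ V' X') (dotC _ X' X) (dotC _ V' V).
by lra.
Qed.

Lemma L2proj_tower G G' X V V' : adm G -> adm G' -> G `<=` G' -> sqint P X ->
  L2proj G' X V' -> L2proj G X V -> L2proj G V' V.
Proof.
move=> aG aG' GG' sX [GV' VU'] [GV VU]; split => // U GU.
have [sV sV' sU] := And3 (L2of_sqint GV) (L2of_sqint GV') (L2of_sqint GU).
have := VU _ GU; have := VU' _ (L2ofS GG' GU); rewrite !dotBl//; lra.
Qed.

Lemma L2proj_cond_exp G X V : adm G -> sqint P X -> L2proj G X V -> is_cond_exp P G X V.
Proof.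
move=> aG sX [[sV mV] VU]; split => //.
  have := sqint_mul sV (sqint_cst P 1).
  by under eq_fun do rewrite mulr1.
move=> B GB; have mB : measurable B by case: aG => _; exact.
rewrite !dot_indic//; congr EFin.
have G1 := L2of_indic aG GB.
by have := VU _ G1; rewrite dotBl//; [lra|case: G1].
Qed.

(** A conditional expectation is tested against sets only. With W the projection and B the set where
    V < W, the function 1 - 2 1_B is the sign of V - W, so sets already give E|V - W| = 0. *)
Lemma cond_exp_L2proj G X V : adm G -> sqint P X -> sqint P V ->
  is_cond_exp P G X V -> L2proj G X V.
Proof.
move=> aG sX sV [mV iV VX]; split => // U GU.
have sU := L2of_sqint GU.
have [W GW] := L2proj_ex aG sX.
have GV : L2of G V by [].
suff VW : {ae P, forall w, V w = W w}.
  have sW := L2of_sqint GW.1.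
  have := GW.2 _ GU; rewrite dotBl// dotBl// (eq_ae_dot sV sW sU VW); lra.
have [_ _ WX] := L2proj_cond_exp aG sX GW.
have GD := L2ofB aG GV GW.1.
have [sG Gm] := aG.
have sD := L2of_sqint GD; have sW := L2of_sqint GW.1.
have G1 B : G B -> dot P (fun w => V w - W w) (\1_B) = 0.
  move=> GB; have G1 := L2of_indic aG GB; have s1 := L2of_sqint G1.
  have := VX B GB; rewrite -(WX B GB) !dot_indic//; [|exact: Gm|exact: Gm].
  by rewrite dotBl// => -[->]; rewrite subrr.
pose D w := V w - W w.
pose B := D @^-1` `]-oo, 0[.
have GB : G B by apply: GD.2; exists `]-oo, 0[%classic => //; rewrite setTI.
have GT : G setT by case: sG => s0 sC _; rewrite -(setD0 setT); exact: sC.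
have s1 C : G C -> sqint P (\1_C) by move=> /(L2of_indic aG); case.
have : dot P D (fun w => \1_setT w + -2 * \1_B w) = 0.
  by rewrite dot_linr// ?(G1 B)// ?(G1 setT)// ?mulr0 ?addr0//; exact: s1.
move=> D0'; have D0 := dotE sD (sqint_lin (-2) (s1 _ GT) (s1 _ GB)).
rewrite D0' in D0; have /ae_eq_integral_abs : (\int[P]_w `|(D w)%:E|)%E = 0%E.
  apply: etrans (esym D0); apply: eq_integral => w _; rewrite /= !indicE in_setT; congr EFin.
  have -> : (w \in B) = (D w < 0) by apply/idP/idP => [/set_mem|h]; [|apply/mem_set]; rewrite /B/= in_itv/=.
  rewrite -/(D w).
  by case: ltP => h; rewrite /= ?mulr1n ?mulr0n; [rewrite ltr0_norm//|rewrite ger0_norm//]; ring.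
have mD : measurable_fun setT (fun w => (D w)%:E) by apply/measurable_EFinP; case: sD.
move=> /(_ measurableT mD); apply: filterS => w /(_ I) [] /eqP.
by rewrite subr_eq0 => /eqP.
Qed.

End sub_sigma_algebra.

(** * Càdlàg versions of martingales *)

Section resets.
Variable R : realType.
Implicit Types (g : nat -> R) (e : R).

(* The anchor jumps to the current value whenever it is more than e away; resets
   counts these jumps.  They replace the upcrossings of the classical proof: the
   anchored increments of a martingale are orthogonal, which bounds their number
   in L2. *)
Fixpoint anchor e g n : R :=
  if n is m.+1 then (if e < `|g m.+1 - anchor e g m| then g m.+1 else anchor e g m)
  else g 0.

Fixpoint resets e g n : nat :=
  if n is m.+1 then (resets e g m + (e < `|g m.+1 - anchor e g m|)%R)%N else 0.

Lemma anchor_close e g n : 0 <= e -> `|g n - anchor e g n| <= e.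
Proof.
move=> e0; case: n => [|n] /=; first by rewrite subrr normr0.
by case: ifPn => [_|]; [rewrite subrr normr0|rewrite -leNgt].
Qed.

Lemma resets_mono e g m n : (m <= n)%N -> (resets e g m <= resets e g n)%N.
Proof.
elim: n => [|n IH]; first by rewrite leqn0 => /eqP ->.
rewrite leq_eqVlt => /predU1P[->//|]; rewrite ltnS => /IH /leq_trans; apply.
exact: leq_addr.
Qed.

Lemma resets_eq_anchor e g m n : (m <= n)%N -> resets e g m = resets e g n ->
  anchor e g m = anchor e g n.
Proof.
elim: n => [|n IH]; first by rewrite leqn0 => /eqP ->.
rewrite leq_eqVlt => /predU1P[->//|]; rewrite ltnS => mn.
have := resets_mono e g mn; rewrite /=; case: ifPn => _ /=.
  by move=> h1 h2; exfalso; lia.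
by rewrite addn0 => _ /IH; exact.
Qed.

(** The value is always within e of the anchor; with the same anchor at both times it could move by
    at most 2 e. *)
Lemma resets_jump e g m n : 0 <= e -> (m <= n)%N -> 2 * e < `|g n - g m| ->
  (resets e g m < resets e g n)%N.
Proof.
move=> e0 mn jump; rewrite ltn_neqAle resets_mono// andbT.
apply/eqP => /(resets_eq_anchor mn) am.
have := anchor_close g m e0; have := anchor_close g n e0; rewrite am => h1 h2.
have := ler_normD (g n - anchor e g n) (anchor e g n - g m).
rewrite addrA subrK (distrC (anchor e g n)); lra.
Qed.

(** A reset trades a squared distance larger than e^2 for one more unit in the count, weighted by
    e^2. *)
Lemma anchor_step e g n : 0 <= e ->
  (g n.+1 - anchor e g n.+1) ^+ 2 + e ^+ 2 * (resets e g n.+1)%:R <=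
  (g n.+1 - anchor e g n) ^+ 2 + e ^+ 2 * (resets e g n)%:R.
Proof.
move=> e0 /=; case: ifPn => [lt|_] /=; last by rewrite addn0.
rewrite subrr expr0n/= add0r natrD mulrDr mulr1 addrC lerD2r.
rewrite -[leRHS]real_normK ?num_real// ler_sqr ?nnegrE//; lra.
Qed.

End resets.

Section oscillation.
Context d (Omega : measurableType d) (R : realType) (P : probability Omega R).
Variables (G : nat -> set_system Omega) (x : nat -> Omega -> R).
Hypothesis aG : forall i, adm (G i).
Hypothesis GS : forall i, G i `<=` G i.+1.
Hypothesis Gx : forall i, L2of P (G i) (x i).
Hypothesis xmart : forall i U, L2of P (G i) U -> dot P (fun w => x i.+1 w - x i w) U = 0.

Let G_mono i j : (i <= j)%N -> G i `<=` G j.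
Proof.
elim: j => [|j IH]; first by rewrite leqn0 => /eqP ->.
rewrite leq_eqVlt => /predU1P[->//|]; rewrite ltnS => /IH h.
exact: subset_trans h (@GS j).
Qed.

Lemma reset_measurable e n f : L2of P (G n) f ->
  measurable_fun (setT : set (g_sigma_algebraType (G n.+1)))
    (fun w => e < `|x n.+1 w - f w|).
Proof.
move=> Gf; have [sG Gm] := aG n.+1.
have [_ /(measP _ sG) mx] := Gx n.+1.
have [_ /(measP _ sG) mf] := L2ofS (@GS n) Gf.
apply: measurable_fun_ltr; first exact: measurable_cst.
apply: measurableT_comp => //; apply: measurable_funB; [exact: mx|exact: mf].
Qed.

Lemma L2of_if i (b : Omega -> bool) f g :
  measurable_fun (setT : set (g_sigma_algebraType (G i))) b ->
  L2of P (G i) f -> L2of P (G i) g -> L2of P (G i) (fun w => if b w then f w else g w).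
Proof.
move=> mb [sf mf] [sg mg]; have [sG Gm] := aG i.
split.
  apply: sqint_if => // _ Y mY; apply: Gm.
  by rewrite -(sigma_algebra_id sG); exact: (mb measurableT Y mY).
by apply/measP => //; apply: measurable_fun_ifT => //; [exact/(measP _ sG)|exact/(measP _ sG)].
Qed.

Lemma L2of_anchor e n : L2of P (G n) (fun w => anchor e (x^~ w) n).
Proof.
elim: n => [|n IH] /=; first exact: Gx.
apply: L2of_if; [exact: reset_measurable|exact: Gx|].
exact: L2ofS (@GS n) IH.
Qed.

Lemma L2of_resets e n : L2of P (G n) (fun w => (resets e (x^~ w) n)%:R).
Proof.
elim: n => [|n IH] /=; first exact: L2of_cst.
have {}IH := L2ofS (@GS n) IH.
under eq_fun do rewrite natrD.
apply: L2ofD => //.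
rewrite (_ : (fun w => _) = (fun w =>
  if (e < `|x n.+1 w - anchor e (x^~ w) n|)%R then 1 else 0)); last first.
  by apply/funext => w; case: ifP.
apply: L2of_if; [exact: reset_measurable (L2of_anchor e n)|exact: L2of_cst|exact: L2of_cst].
Qed.

(** The increment from n to n + 1 is orthogonal to everything known at n, so it adds the same amount
    to the squared distances of x_n to its anchor and to x_0. Resetting then only lowers the
    distance to the anchor plus e^2 times the expected count. *)
Lemma resets_bound (e : R) n : 0 <= e ->
  e ^+ 2 * dot P (fun w => (resets e (x^~ w) n)%:R) (fun=> 1) <= dist2 P (x n) (x 0).
Proof.
move=> e0.
pose a n w := anchor e (x^~ w) n; pose c n w : R := (resets e (x^~ w) n)%:R.
have sx i : sqint P (x i) by case: (Gx i).
have sa i : sqint P (a i) by case: (L2of_anchor e i).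
have sc i : sqint P (c i) by case: (L2of_resets e i).
have s1 : sqint P (fun=> 1) by exact: sqint_cst.
(* The induction needs the distance to the current anchor as an additional term on the left. *)
suff : dist2 P (x n) (a n) + e ^+ 2 * dot P (c n) (fun=> 1) <= dist2 P (x n) (x 0).
  by apply: le_trans; rewrite lerDr dot_ge0.
elim: n => [|n IH].
  have -> : a 0 = x 0 by [].
  have -> : c 0 = (fun=> 0) by [].
  by rewrite dot0l mulr0 addr0.
have step : dist2 P (x n.+1) (a n.+1) + e ^+ 2 * dot P (c n.+1) (fun=> 1) <=
            dist2 P (x n.+1) (a n) + e ^+ 2 * dot P (c n) (fun=> 1).
  rewrite -!dotZl// /dist2 /dot -!RintegralD//; try by apply: sqint_mul => //; try exact: sqintB; exact: sqintZ.
  have int f h : sqint P f -> sqint P h ->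
      P.-integrable setT (EFin \o (fun w => f w * f w + h w * 1)).
    move=> sf sh; rewrite (_ : _ \o _ = (fun w => (f w * f w)%:E + (h w * 1)%:E)%E)//.
    by apply: integrableD => //; exact: sqint_mul.
  apply: le_Rintegral => //.
  - by apply: int; [exact: sqintB|exact: sqintZ].
  - by apply: int; [exact: sqintB|exact: sqintZ].
  - by move=> w _; rewrite !mulr1 -!expr2; exact: anchor_step.
have orth U : L2of P (G n) U -> dist2 P (x n.+1) U = dist2 P (x n.+1) (x n) + dist2 P (x n) U.
  move=> GU; have sU := L2of_sqint GU.
  have := xmart (L2ofB (aG n) (Gx n) GU); rewrite dotBl//; try exact: sqintB.
  rewrite !dotBr// !dist2E// (dotC _ (x n.+1) (x n)); lra.
have h1 := orth _ (L2of_anchor e n).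
have h2 := orth _ (L2ofS (G_mono (leq0n n)) (Gx 0)).
rewrite -/(a n) in h1; lra.
Qed.

End oscillation.

(** * One-sided limits of paths along dyadic times *)

Section path_regularity.
Variables (R : realType) (T : R).
Hypothesis T0 : 0 < T.
Implicit Types (g : R -> R) (e t : R).

Lemma cauchy_osc_cvg (X : Type) (F : set_system X) (f : X -> R) : ProperFilter F ->
  (forall e, 0 < e -> exists2 B, F B & forall x y, B x -> B y -> `|f x - f y| <= e) ->
  cvg (f @ F).
Proof.
move=> FF osc; apply/cauchy_cvgP/cauchy_exP => e e0.
have [B FB Be] := osc _ (divr_gt0 e0 (ltr0Sn R 1)).
have [y By] := filter_ex FB; exists (f y).
suff : F (f @^-1` ball (f y) e) by [].
apply: filterS FB => x Bx; rewrite /= /ball/=.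
apply: le_lt_trans (Be _ _ By Bx) _; rewrite ltr_pdivrMr// ltr_pMr//; lra.
Qed.

Definition dyadic m k : R := T * (k%:R / 2 ^+ m).

Definition dyadics := [set s : R | exists m k, (k <= 2 ^ m)%N /\ s = dyadic m k].

Lemma dyadic_refine m k n : dyadic m k = dyadic (m + n) (k * 2 ^ n).
Proof.
rewrite /dyadic natrM natrX exprD -mulf_div divff ?mulr1//.
Qed.

Lemma dyadic_itv m k : (k <= 2 ^ m)%N -> 0 <= dyadic m k <= T.
Proof.
move=> km; have p2 : 0 < (2 ^+ m : R) by rewrite exprn_gt0.
rewrite /dyadic mulr_ge0 ?(ltW T0) ?divr_ge0 ?(ltW p2)//=.
rewrite -[leRHS]mulr1 ler_pM2l// ler_pdivrMr// mul1r -natrX ler_nat//.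
Qed.

Lemma dyadics_itv s : dyadics s -> 0 <= s <= T.
Proof. by move=> [m [k [km ->]]]; exact: dyadic_itv. Qed.

Lemma dyadic_lt m k l : (dyadic m k < dyadic m l) = (k < l)%N.
Proof.
have p2 : 0 < ((2 ^+ m)^-1 : R) by rewrite invr_gt0 exprn_gt0.
by rewrite /dyadic ltr_pM2l// ltr_pM2r// ltr_nat.
Qed.

Lemma dyadic0 m : dyadic m 0 = 0.
Proof. by rewrite /dyadic mul0r mulr0. Qed.

Lemma dyadicT m : dyadic m (2 ^ m) = T.
Proof. by rewrite /dyadic natrX divff ?mulr1// expf_neq0// pnatr_eq0. Qed.

(** Frozen at T after index 2^m, so that a grid is a sequence over all of [nat], as [anchor] and
    [resets] expect. *)
Definition grid m i := dyadic m (minn i (2 ^ m)).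

(* A bound along some arbitrarily fine grids only: this is what Fatou's lemma gives. *)
Definition finite_osc e g := exists L : nat, forall m0, exists2 m, (m0 <= m)%N &
  (resets e (g \o grid m) (2 ^ m) <= L)%N.

Lemma common_grid n (s : nat -> R) : (forall i, (i <= n)%N -> dyadics (s i)) ->
  exists m0, forall m, (m0 <= m)%N -> forall i, (i <= n)%N ->
    exists2 k, (k <= 2 ^ m)%N & s i = dyadic m k.
Proof.
elim: n => [|n IH] sD.
  have [m0 [k [km sk]]] := sD 0%N isT; exists m0 => m m0m i; rewrite leqn0 => /eqP ->.
  exists (k * 2 ^ (m - m0))%N; last by rewrite sk (dyadic_refine _ _ (m - m0)) subnKC.
  by rewrite -{2}(subnKC m0m) expnD leq_mul2r km orbT.
have [m1 IH1] := IH (fun i ni => sD i (leqW ni)).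
have [m0 [k [km sk]]] := sD n.+1 (leqnn _).
exists (maxn m1 m0) => m; rewrite geq_max => /andP[m1m m0m] i.
rewrite leq_eqVlt => /predU1P[->|]; last by rewrite ltnS; exact: IH1.
exists (k * 2 ^ (m - m0))%N; last by rewrite sk (dyadic_refine _ _ (m - m0)) subnKC.
by rewrite -{2}(subnKC m0m) expnD leq_mul2r km orbT.
Qed.

(** The finitely many points of a chain lie on a common grid, which may be taken among those where
    the bound holds; each jump forces at least one reset there. *)
Lemma finite_osc_chain e g : 0 <= e -> finite_osc e g -> exists L : nat,
  forall n (s : nat -> R), (forall i, (i <= n)%N -> dyadics (s i)) ->
  (forall i, (i < n)%N -> s i < s i.+1 /\ 2 * e < `|g (s i.+1) - g (s i)|) ->
  (n <= L)%N.
Proof.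
move=> e0 [L HL]; exists L => n s sD sj.
have [m0 Hm0] := common_grid sD.
have [m m0m] := HL m0; apply: leq_trans.
have /choice[k kP] : forall i, exists k, (i <= n)%N -> (k <= 2 ^ m)%N /\ s i = dyadic m k.
  move=> i; case: (leqP i n) => ni; last by exists 0%N.
  by have [k k1 k2] := Hm0 _ m0m _ ni; exists k.
have gE i : (i <= n)%N -> g (s i) = (g \o grid m) (k i).
  by move=> ni; have [k1 k2] := kP i ni; rewrite /= /grid (minn_idPl k1) k2.
suff : forall i, (i <= n)%N -> (i <= resets e (g \o grid m) (k i))%N.
  move=> /(_ n (leqnn _)) /leq_trans; apply; apply: resets_mono.
  by have [] := kP n (leqnn _).
elim=> [//|i IH] ni.
have [slt jump] := sj i ni.
apply: leq_ltn_trans (IH (ltnW ni)) _.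
apply: resets_jump => //; last by rewrite -!gE// ltnW.
have [_ k1] := kP i (ltnW ni); have [_ k2] := kP i.+1 ni.
by move: slt; rewrite k1 k2 dyadic_lt; exact: ltnW.
Qed.

(** Dependent choice would produce a monotone chain of dyadic points with more jumps than the bound
    of [finite_osc_chain] allows. *)
Lemma no_infinite_chain e g (I : set R) (p0 : R) : 0 <= e -> finite_osc e g ->
  dyadics p0 -> I p0 ->
  ((forall p, dyadics p -> I p -> exists q, [/\ dyadics q, I q, p < q & 2 * e < `|g q - g p|]) \/
   (forall p, dyadics p -> I p -> exists q, [/\ dyadics q, I q, q < p & 2 * e < `|g q - g p|])) ->
  False.
Proof.
move=> e0 fo Dp0 Ip0 step.
have [L HL] := finite_osc_chain e0 fo.
pose X := {p : R | dyadics p /\ I p}.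
pose x0 : X := exist _ p0 (conj Dp0 Ip0).
have chain (r : rel R) : (forall p, dyadics p -> I p ->
      exists q, [/\ dyadics q, I q, r p q & 2 * e < `|g q - g p|]) ->
    exists s : nat -> R, forall i, [/\ dyadics (s i), r (s i) (s i.+1) &
      2 * e < `|g (s i.+1) - g (s i)|].
  move=> st.
  have st' (x : X) : {y : X | r (sval x) (sval y) /\ 2 * e < `|g (sval y) - g (sval x)|}.
    apply: cid; case: x => p [Dp Ip] /=; have [q [Dq Iq rq jq]] := st p Dp Ip.
    by exists (exist _ q (conj Dq Iq)).
  have [f [_ fP]] := dependent_choice st' x0.
  exists (fun i => sval (f i)) => i; have [f1 f2] := fP i; split => //.
  by case: (f i) => p [].
case: step => /chain[s sP].
  have := HL L.+1 s (fun i _ => let: And3 h _ _ := sP i in h).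
  have sj : forall i, (i < L.+1)%N -> s i < s i.+1 /\ 2 * e < `|g (s i.+1) - g (s i)|.
    by move=> i _; have [] := sP i.
  by move=> /(_ sj); rewrite ltnn.
(* A descending chain is read backwards from index L + 1, to become ascending. *)
have := HL L.+1 (fun i => s (L.+1 - i)%N) (fun i _ => let: And3 h _ _ := sP _ in h).
have sj : forall i, (i < L.+1)%N -> s (L.+1 - i)%N < s (L.+1 - i.+1)%N /\
    2 * e < `|g (s (L.+1 - i.+1)%N) - g (s (L.+1 - i)%N)|.
  move=> i iL; rewrite -(subnSK iL); have [_ h1 h2] := sP (L.+1 - i.+1)%N.
  by rewrite distrC.
by move=> /(_ sj); rewrite ltnn.
Qed.

(** This continues a chain: of two points whose values are more than 4 e apart, one has a value more
    than 2 e away from that of the current point. *)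
Lemma far_from_one (a b c e : R) : 4 * e < `|a - b| -> 2 * e < `|a - c| \/ 2 * e < `|b - c|.
Proof.
move=> h; case: (ltP (2 * e) `|a - c|) => h1; [by left|right].
have := ler_normD (a - c) (c - b); rewrite addrA subrK (distrC c); lra.
Qed.

(** Only countably many thresholds, so that almost every path satisfies all of them at once. *)
Definition all_osc g := forall n : nat, finite_osc n.+1%:R^-1 g.

(** Otherwise pairs of dyadic points with values more than 4/(n+1) apart exist arbitrarily close to
    t on its right. Given a point p of a chain, such a pair is taken between t and p, and one of its
    members continues the chain downwards. *)
Lemma osc_right g t : all_osc g -> 0 <= t < T ->
  forall e, 0 < e -> exists2 dl, 0 < dl & forall s s', dyadics s -> dyadics s' ->
    t < s < t + dl -> t < s' < t + dl -> `|g s - g s'| <= e.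
Proof.
move=> go /andP[t0 tT] e e0; apply: contrapT => H.
have [n _ /(_ n (leqnn n))/= ne] := near_infty_natSinv_lt (PosNum (divr_gt0 e0 (ltr0Sn R 3))).
have {}H dl : 0 < dl -> exists s s', [/\ dyadics s, dyadics s', t < s < t + dl,
    t < s' < t + dl & 4 * n.+1%:R^-1 < `|g s - g s'|].
  move=> dl0; apply: contrapT => H'; apply: H; exists dl => // s s' Ds Ds' ts ts'.
  rewrite leNgt; apply/negP => lt; apply: H'; exists s, s'; split => //.
  by apply: lt_trans lt; rewrite mulrC -ltr_pdivlMr.
have [p0 [_ [Dp0 _ /andP[tp0 _] _ _]]] := H 1 ltr01.
apply: (@no_infinite_chain n.+1%:R^-1 g [set s | t < s] p0) => //; right=> p Dp /= tp.
have [|s [s' [Ds Ds' /andP[ts sp] /andP[ts' s'p] jump]]] := H (p - t); first by rewrite subr_gt0.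
rewrite subrKC in sp s'p.
by have [h|h] := far_from_one (g p) jump; [exists s|exists s'].
Qed.

Lemma osc_left g t : all_osc g -> 0 < t <= T ->
  forall e, 0 < e -> exists2 dl, 0 < dl & forall s s', dyadics s -> dyadics s' ->
    t - dl < s < t -> t - dl < s' < t -> `|g s - g s'| <= e.
Proof.
move=> go /andP[t0 tT] e e0; apply: contrapT => H.
have [n _ /(_ n (leqnn n))/= ne] := near_infty_natSinv_lt (PosNum (divr_gt0 e0 (ltr0Sn R 3))).
have {}H dl : 0 < dl -> exists s s', [/\ dyadics s, dyadics s', t - dl < s < t,
    t - dl < s' < t & 4 * n.+1%:R^-1 < `|g s - g s'|].
  move=> dl0; apply: contrapT => H'; apply: H; exists dl => // s s' Ds Ds' ts ts'.
  rewrite leNgt; apply/negP => lt; apply: H'; exists s, s'; split => //.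
  by apply: lt_trans lt; rewrite mulrC -ltr_pdivlMr.
have [p0 [_ [Dp0 _ /andP[_ tp0] _ _]]] := H 1 ltr01.
apply: (@no_infinite_chain n.+1%:R^-1 g [set s | s < t] p0) => //; left=> p Dp /= tp.
have [|s [s' [Ds Ds' /andP[sp ts] /andP[s'p ts'] jump]]] := H (t - p); first by rewrite subr_gt0.
rewrite subKr in sp s'p.
by have [h|h] := far_from_one (g p) jump; [exists s|exists s'].
Qed.

(** The first point of the k-th grid strictly after t, even when t is itself dyadic: the value at t
    must not enter a right limit. *)
Definition next_dyadic t k := dyadic k (Num.truncn (2 ^+ k * (t / T))).+1.

Lemma next_dyadicP t k : 0 <= t < T ->
  [/\ dyadics (next_dyadic t k), t < next_dyadic t k & next_dyadic t k <= t + T / 2 ^+ k].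
Proof.
move=> /andP[t0 tT].
have p2 : 0 < (2 ^+ k : R) by rewrite exprn_gt0.
have z0 : 0 <= 2 ^+ k * (t / T) by rewrite mulr_ge0 ?divr_ge0// ltW.
have /andP[tr1 tr2] := truncn_itv z0; set i := Num.truncn _ in tr1 tr2 *.
have tE : t = T * ((2 ^+ k * (t / T)) / 2 ^+ k) by field; rewrite expf_neq0//= gt_eqF.
split.
- exists k, i.+1; split => //; rewrite -(ltr_nat R) natrX.
  apply: le_lt_trans tr1 _; rewrite gtr_pMr// ltr_pdivrMr// mul1r//.
- by rewrite {1}tE /next_dyadic /dyadic ltr_pM2l// ltr_pM2r// invr_gt0.
- rewrite {2}tE /next_dyadic /dyadic -mulrDr ler_pM2l// -[X in _ + X]mul1r -mulrDl.
  by rewrite ler_pM2r ?invr_gt0// -natr1 lerD2r.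
Qed.

Lemma next_dyadic_noninc t k : 0 <= t < T -> next_dyadic t k.+1 <= next_dyadic t k.
Proof.
move=> /andP[t0 tT].
have z0 j : 0 <= 2 ^+ j * (t / T) by rewrite mulr_ge0 ?exprn_ge0 ?divr_ge0// ltW.
rewrite /next_dyadic (dyadic_refine k _ 1) addn1 leNgt dyadic_lt -leqNgt.
rewrite truncn_lt_nat// expn1 exprS -mulrA natrM mulrC ltr_pM2r//.
by have /andP[] := truncn_itv (z0 k).
Qed.

Lemma next_dyadic_near t dl : 0 <= t < T -> 0 < dl ->
  exists N, forall k, (N <= k)%N -> next_dyadic t k < t + dl.
Proof.
move=> tT dl0.
have [N _ HN] : \forall k \near \oo, T * 2^-1 ^+ k < dl.
  have h : (fun k => T * 2^-1 ^+ k) @ \oo --> (0 : R).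
    apply: (@cvg_geometric R T 2^-1); rewrite ger0_norm//; lra.
  exact: (cvgr_lt _ h).
exists N => k /HN /=; have [_ _ h] := next_dyadicP k tT.
by rewrite -exprVn in h => ?; apply: le_lt_trans h _; rewrite ltrD2l.
Qed.

(** A limsup along one fixed sequence depends measurably on the path; for paths with controlled
    oscillation it is the limit over all dyadic times decreasing to t. *)
Definition right_lim g t := fine (limn_esup (fun k => (g (next_dyadic t k))%:E)).

Lemma right_lim_cvg g t : all_osc g -> 0 <= t < T ->
  g (next_dyadic t k) @[k --> \oo] --> right_lim g t.
Proof.
move=> go tT; have : cvgn (fun k => g (next_dyadic t k)).
  apply: cauchy_osc_cvg => e e0.
  have [dl dl0 H] := osc_right go tT e0.
  have [N HN] := next_dyadic_near tT dl0.
  exists [set k | (N <= k)%N]; first by exists N.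
  move=> k l /= Nk Nl; have [Dk tk _] := next_dyadicP k tT; have [Dl tl _] := next_dyadicP l tT.
  by apply: H => //; apply/andP; split => //; exact: HN.
move=> /cvg_ex[l gl]; rewrite /right_lim.
have -> : limn_esup (fun k => (g (next_dyadic t k))%:E) = l%:E; last exact: gl.
by apply: (cvg_limn_einf_sup _).2; apply: cvg_EFin => //; exact: nearW.
Qed.

Lemma right_lim_le g t a dl e : all_osc g -> 0 <= t < T -> 0 < dl ->
  (forall s, dyadics s -> t < s < t + dl -> `|a - g s| <= e) -> `|a - right_lim g t| <= e.
Proof.
move=> go tT dl0 H; have [N HN] := next_dyadic_near tT dl0.
have h : `|a - g (next_dyadic t k)| @[k --> \oo] --> `|a - right_lim g t|.
  by apply: cvg_norm; apply: cvgB; [exact: cvg_cst|exact: right_lim_cvg].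
rewrite -(cvg_lim _ h)//; apply: limr_le; first by apply/cvg_ex; exists `|a - right_lim g t|.
exists N => // k /= Nk; have [Dk tk _] := next_dyadicP k tT.
by apply: H => //; rewrite tk/= HN.
Qed.

(** The value at u is a limit of dyadic values taken just after u, all of which are within e of the
    right limit at t once u is close to t. *)
Lemma right_lim_rcont g t : all_osc g -> 0 <= t < T ->
  right_lim g s @[s --> t^'+] --> right_lim g t.
Proof.
move=> go tT; have /andP[t0 tT'] := tT; apply/cvgrPdist_le => e e0.
have [dl dl0 H] := osc_right go tT e0.
have Hr s : dyadics s -> t < s < t + dl -> `|right_lim g t - g s| <= e.
  move=> Ds ts; rewrite distrC; apply: right_lim_le dl0 _ => // s' Ds' ts'; exact: H.
near=> u.
have tu : t < u by near: u; exact: nbhs_right_gt.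
have udl : u < t + dl by near: u; apply: nbhs_right_lt; rewrite ltrDl.
have uT : u < T by near: u; exact: nbhs_right_lt.
apply: (@right_lim_le _ _ _ (t + dl - u)) => //.
- by rewrite (ltW (le_lt_trans t0 tu)).
- by rewrite subr_gt0.
- move=> s Ds /andP[us su]; apply: Hr => //; rewrite (lt_trans tu us)/=.
  by rewrite subrKC in su.
Unshelve. all: end_near.
Qed.

Lemma right_lim_left_cvg g t : all_osc g -> 0 < t <= T -> cvg (right_lim g s @[s --> t^'-]).
Proof.
move=> go tT; have /andP[t0 tT'] := tT; apply: cauchy_osc_cvg => e e0.
have [dl dl0 H] := osc_left go tT e0.
pose B := [set u | 0 <= u /\ t - dl < u < t].
exists B.
  near=> u; split; first by near: u; exact: nbhs_left_ge.
  apply/andP; split; last by near: u; exact: nbhs_left_lt.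
  by near: u; apply: nbhs_left_gt; rewrite ltrBlDr ltrDl.
move=> u v [u0 /andP[tu ut]] [v0 /andP[tv vt]].
have uT : 0 <= u < T by rewrite u0 (lt_le_trans ut).
have vT : 0 <= v < T by rewrite v0 (lt_le_trans vt).
apply: (@right_lim_le _ _ _ (t - v)) => //; first by rewrite subr_gt0.
move=> s Ds /andP[vs st]; rewrite subrKC in st.
rewrite distrC; apply: (@right_lim_le _ _ _ (t - u)) => //; first by rewrite subr_gt0.
move=> s' Ds' /andP[us' s't]; rewrite subrKC in s't.
by apply: H => //; [rewrite (lt_trans tv vs)|rewrite (lt_trans tu us')].
Unshelve. all: end_near.
Qed.

End path_regularity.

(** * Adapted càdlàg versions of conditional expectations *)

Section regularization.
Context d (Omega : measurableType d) (R : realType) (P : probability Omega R).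
Variables (T : R) (F : R -> set_system Omega).
Hypothesis T0 : 0 < T.
Hypothesis filtF : filtration T F.
Hypothesis usualF : usual_hypotheses P T F.

Lemma filtration_adm t : 0 <= t <= T -> adm (F t).
Proof.
by move=> tT; have [sF Fm _] := filtF; split; [apply: sF|apply: Fm]; rewrite in_itv.
Qed.

Lemma filtrationS s t : 0 <= s -> s <= t -> t <= T -> F s `<=` F t.
Proof. by have [_ _] := filtF; exact. Qed.

(** V is also the projection of V', and Pythagoras applies. Projections on a monotone sequence of
    sigma-algebras are therefore Cauchy as soon as their norms converge. *)
Lemma dist2_L2proj_mono (xi : Omega -> R) G G' V V' : adm G -> adm G' -> G `<=` G' -> sqint P xi ->
  L2proj P G xi V -> L2proj P G' xi V' ->
  dist2 P V' V = dot P V' V' - dot P V V.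
Proof.
move=> aG aG' GG' sxi pV pV'.
have [GV tV] := L2proj_tower aG aG' GG' sxi pV' pV.
have [sV sV'] := (L2of_sqint GV, L2of_sqint pV'.1).
have := tV _ GV; rewrite dotBl// dist2E//; lra.
Qed.

Section conditional_expectations.
Variables (xi : Omega -> R) (x : R -> Omega -> R).
Hypothesis sxi : sqint P xi.
Hypothesis xP : forall t, 0 <= t <= T -> L2proj P (F t) xi (x t).

Let grid_in m i : 0 <= grid T m i <= T.
Proof. by apply: dyadic_itv => //; exact: geq_minr. Qed.

Let grid_le m i : grid T m i <= grid T m i.+1.
Proof.
rewrite leNgt dyadic_lt// -leqNgt leq_min geq_minr andbT.
by rewrite (leq_trans (geq_minl _ _)).
Qed.

(** On every grid the expected number of resets is at most the squared distance of x_T to x_0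
    divided by e^2, a bound free of the mesh. By Fatou the liminf of the counts is integrable, hence
    finite almost surely. *)
Lemma x_finite_osc (e : R) : 0 < e ->
  {ae P, forall w, finite_osc T e (x^~ w)}.
Proof.
move=> e0.
pose C m w : R := (resets e ((x^~ w) \o grid T m) (2 ^ m))%:R.
have Cb m : sqint P (C m) /\ e ^+ 2 * dot P (C m) (fun=> 1) <= dist2 P (x T) (x 0).
  have aG i : adm (F (grid T m i)) by apply: filtration_adm; exact: grid_in.
  have GS i : F (grid T m i) `<=` F (grid T m i.+1).
    apply: filtrationS (grid_le m i) _; first by have /andP[] := grid_in m i.
    by have /andP[] := grid_in m i.+1.
  have Gx i : L2of P (F (grid T m i)) (x (grid T m i)) by exact: (xP (grid_in m i)).1.
  have xm i U : L2of P (F (grid T m i)) U ->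
      dot P (fun w => x (grid T m i.+1) w - x (grid T m i) w) U = 0.
    by apply: (L2proj_tower _ _ (GS i) sxi (xP (grid_in m i.+1)) (xP (grid_in m i))).2.
  split; first by have [] := L2of_resets aG GS Gx e (2 ^ m).
  have := @resets_bound _ _ _ P _ _ aG GS Gx xm e (2 ^ m) (ltW e0).
  by rewrite /= {2}/grid minnn dyadicT// {2}/grid min0n dyadic0.
have sC m : sqint P (C m) by case: (Cb m).
have mC m : measurable_fun setT (fun w => (C m w)%:E) by apply/measurable_EFinP; case: (sC m).
have C0 m w : (0 <= (C m w)%:E)%E by rewrite lee_fin.
pose K := dist2 P (x T) (x 0) / e ^+ 2.
have CK m : (\int[P]_w (C m w)%:E <= K%:E)%E.
  under eq_integral do rewrite -[C m _]mulr1.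
  rewrite -dotE//; last exact: sqint_cst.
  by rewrite lee_fin ler_pdivlMr ?exprn_gt0// mulrC; case: (Cb m).
have : P.-integrable setT (fun w => limn_einf (fun m => (C m w)%:E)).
  apply/integrableP; split; first exact: measurable_fun_limn_einf.
  have l0 w : (0 <= limn_einf (fun m => (C m w)%:E))%E by apply: limn_einf_ge; exact: nearW.
  under eq_integral do rewrite gee0_abs//.
  apply: le_lt_trans (fatou _ measurableT mC _) _ => //.
  by apply: le_lt_trans (limn_einf_le _) (ltry K); exact: nearW.
move=> /integrable_ae => /(_ measurableT); apply: filterS => w /(_ I).
set l := limn_einf _ => lfin.
(* An integer above the liminf: if the counts exceeded it on all grids from [m0] on, so would the
   liminf. *)
exists (Num.truncn (fine l)).+1 => m0; apply: contrapT => H.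
have : (((Num.truncn (fine l)).+1%:R)%:E <= l)%E.
  apply: limn_einf_ge; exists m0 => // m /= m0m; rewrite lee_fin ler_nat ltnW//.
  by rewrite ltnNge; apply/negP => mL; apply: H; exists m.
rewrite -(fineK lfin) lee_fin leNgt truncnS_gt//.
Qed.

Definition good_paths := [set w | all_osc T (x^~ w)].

Lemma bad_paths_negligible : P.-negligible (~` good_paths).
Proof.
have : {ae P, forall w, good_paths w}.
  by apply: ae_foralln => n; apply: x_finite_osc; rewrite invr_gt0.
by [].
Qed.

(** The value 0 on bad paths makes every path càdlàg, and costs no adaptedness, since the bad paths
    form a null set and thus belong to F_0. At T, where no right limit exists, the value is [xi]
    itself. *)
Definition reg t w : R :=
  if T <= t then xi w else if `[< good_paths w >] then right_lim T (x^~ w) t else 0.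

Lemma reg_cadlag : cadlag T reg.
Proof.
move=> w; split=> t; rewrite in_itv/= => /andP[t0 tT].
  have -> : reg t w = if `[< good_paths w >] then right_lim T (x^~ w) t else 0.
    by rewrite /reg leNgt tT.
  have h : {near t^'+, (fun s => if `[< good_paths w >] then right_lim T (x^~ w) s else 0) =1
                       (fun s => reg s w)}.
    near=> s; have sT : s < T by near: s; exact: nbhs_right_lt.
    by rewrite /reg leNgt sT.
  apply: cvg_trans (near_eq_cvg h) _.
  case: asboolP => [gw|_]; last exact: cvg_cst.
  by apply: right_lim_rcont => //; rewrite t0.
have h : {near t^'-, (fun s => if `[< good_paths w >] then right_lim T (x^~ w) s else 0) =1
                     (fun s => reg s w)}.
  near=> s; have sT : s < T.
    by apply: (@lt_le_trans _ _ t) => //; near: s; exact: nbhs_left_lt.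
  by rewrite /reg leNgt sT.
apply: (cvgP (lim ((fun s => if `[< good_paths w >] then right_lim T (x^~ w) s else 0) @ t^'-))).
apply: cvg_trans (near_eq_cvg h) _.
case: asboolP => [gw|_]; last by apply: cvgP; exact: cvg_cst.
by apply: right_lim_left_cvg => //; rewrite t0.
Unshelve. all: end_near.
Qed.

Lemma good_pathsF t : 0 <= t <= T -> F t good_paths.
Proof.
move=> /andP[t0 tT].
have : F 0 (~` good_paths) by case: usualF => h _; apply: h; exact: bad_paths_negligible.
move/(filtrationS (lexx _) t0 tT) => Ft.
have [[_ sC _] _] : adm (F t) by apply: filtration_adm; rewrite t0.
by have := sC _ Ft; rewrite setTD setCK.
Qed.

(** By right-continuity of the filtration it suffices to have measurability for F_s for each s >
    t. *)
Lemma reg_meas t : 0 <= t < T -> meas (F t) (reg t).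
Proof.
move=> tT; have /andP[t0 tT'] := tT.
have [_ rcF] := usualF; rewrite /meas -(rcF t); last by rewrite in_itv/= t0.
move=> B mB s /=; rewrite in_itv/= => /andP[ts sT].
suff : meas (F s) (reg t) by exact.
have sT' : 0 <= s <= T by rewrite sT (ltW (le_lt_trans t0 ts)).
have [sF Fm] := filtration_adm sT'.
have st0 : 0 < s - t by rewrite subr_gt0.
have [N HN] := next_dyadic_near T0 tT st0; rewrite subrKC in HN.
(* From index N on, the dyadic times lie before s; dropping the first N terms does not change the
   limit on good paths. *)
rewrite (_ : reg t = fun w => if `[< good_paths w >] then
   fine (limn_esup (fun k => (x (next_dyadic T t (k + N)) w)%:E)) else 0); last first.
  apply/funext => w; rewrite /reg leNgt tT' /=; case: asboolP => // gw.
  have := right_lim_cvg T0 gw tT; rewrite -(cvg_shiftn N).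
  move=> h; have [_ ->] : (limn_einf (fun k => (x (next_dyadic T t (k + N)) w)%:E) = (right_lim T (x^~ w) t)%:E) *
    (limn_esup (fun k => (x (next_dyadic T t (k + N)) w)%:E) = (right_lim T (x^~ w) t)%:E).
    by apply: cvg_limn_einf_sup; apply: cvg_EFin; [exact: nearW|exact: h].
  by [].
apply/measP => //; apply: measurable_fun_ifT.
- apply: (measurable_fun_bool true); rewrite setTI.
  have -> : (fun w => `[< good_paths w >]) @^-1` [set true] = good_paths.
    by apply/seteqP; split => w /=; [move/asboolP|move=> gw; apply/asboolP].
  by rewrite /measurable/= sigma_algebra_id//; exact: good_pathsF.
- apply: measurableT_comp; first exact: fine_measurable.
  apply: measurable_fun_limn_esup => k; apply/measurable_EFinP.
  have [D1 D2 _] := next_dyadicP T0 (k + N) tT.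
  apply/measP => //; apply: measS (xP (dyadics_itv T0 D1)).1.2.
  apply: filtrationS => //; first by have /andP[] := dyadics_itv T0 D1.
  by apply: ltW; apply: HN; exact: leq_addl.
- exact: measurable_cst.
Qed.

(** Along the dyadic times decreasing to t the projections have nonincreasing norms, hence converge
    in L2. The limit is the right limit almost surely, and it is tested against U in L2(F_t), which
    is a legitimate test function at all those later times. *)
Lemma reg_L2proj t : 0 <= t < T -> L2proj P (F t) xi (reg t).
Proof.
move=> tT; have /andP[t0 tT'] := tT.
have tT2 : 0 <= t <= T by rewrite t0 ltW.
have aF := filtration_adm tT2.
pose q k := next_dyadic T t k; pose y k := x (q k).
have qT k : 0 <= q k <= T by have [D _ _] := next_dyadicP T0 k tT; exact: dyadics_itv D.
have qmono : {homo q : n m / (n <= m)%N >-> m <= n}.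
  by apply/nonincreasing_seqP => n; exact: next_dyadic_noninc.
have sy k : sqint P (y k) by case: (xP (qT k)) => [[]].
have dy k l : (k <= l)%N -> dist2 P (y k) (y l) = dot P (y k) (y k) - dot P (y l) (y l).
  move=> kl; apply: (dist2_L2proj_mono (filtration_adm (qT l)) (filtration_adm (qT k)) _ sxi (xP (qT l)) (xP (qT k))).
  apply: filtrationS (qmono _ _ kl) _; first by have /andP[] := qT l.
  by have /andP[] := qT k.
have yc : L2cauchy P y.
  have cv : cvgn (fun k => dot P (y k) (y k)).
    apply: nonincreasing_is_cvgn.
      by move=> k l kl; rewrite -subr_ge0 -dy//; exact: dot_ge0.
    by exists 0 => _ [k _ <-]; exact: dot_ge0.
  move=> e e0; have [l yl] := (cvg_ex _).1 cv.
  have [N _ HN] := (cvgrPdist_le _ _).1 yl _ (divr_gt0 e0 (ltr0Sn R 1)).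
  exists N => m n Nm Nn; have := HN m Nm; have := HN n Nn => /=.
  rewrite !ler_norml => /andP[a1 a2] /andP[b1 b2].
  have [mn|/ltnW nm] := leqP m n; last rewrite dist2C.
    by rewrite dy//; lra.
  by rewrite dy//; lra.
have [phi /= [phi_ge sf yf aef]] := riesz_fischer sy yc.
set f := (fun w => _) in sf yf aef.
(* The L2 limit and the pathwise limit agree because a subsequence converges almost everywhere to
   the former. *)
have fr : {ae P, forall w, f w = reg t w}.
  have gd : {ae P, forall w, good_paths w} by exact: bad_paths_negligible.
  apply: filterS2 aef gd => w fw gw.
  have h := right_lim_cvg T0 gw tT.
  have phiy : phi k @[k --> \oo] --> \oo.
    by apply/cvgnyPge => A; exists A => // k /= Ak; apply: leq_trans Ak (phi_ge k).
  have h' : y (phi k) w @[k --> \oo] --> right_lim T (x^~ w) t by exact: (cvg_comp _ _ phiy h).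
  rewrite /reg leNgt tT' /=; case: asboolP => // _.
  transitivity (lim (y (phi k) w @[k --> \oo])); first by apply/esym; exact: cvg_lim fw.
  exact: cvg_lim h'.
have Gr : L2of P (F t) (reg t).
  split; last exact: reg_meas.
  apply: eq_ae_sqint sf _ fr; apply: meas_measurable (reg_meas tT).
  by case: aF.
split => // U GU; have sU := L2of_sqint GU; have sr := L2of_sqint Gr.
rewrite dotBl// -(eq_ae_dot sf sr sU fr).
have yU k : dot P xi U = dot P (y k) U.
  have [D1 D2 _] := next_dyadicP T0 k tT.
  have := (xP (qT k)).2 U; rewrite -/(y k) dotBl// => h; apply/eqP; rewrite -subr_eq0; apply/eqP/h.
  apply: L2ofS GU; apply: filtrationS => //; first exact: ltW.
  by have /andP[] := qT k.
apply/eqP; rewrite -sqrf_eq0 eq_le sqr_ge0 andbT.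
apply/ler_addgt0Pr => e e0; rewrite add0r.
have e'0 : 0 < e / (dot P U U + 1) by rewrite divr_gt0// ltr_wpDl// dot_ge0.
have [N /(_ N (leqnn _)) HN] := yf _ e'0.
rewrite (yU N) -dotBl//; apply: le_trans (cauchy_schwarz (sqintB (sy N) sf) sU) _.
rewrite -/(dist2 P (y N) f); have := dot_ge0 P U; have := dot_ge0 P (fun w => y N w - f w).
rewrite -/(dist2 P (y N) f); move: HN; rewrite ler_pdivlMr; last by rewrite ltr_wpDl// dot_ge0.
move: (dist2 _ _ _) (dot P U U) => *; nra.
Qed.

End conditional_expectations.

Theorem cadlag_version (xi : Omega -> R) : L2of P (F T) xi ->
  exists N : R -> Omega -> R, [/\ cadlag T N, N T = xi &
    forall t, 0 <= t <= T -> L2proj P (F t) xi (N t)].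
Proof.
move=> Fxi; have sxi := L2of_sqint Fxi.
(* The versions are chosen at each time without any coherence; before T, [reg] reads them at dyadic
   times only. *)
have /choice[x xP] : forall t, exists V, 0 <= t <= T -> L2proj P (F t) xi V.
  move=> t; case: (boolP (0 <= t <= T)) => [tT|_]; last by exists xi.
  by have [V] := L2proj_ex (filtration_adm tT) sxi; exists V.
exists (reg xi x); split.
- exact: reg_cadlag.
- by apply/funext => w; rewrite /reg lexx.
- move=> t /andP[t0]; rewrite le_eqVlt => /predU1P[->|tT]; last first.
    by apply: reg_L2proj => //; rewrite t0.
  rewrite (_ : reg xi x T = xi); last by apply/funext => w; rewrite /reg lexx.
  split => // U GU; rewrite (_ : (fun w => _) = fun=> 0) ?dot0l//.
  by apply/funext => w; rewrite subrr.
Qed.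

End regularization.

(** * The measure of the bracket on the predictable sigma-algebra *)

Section mixture.
Context d d' (X : measurableType d) (Y : measurableType d') (R : realType).
Variables (mu : {measure set X -> \bar R}) (nu : X -> {measure set Y -> \bar R}).
Local Open Scope ereal_scope.

(** Measurability of the kernel is a phantom argument: sigma-additivity rests on it, and the measure
    structure must recover it from the term. *)
Definition mixture of (forall U, measurable U -> measurable_fun setT (nu ^~ U)) :=
  fun U : set Y => \int[mu]_x nu x U.

Hypothesis mnu : forall U, measurable U -> measurable_fun setT (nu ^~ U).

Let mixture0 : mixture mnu set0 = 0.
Proof. by rewrite /mixture integral0_eq. Qed.

Let mixture_ge0 U : 0 <= mixture mnu U.
Proof. exact: integral_ge0. Qed.

Let mixture_sigma_additive : semi_sigma_additive (mixture mnu).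
Proof.
move=> U mU tU mUU; rewrite /mixture.
under eq_integral do rewrite measure_semi_bigcup//.
rewrite integral_nneseries// => [|n]; last exact: mnu.
by apply: is_cvg_nneseries => n _ _; exact: integral_ge0.
Qed.

HB.instance Definition _ := isMeasure.Build _ _ R (mixture mnu)
  mixture0 mixture_ge0 mixture_sigma_additive.

Import HBNNSimple.

Let ge0_integral_mixture_nnsfun (g : {nnsfun Y >-> R}) :
  \int[mixture mnu]_y (g y)%:E = \int[mu]_x \int[nu x]_y (g y)%:E.
Proof.
rewrite integralT_nnsfun sintegralE.
under [RHS]eq_integral do rewrite integralT_nnsfun sintegralE.
rewrite ge0_integral_fsum//=; last 2 first.
- move=> r; apply: measurable_funeM; apply: mnu.
  by rewrite -[_ @^-1` _]setTI; exact: measurable_funP.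
- by move=> r x _; exact: nnsfun_mulemu_ge0.
apply: eq_fsbigr => r _.
have mr : measurable_fun setT (fun x => nu x (g @^-1` [set r])).
  by apply: mnu; rewrite -[_ @^-1` _]setTI; exact: measurable_funP.
have [r0|r0] := leP 0%R r; first by rewrite ge0_integralZl.
rewrite (preimage_nnfun0 g r0) measure0 mule0 integral0_eq// => x _.
by rewrite measure0 mule0.
Qed.

(** Proved for simple functions, then extended by monotone convergence, used twice on the right: for
    each [nu x] and then for [mu]. *)
Lemma ge0_integral_mixture (f : Y -> \bar R) : (forall y, 0 <= f y) ->
  measurable_fun setT f -> \int[mixture mnu]_y f y = \int[mu]_x \int[nu x]_y f y.
Proof.
move=> f0 mf; pose g := nnsfun_approx measurableT mf.
have mg n : measurable_fun setT (fun y : Y => (g n y)%:E) by exact/measurable_EFinP.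
have g0 n (y : Y) : 0 <= (g n y)%:E by rewrite lee_fin.
have ndg (y : Y) : {homo (fun n => (g n y)%:E) : a b / (a <= b)%N >-> a <= b}.
  by move=> a b ab; rewrite lee_fin; exact/lefP/nd_nnsfun_approx.
have fE y : f y = lim ((g n y)%:E @[n --> \oo]).
  by apply/esym/cvg_lim => //; exact: cvg_nnsfun_approx.
have mono (m : {measure set Y -> \bar R}) :
    \int[m]_y f y = lim ((\int[m]_y (g n y)%:E) @[n --> \oo]).
  by under eq_integral do rewrite fE; rewrite monotone_convergence.
rewrite mono; under [RHS]eq_integral do rewrite mono.
rewrite monotone_convergence//; last 3 first.
- by move=> n; apply: measurable_fun_integral_kernel => //; exact: mnu.
- by move=> n x _; exact: integral_ge0.
- by move=> x _ a b ab; apply: ge0_le_integral => // y _; exact: ndg.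
by congr (lim (_ @ \oo)); apply/funext => n; exact: ge0_integral_mixture_nnsfun.
Qed.

End mixture.

Section restricted_integral.
Context d (Y : measurableType d) (R : realType).
Local Open Scope ereal_scope.

Lemma ge0_integral_mrestr (mu : {measure set Y -> \bar R}) D (mD : measurable D)
    (f : Y -> \bar R) : (forall y, 0 <= f y) -> measurable_fun setT f ->
  \int[mrestr mu mD]_y f y = \int[mu]_(y in D) f y.
Proof.
move=> f0 mf.
rewrite (@ge0_negligible_integral _ _ _ _ setT (~` D))//; last 2 first.
- exact: measurableC.
- by rewrite /= /mrestr setICl measure0.
rewrite setTD setCK; apply: eq_measure_integral => C mC CD.
by rewrite /= /mrestr setIidl.
Qed.

End restricted_integral.

Section predictable_sets.
Context d (Omega : measurableType d) (R : realType).
Variables (T : R) (F : R -> set_system Omega).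
Hypothesis T0 : 0 < T.
Hypothesis filtF : filtration T F.

Local Notation PF := (g_sigma_algebraType (predictable_rectangle T F)).
Local Notation DT := (`[0, T]%classic `*` [set: Omega]).

Lemma filtrationT t : 0 <= t <= T -> F t setT.
Proof.
move=> tT; have [[s0 sC _] _] := filtration_adm filtF tT.
by rewrite -(setD0 setT); exact: sC.
Qed.

Lemma filtration0 t : 0 <= t <= T -> F t set0.
Proof. by move=> tT; have [[s0 _ _] _] := filtration_adm filtF tT. Qed.

Lemma filtrationI t B C : 0 <= t <= T -> F t B -> F t C -> F t (B `&` C).
Proof.
move=> tT FB FC; have [sF _] := filtration_adm filtF tT.
have : measurable ((B : set (g_sigma_algebraType (F t))) `&` C).
  by apply: measurableI; rewrite /measurable/= sigma_algebra_id.
by rewrite /measurable/= sigma_algebra_id.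
Qed.

Lemma measurable_rectangle s t B : 0 <= s -> s <= t -> t <= T -> F s B ->
  measurable (`]s, t]%classic `*` B : set PF).
Proof.
by move=> *; apply: sub_sigma_algebra; right; exists s, t, B.
Qed.

Lemma predictable_rectangle_subT : predictable_rectangle T F `<=` [set D | D `<=` DT].
Proof.
move=> _ [[B FB ->]|[s [t [B [s0 st tT FB ->]]]]] [u w] /= [].
  by move=> -> _; split => //=; rewrite in_itv/= lexx ltW.
rewrite in_itv/= => /andP[su ut] _; split => //; rewrite in_itv/=.
by rewrite (le_trans s0 (ltW su)) (le_trans ut).
Qed.

Lemma measurable_DT : measurable (DT : set PF).
Proof.
have -> : DT = ([set 0] `*` setT) `|` (`]0, T]%classic `*` setT) :> set (R * Omega).
  apply/seteqP; split => -[t w] /=; rewrite !in_itv/=.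
    move=> [/andP[]]; rewrite le_eqVlt => /predU1P[<-|t0] tT _; first by left.
    by right; rewrite t0 tT.
  move=> [[-> _]|[/andP[t0 tT] _]]; split => //; first by rewrite lexx ltW.
  by rewrite (ltW t0).
apply: measurableU; last by apply: measurable_rectangle => //; [exact: ltW|apply: filtrationT; rewrite lexx ltW].
apply: sub_sigma_algebra; left; exists setT => //.
by apply: filtrationT; rewrite lexx ltW.
Qed.

(** [predictable_sigma] is a sigma-algebra on [0, T] x Omega, while measures need one on a whole
    type; [PF] is generated by the same rectangles on R x Omega. This inclusion and
    [predictable_sigma_trace] pass between the two. *)
Lemma predictable_sigma_measurable D : predictable_sigma T F D -> measurable (D : set PF).
Proof.
apply: smallest_sub; last exact: sub_sigma_algebra.
split; first exact: measurable0.
- by move=> C mC; apply: measurableD => //; exact: measurable_DT.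
- by move=> C mC; exact: bigcup_measurable.
Qed.

Lemma predictable_sigma_trace D : measurable (D : set PF) -> predictable_sigma T F (DT `&` D).
Proof.
move: D; rewrite /measurable/=; apply: smallest_sub.
  have [s0 sC sU] := smallest_sigma_algebra DT (predictable_rectangle T F).
  split => [|C sDC|C sDC] /=.
  - by rewrite setI0.
  - have := sC _ sDC; rewrite /predictable_sigma; congr (smallest _ _).
    by apply/seteqP; split => x /=; tauto.
  - by rewrite setI_bigcupr; exact: sU.
move=> D RD /=; rewrite setIidr; last exact: predictable_rectangle_subT.
exact: sub_sigma_algebra.
Qed.

Lemma predictable_measurable (Z : R -> Omega -> R) : predictable T F Z ->
  measurable_fun (setT : set PF) ((fun tw => Z tw.1 tw.2) \_ DT).
Proof.
move=> pZ; apply/(measurable_restrictT _ measurable_DT).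
move=> _ Y mY; apply: predictable_sigma_measurable; apply: pZ.
by exists Y.
Qed.

Lemma measurable_predictable (g : PF -> R) : measurable_fun setT g ->
  predictable T F (fun t w => g (t, w)).
Proof.
move=> mg _ [Y mY <-].
have := predictable_sigma_trace (mg measurableT Y mY); rewrite setTI.
congr (predictable_sigma T F (_ `&` _)).
by apply/seteqP; split => -[].
Qed.

(** The pi-system for the pi-lambda arguments on predictable sets: measurability of the path
    measures and density of simple processes. *)
Lemma predictable_rectangleI : setI_closed (predictable_rectangle T F).
Proof.
have T00 : 0 <= (0 : R) <= T by rewrite lexx ltW.
have R0 : predictable_rectangle T F set0.
  by left; exists set0; [exact: filtration0|rewrite setX0].
have zero_oc s t B C : 0 <= s -> ([set 0] `*` B) `&` (`]s, t]%classic `*` C) = set0 :> set (R * Omega).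
  move=> s0; apply/seteqP; split => -[u w] //= [[-> _]] [].
  by rewrite in_itv/= ltNge s0.
move=> _ _ [[B FB ->]|[s [t [B [s0 st tT FB ->]]]]] [[C FC ->]|[s' [t' [C [s0' st' tT' FC ->]]]]].
- by rewrite -setXI setIid; left; exists (B `&` C) => //; exact: filtrationI.
- by rewrite zero_oc.
- by rewrite setIC zero_oc.
- rewrite -setXI -itv_setI.
  have m0 : 0 <= Num.max s s' by rewrite le_max s0.
  have [mm|mm] := leP (Num.max s s') (Num.min t t'); last first.
    rewrite (_ : [set` _] = set0) ?set0X//.
    apply/seteqP; split => u //=; rewrite in_itvI !in_itv/= => /andP[/andP[su ut] /andP[su' ut']].
    have : u <= Num.min t t' by rewrite le_min ut ut'.
    by rewrite leNgt (lt_trans mm)// gt_max su su'.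
  right; exists (Num.max s s'), (Num.min t t'), (B `&` C); split => //.
  + by rewrite ge_min tT.
  + have mT : Num.max s s' <= T by rewrite (le_trans mm)// ge_min tT.
    have sm : s <= Num.max s s' by rewrite le_max lexx.
    have sm' : s' <= Num.max s s' by rewrite le_max lexx orbT.
    apply: filtrationI; first by rewrite m0.
      exact: (filtrationS filtF s0 sm mT) FB.
    exact: (filtrationS filtF s0' sm' mT) FC.
  + congr (_ `*` _); apply/seteqP; split => u /=; rewrite in_itvI !in_itv/= gt_max le_min.
      by move=> /andP[/andP[-> ->] /andP[-> ->]].
    by move=> /andP[/andP[-> ->] /andP[-> ->]].
Qed.

Definition time_slice (w : Omega) : R -> PF := fun t => (t, w).

Lemma measurable_time_slice w : measurable_fun setT (time_slice w).
Proof.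
apply: (@measurability _ _ R PF setT (time_slice w) (predictable_rectangle T F) erefl).
move=> _ [_ [[B FB ->]|[s [t [B [s0 st tT FB ->]]]]] <-]; rewrite setTI.
- have [Bw|Bw] := pselect (B w).
    rewrite (_ : _ @^-1` _ = [set 0]); first exact: measurable_set1.
    by apply/seteqP; split => u /= => [[]|].
  by rewrite (_ : _ @^-1` _ = set0)//; apply/seteqP; split => u //= [].
- have [Bw|Bw] := pselect (B w).
    rewrite (_ : _ @^-1` _ = `]s, t]%classic); first exact: measurable_itv.
    by apply/seteqP; split => u /= => [[]|].
  by rewrite (_ : _ @^-1` _ = set0)//; apply/seteqP; split => u //= [].
Qed.

End predictable_sets.

Section bracket_measure.
Context d (Omega : measurableType d) (R : realType) (P : probability Omega R).
Variables (T : R) (F : R -> set_system Omega) (A : Omega -> cumulative R R).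
Hypothesis T0 : 0 < T.
Hypothesis filtF : filtration T F.
Hypothesis mA : forall t, 0 <= t <= T -> measurable_fun setT (fun w => A w t).
Hypothesis iA : forall t, 0 <= t <= T -> P.-integrable setT (fun w => (A w t)%:E).

Local Notation PF := (g_sigma_algebraType (predictable_rectangle T F)).

Lemma lebesgue_stieltjes_itvoc (f : cumulative R R) (a b : R) : a <= b ->
  lebesgue_stieltjes_measure f `]a, b]%classic = (f b - f a)%:E.
Proof.
move=> ab; rewrite /lebesgue_stieltjes_measure/= /measure_extension.
by rewrite measurable_mu_extE/=; [rewrite wlength_itv_bnd|exact: is_ocitv].
Qed.

Let mI : measurable (`]0, T]%classic : set R) := measurable_itv `]0, T].

(** The path measure dA(w) on ]0, T], carried into R x Omega along t -> (t, w). Integrating it over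
    w gives d<M> (x) dP on the predictable sigma-algebra. *)
Definition bracket_slice (w : Omega) : set PF -> \bar R :=
  pushforward (mrestr (lebesgue_stieltjes_measure (A w)) mI) (time_slice T F w).

Lemma bracket_sliceE w U : bracket_slice w U =
  lebesgue_stieltjes_measure (A w) ((time_slice T F w) @^-1` U `&` `]0, T]%classic).
Proof. by []. Qed.

Let bracket_slice0 w : bracket_slice w set0 = 0%E.
Proof. by rewrite bracket_sliceE preimage_set0 set0I measure0. Qed.

Let bracket_slice_ge0 w U : (0 <= bracket_slice w U)%E.
Proof. exact: (measure_ge0 (mrestr (lebesgue_stieltjes_measure (A w)) mI)). Qed.

Let bracket_slice_sigma_additive w : semi_sigma_additive (bracket_slice w).
Proof.
move=> U mU tU mUU.
have mt := @measurable_time_slice _ _ _ T F w.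
have ms V : measurable V -> measurable (time_slice T F w @^-1` V).
  by move=> mV; rewrite -[X in measurable X]setTI; exact: mt.
have := @measure_semi_sigma_additive _ _ _ (mrestr (lebesgue_stieltjes_measure (A w)) mI)
  (fun n => time_slice T F w @^-1` U n).
rewrite -preimage_bigcup; apply.
- by move=> n; exact: ms.
- apply/trivIsetP => /= i j _ _ ij; rewrite -preimage_setI.
  by move/trivIsetP : tU => /(_ _ _ _ _ ij) ->//; rewrite preimage_set0.
- exact: ms.
Qed.

HB.instance Definition _ w := isMeasure.Build _ _ R (bracket_slice w)
  (bracket_slice0 w) (bracket_slice_ge0 w) (@bracket_slice_sigma_additive w).

Lemma bracket_slice_rectangle w s t B : 0 <= s -> s <= t -> t <= T ->
  bracket_slice w (`]s, t]%classic `*` B) = (\1_B w * (A w t - A w s))%:E.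
Proof.
move=> s0 st tT; rewrite bracket_sliceE indicE.
case: (boolP (w \in B)) => [/set_mem Bw|/negP Bw].
  rewrite mul1r -lebesgue_stieltjes_itvoc//; congr (lebesgue_stieltjes_measure _ _).
  apply/seteqP; split => u /=; rewrite !in_itv/=; first by move=> [[]].
  by move=> /andP[su ut]; rewrite su ut (le_lt_trans s0 su) (le_trans ut tT).
rewrite mul0r (_ : _ `&` _ = set0) ?measure0//.
by apply/seteqP; split => u //= [[_ /mem_set]].
Qed.

Lemma bracket_slice_zero w B : bracket_slice w ([set 0] `*` B) = 0%E.
Proof.
rewrite bracket_sliceE (_ : _ `&` _ = set0) ?measure0//.
by apply/seteqP; split => u //= [[-> _]]; rewrite in_itv/= ltxx.
Qed.

Lemma bracket_sliceT w : bracket_slice w setT = (A w T - A w 0)%:E.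
Proof. by rewrite bracket_sliceE preimage_setT setTI lebesgue_stieltjes_itvoc// ltW. Qed.

(** On rectangles the mass is 1_B (A_t - A_s). The pi-lambda theorem does the rest; complements are
    allowed because each path measure is finite. *)
Lemma measurable_bracket_slice U : measurable U ->
  measurable_fun setT (bracket_slice ^~ U).
Proof.
have zT : 0 <= (0 : R) <= T by rewrite lexx ltW.
have TT : 0 <= T <= T by rewrite lexx ltW.
move: U; apply: (@dynkin_induction _ PF _
  (fun U => measurable_fun setT (bracket_slice ^~ U)) erefl
  (predictable_rectangleI T0 filtF)).
- under eq_fun do rewrite bracket_sliceT.
  by apply/measurable_EFinP; apply: measurable_funB; exact: mA.
- move=> _ [[B FB ->]|[s [t [B [s0 st tT FB ->]]]]].
    rewrite (_ : (fun w => _) = cst 0%E); first exact: measurable_cst.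
    by apply/funext => w; rewrite bracket_slice_zero.
  under eq_fun do rewrite bracket_slice_rectangle//.
  apply/measurable_EFinP; apply: measurable_funM.
    have [_ Fm] : adm (F s) by apply: (filtration_adm filtF); rewrite s0 (le_trans st).
    by apply: measurable_indic; exact: Fm.
  by apply: measurable_funB; apply: mA; rewrite ?s0 ?(le_trans st) ?tT ?(le_trans s0).
- move=> S mS mf.
  have -> : (fun w => bracket_slice w (~` S)) =
      (fun w => bracket_slice w setT - bracket_slice w S)%E.
    apply/funext => w; rewrite -setTD measureD//; first by rewrite setTI.
    by rewrite [X in (X < _)%E]bracket_sliceT ltry.
  apply: emeasurable_funB => //.
  under eq_fun do rewrite bracket_sliceT.
  by apply/measurable_EFinP; apply: measurable_funB; exact: mA.
- move=> G mG tG mf.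
  under eq_fun do rewrite measure_bigcup//.
  apply: ge0_emeasurable_sum; last by move=> n _; exact: mf.
  by move=> n w _ _; exact: measure_ge0.
Qed.

(* Integrability is a phantom argument, from which the finiteness of the measure
   is inferred. *)
Definition bracket_measure_of
    of (forall t, 0 <= t <= T -> P.-integrable setT (fun w => (A w t)%:E)) :
  set PF -> \bar R := mixture P measurable_bracket_slice.

Local Notation bracket_measure := (bracket_measure_of iA).

HB.instance Definition _ := Measure.on bracket_measure.

Lemma bracket_measureE U : bracket_measure U = (\int[P]_w bracket_slice w U)%E.
Proof. by []. Qed.

Let bracket_measure_fin : fin_num_fun bracket_measure.
Proof.
move=> U mU.
have zT : 0 <= (0 : R) <= T by rewrite lexx ltW.
have TT : 0 <= T <= T by rewrite lexx ltW.
suff : (bracket_measure setT < +oo)%E.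
  move=> h; rewrite ge0_fin_numE//; apply: le_lt_trans h.
  by apply: le_measure; rewrite ?inE.
rewrite bracket_measureE; under eq_integral do rewrite bracket_sliceT.
apply: integrable_lty => //; under eq_fun do rewrite EFinB.
by apply: integrableB => //; exact: iA.
Qed.

HB.instance Definition _ := Measure_isFinite.Build _ _ _ bracket_measure bracket_measure_fin.

(** The iterated integrals of the definitions become integrals for a single finite measure, so that
    the L2 theory applies. [f] is read on ]0, T] only, and may differ from the measurable [g]
    elsewhere. *)
Lemma ge0_integral_bracket (f : R -> Omega -> R) (g : PF -> R) :
  (forall tw, 0 <= g tw) -> measurable_fun setT g ->
  (forall t w, 0 < t <= T -> f t w = g (t, w)) ->
  bracket_expectation P T A f = (\int[bracket_measure]_tw (g tw)%:E)%E.
Proof.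
move=> g0 mg fg.
rewrite ge0_integral_mixture//; last exact/measurable_EFinP.
apply: eq_integral => w _.
have mt : measurable_fun (setT : set (measurableTypeR R)) (time_slice T F w).
  exact: measurable_time_slice.
have mEg : measurable_fun setT (EFin \o g) by exact/measurable_EFinP.
have Eg0 : {in [set: PF], forall y, (0 <= (EFin \o g) y)%E} by move=> y _; rewrite lee_fin.
have := ge0_integral_pushforward mt (mrestr (lebesgue_stieltjes_measure (A w)) mI)
  measurableT mEg Eg0.
rewrite preimage_setT ge0_integral_mrestr; last 2 first.
- by move=> t; rewrite lee_fin; exact: g0.
- exact: measurableT_comp mEg mt.
move=> H; apply: etrans (etrans (esym H) _); last exact: eq_measure_integral.
by apply: eq_integral => t; rewrite inE/= in_itv/= => /fg ->.
Qed.

End bracket_measure.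

(** * Square integrability and bounded test functions *)

Section L2_predicates.
Context d (E : measurableType d) (R : realType).

Lemma Lfun2_sqint (mu : {measure set E -> \bar R}) (f : E -> R) :
  f \in Lfun mu 2%:E <-> sqint mu f.
Proof.
split=> [fL|[mf f2]].
  split; last exact: Lfun2_integrable_sqr.
  by move: fL; rewrite inE => /andP[]; rewrite inE.
rewrite inE; apply/andP; split; rewrite inE//= /finite_norm unlock poweR_lty//.
have /integrableP[_] := f2; apply: le_lt_trans.
rewrite le_eqVlt; apply/orP; left; apply/eqP; apply: eq_integral => x _.
by rewrite poweR_EFin powR_mulrn// real_normK ?num_real// gee0_abs// lee_fin sqr_ge0.
Qed.

Lemma sum_ind_truncn (x : R) n : 0 <= x ->
  \sum_(i < n) ((i.+1%:R <= x)%R : nat) = minn n (Num.truncn x).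
Proof.
move=> x0; elim: n => [|n IH]; first by rewrite big_ord0 min0n.
rewrite big_ord_recr/= IH -truncn_ge_nat//.
by case: leqP => /=; lia.
Qed.

End L2_predicates.

Section bounded_test_functions.
Context d (Omega : measurableType d) (R : realType) (P : probability Omega R).

(* A bounded nonnegative K is within 1/n of n^-1 times the sum of the indicators
   of the sets K >= i/n. *)
Lemma integral_bounded_eq0 (G : set_system Omega) (X K : Omega -> R) (c : R) : adm G ->
  P.-integrable setT (EFin \o X) -> (forall B, G B -> \int[P]_(w in B) X w = 0) ->
  meas G K -> (forall w, `|K w| <= c) -> \int[P]_w (K w * X w) = 0.
Proof.
move=> aG iX X0 mK Kc; have [sG Gm] := aG.
have iKX (L : Omega -> R) (b : R) : measurable_fun setT L -> (forall w, `|L w| <= b) ->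
    P.-integrable setT (EFin \o (fun w => L w * X w)).
  move=> mL Lb; apply: (@le_integrable _ _ _ P setT measurableT _ (fun w => b%:E * (EFin \o X) w)%E).
  - apply/measurable_EFinP; apply: measurable_funM => //.
    by apply/measurable_EFinP; case/integrableP : iX.
  - move=> w _ /=; rewrite lee_fin !normrM ler_wpM2r//.
    by rewrite (le_trans (Lb w))// ler_norm.
  - exact: integrableZl.
have GT : G setT by case: sG => s0 sC _; rewrite -(setD0 setT); exact: sC.
have c0 : 0 <= c by rewrite (le_trans _ (Kc point)).
(* The shift makes the test function nonnegative, with values in [0, 2 c]; the constant c
   contributes nothing, by the hypothesis on the whole space. *)
pose L w := K w + c.
have L0 w : 0 <= L w by have := Kc w; rewrite ler_norml /L => /andP[]; lra.
have L2c w : L w <= 2 * c by have := Kc w; rewrite ler_norml /L => /andP[]; lra.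
have mL : meas G L.
  by apply/measP => //; apply: measurable_funD => //; exact/(measP _ sG).
have mKO := meas_measurable Gm mK; have mLO := meas_measurable Gm mL.
suff LX0 : \int[P]_w (L w * X w) = 0.
  have -> : \int[P]_w (K w * X w) = \int[P]_w (L w * X w - c * X w).
    by apply: eq_Rintegral => w _; rewrite /L; ring.
  rewrite RintegralB//; last 2 first.
  - by apply: (iKX _ (2 * c)) => // w; rewrite ger0_norm.
  - by apply: (iKX _ `|c|).
  by rewrite LX0 RintegralZl// X0// mulr0 subr0.
pose EX := \int[P]_w `|X w|.
have EX0 : 0 <= EX by apply: Rintegral_ge0.
apply/eqP; rewrite -normr_le0; apply/ler_addgt0Pr => e e0; rewrite add0r.
have e'0 : 0 < e / (EX + 1) by rewrite divr_gt0// ltr_wpDl.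
have [n _ /(_ n (leqnn n))/= ne] := near_infty_natSinv_lt (PosNum e'0).
pose B i := [set w | i.+1%:R <= n.+1%:R * L w].
have GB i : G (B i).
  have : meas G (fun w => n.+1%:R * L w).
    by apply/measP => //; apply: measurable_funM => //; exact/(measP _ sG).
  move/(meas_set1 aG) => /(_ `[i.+1%:R, +oo[%classic (measurable_itv _)).
  by congr G; apply/seteqP; split => w /=; rewrite in_itv/= andbT.
(* Enough levels to reach the upper bound 2 c of [L], so that counting them gives the integer part
   of (n + 1) L exactly. *)
pose N := (Num.truncn (n.+1%:R * (2 * c))).
pose Ln w : R := n.+1%:R^-1 * \sum_(i < N) \1_(B i) w.
have LnE w : Ln w = n.+1%:R^-1 * (Num.truncn (n.+1%:R * L w))%:R.
  rewrite /Ln; congr (_ * _); transitivity ((\sum_(i < N) ((i.+1%:R <= n.+1%:R * L w)%R : nat))%:R : R).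
    rewrite natr_sum; apply: eq_bigr => i _; rewrite indicE; congr (_%:R).
    by congr nat_of_bool; apply/idP/idP => [/set_mem|h]//; apply/mem_set.
  rewrite sum_ind_truncn ?mulr_ge0//; congr (_%:R); apply/minn_idPr.
  by apply: le_truncn; rewrite ler_pM2l.
have LnL w : `|L w - Ln w| <= n.+1%:R^-1.
  have z0 : 0 <= n.+1%:R * L w by rewrite mulr_ge0.
  have /andP[h1 h2] := truncn_itv z0; rewrite LnE.
  have -> : L w - n.+1%:R^-1 * (Num.truncn (n.+1%:R * L w))%:R =
            n.+1%:R^-1 * (n.+1%:R * L w - (Num.truncn (n.+1%:R * L w))%:R).
    by rewrite mulrBr mulrA mulVf ?pnatr_eq0// mul1r.
  rewrite normrM ger0_norm ?invr_ge0// -[leRHS]mulr1 ler_pM2l ?invr_gt0//.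
  by rewrite ger0_norm ?subr_ge0// lerBlDl natr1 ltW.
have mB i : measurable (B i) by exact: Gm.
have mLn : measurable_fun setT Ln.
  by apply: measurable_funM => //; apply: measurable_sum => i; exact: measurable_indic.
have iB i : P.-integrable setT (EFin \o (fun w => \1_(B i) w * X w)).
  by apply: (iKX _ 1) => [|w]; [exact: measurable_indic|rewrite indicE; case: (_ \in _); rewrite ?normr1 ?normr0].
have LnX : \int[P]_w (Ln w * X w) = 0.
  have -> : \int[P]_w (Ln w * X w) = \int[P]_w (n.+1%:R^-1 * \sum_(i < N) (\1_(B i) w * X w)).
    by apply: eq_Rintegral => w _; rewrite /Ln -mulrA mulr_suml.
  have [isum sum0] : P.-integrable setT (EFin \o (fun w => \sum_(i < N) (\1_(B i) w * X w))) /\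
      \int[P]_w (\sum_(i < N) (\1_(B i) w * X w)) = 0.
    elim: N {LnE Ln LnL mLn} => [|m [IH1 IH2]].
      rewrite (_ : (fun w => \sum_(i < 0) _) = cst 0); last by apply/funext => w; rewrite big_ord0.
      by split; [exact: finite_measure_integrable_cst|rewrite Rintegral_cst// mul0r].
    rewrite (_ : (fun w => _) = (fun w => \sum_(i < m) (\1_(B i) w * X w) + \1_(B m) w * X w)); last first.
      by apply/funext => w; rewrite big_ord_recr.
    split.
      rewrite (_ : _ \o _ = (fun w => (\sum_(i < m) (\1_(B i) w * X w))%:E + (\1_(B m) w * X w)%:E)%E)//.
      exact: (integrableD measurableT IH1 (iB m)).
    rewrite RintegralD// IH2 add0r -(X0 _ (GB m)) [RHS]Rintegral_mkcond.
    apply: eq_Rintegral => w _; rewrite patchE indicE.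
    by case: (_ \in _); rewrite ?mul1r ?mul0r.
  by rewrite RintegralZl// sum0 mulr0.
rewrite -[X in `|X|]subr0 -LnX -RintegralB//; last 2 first.
- by apply: (iKX _ (2 * c)) => // w; rewrite ger0_norm.
- apply: (iKX _ (2 * c + n.+1%:R^-1)) => // w.
  have := LnL w; have := L0 w; have := L2c w; rewrite !ler_norml => h1 h2 /andP[h3 h4].
  move: h3 h4 => /=; move: (n.+1%:R^-1) => q h3 h4.
  by apply/andP; split; lra.
apply: le_trans (le_normr_Rintegral _ _) _ => //.
  rewrite (_ : _ \o _ = EFin \o (fun w => (L w - Ln w) * X w)).
    apply: (iKX _ n.+1%:R^-1) => //; exact: measurable_funB.
  by apply/funext => w /=; rewrite mulrBl.
apply: (@le_trans _ _ (n.+1%:R^-1 * EX)).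
  rewrite -RintegralZl//; last exact: integrable_norm.
  apply: le_Rintegral => //.
  - rewrite (_ : _ \o _ = (EFin \o (Num.norm \o (fun w => (L w - Ln w) * X w)))).
      by apply: integrable_norm; apply: (iKX _ n.+1%:R^-1) => //; exact: measurable_funB.
    by apply/funext => w /=; rewrite mulrBl.
  - rewrite (_ : _ \o _ = (fun w => n.+1%:R^-1%:E * (EFin \o (Num.norm \o X)) w)%E)//.
    by apply: integrableZl => //; exact: integrable_norm.
  - by move=> w _; rewrite -mulrBl normrM ler_wpM2r.
move: ne; rewrite ltr_pdivlMr ?ltr_wpDl// => ne; apply: le_trans (ltW ne).
by rewrite ler_pM2l ?invr_gt0// lerDl.
Qed.

End bounded_test_functions.

(** * The isometry for simple processes *)

Section martingale_bracket.
Context d (Omega : measurableType d) (R : realType) (P : probability Omega R).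
Variables (T : R) (F : R -> set_system Omega) (M : R -> Omega -> R)
  (A : Omega -> cumulative R R).
Hypothesis T0 : 0 < T.
Hypothesis filtF : filtration T F.
Hypothesis martM : square_integrable_martingale P T F M.
Hypothesis bracketM : is_predictable_bracket P T F M A.

Lemma martingale_sqint t : 0 <= t <= T -> sqint P (M t).
Proof. by move=> tT; apply/Lfun2_sqint; case: martM => _; apply; rewrite in_itv. Qed.

Lemma martingale_L2of t : 0 <= t <= T -> L2of P (F t) (M t).
Proof.
move=> tT; split; first exact: martingale_sqint.
by case: martM => -[+ _ _] _; apply; rewrite in_itv.
Qed.

Lemma martingale_L2proj s t : 0 <= s -> s <= t -> t <= T -> L2proj P (F s) (M t) (M s).
Proof.
move=> s0 st tT.
have sT : 0 <= s <= T by rewrite s0 (le_trans st).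
have tT' : 0 <= t <= T by rewrite tT (le_trans s0).
apply: cond_exp_L2proj; [exact: filtration_adm sT|exact: martingale_sqint|exact: martingale_sqint|].
by case: martM => -[_ _ +] _; apply.
Qed.

Lemma martingale_dot s t U : 0 <= s -> s <= t -> t <= T -> L2of P (F s) U ->
  dot P U (M t) = dot P U (M s).
Proof.
move=> s0 st tT FU.
have sT : 0 <= s <= T by rewrite s0 (le_trans st).
have tT' : 0 <= t <= T by rewrite tT (le_trans s0).
have := (martingale_L2proj s0 st tT).2 _ FU.
have sU := L2of_sqint FU; have [st' ss'] := (martingale_sqint tT', martingale_sqint sT).
rewrite dotBl// (dotC _ U) (dotC _ U); lra.
Qed.

Let compensated t := fun w => M t w ^+ 2 - A w t.

Let compensated_int t : 0 <= t <= T -> P.-integrable setT (EFin \o compensated t).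
Proof. by move=> tT; case: bracketM => _ _ [_ + _]; apply; rewrite in_itv. Qed.

Let bracketE t : (fun w => A w t) = (fun w => M t w ^+ 2 - compensated t w).
Proof. by apply/funext => w; rewrite /compensated opprB addrC subrK. Qed.

Lemma bracket_measurable t : 0 <= t <= T -> measurable_fun setT (fun w => A w t).
Proof.
move=> tT; rewrite bracketE; apply: measurable_funB.
  by apply: measurable_funX; case: (martingale_sqint tT).
by apply/measurable_EFinP; case/integrableP : (compensated_int tT).
Qed.

Lemma bracket_integrable t : 0 <= t <= T -> P.-integrable setT (fun w => (A w t)%:E).
Proof.
move=> tT; rewrite (_ : (fun w => _) = (fun w => (M t w ^+ 2)%:E - (compensated t w)%:E)%E).
  by apply: integrableB => //; [case: (martingale_sqint tT)|exact: compensated_int].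
by apply/funext => w; rewrite -EFinB; congr EFin; rewrite /compensated opprB addrC subrK.
Qed.

Lemma bounded_mul_integrable (K X : Omega -> R) c : measurable_fun setT K ->
  (forall w, `|K w| <= c) -> P.-integrable setT (EFin \o X) ->
  P.-integrable setT (EFin \o (fun w => K w * X w)).
Proof.
move=> mK Kc iX.
apply: (@le_integrable _ _ _ P setT measurableT _ (fun w => c%:E * (EFin \o X) w)%E).
- apply/measurable_EFinP; apply: measurable_funM => //.
  by apply/measurable_EFinP; case/integrableP : iX.
- move=> w _ /=; rewrite lee_fin !normrM ler_wpM2r//.
  by rewrite (le_trans (Kc w))// ler_norm.
- exact: integrableZl.
Qed.

(** The martingale M^2 - A is tested with [K] between s and t. It is integrable but need not be
    square-integrable, so L2 projections do not apply to it, and [K] is taken bounded. *)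
Lemma bracket_increment s t (K : Omega -> R) c : 0 <= s -> s <= t -> t <= T ->
  meas (F s) K -> (forall w, `|K w| <= c) ->
  dot P (fun w => K w * M t w) (M t) - dot P (fun w => K w * M s w) (M s) =
  \int[P]_w (K w * (A w t - A w s)).
Proof.
move=> s0 st tT mK Kc.
have sT : 0 <= s <= T by rewrite s0 (le_trans st).
have tT' : 0 <= t <= T by rewrite tT (le_trans s0).
have aF := filtration_adm filtF sT.
have mK' := meas_measurable aF.2 mK.
have iD : P.-integrable setT (EFin \o (fun w => compensated t w - compensated s w)).
  rewrite (_ : _ \o _ = (fun w => (compensated t w)%:E - (compensated s w)%:E)%E)//.
  by apply: integrableB => //; exact: compensated_int.
have D0 : forall B, F s B -> \int[P]_(w in B) (compensated t w - compensated s w) = 0.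
  move=> B FB; have mB : measurable B by apply: aF.2.
  have iS u : 0 <= u <= T -> P.-integrable B (EFin \o compensated u).
    by move=> uT; apply: integrableS (compensated_int uT).
  rewrite RintegralB//; try exact: iS.
  case: bracketM => _ _ [_ _ /(_ s t s0 st tT)[_ _ /(_ B FB) e]].
  by rewrite /Rintegral e subrr.
have := integral_bounded_eq0 aF iD D0 mK Kc.
have i2 u : 0 <= u <= T -> P.-integrable setT (EFin \o (fun w => K w * M u w ^+ 2)).
  by move=> uT; apply: (bounded_mul_integrable mK' Kc); case: (martingale_sqint uT).
have iA u : 0 <= u <= T -> P.-integrable setT (EFin \o (fun w => K w * A w u)).
  by move=> uT; apply: (bounded_mul_integrable mK' Kc); exact: bracket_integrable.
have -> : \int[P]_w (K w * (compensated t w - compensated s w)) =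
    (\int[P]_w (K w * M t w ^+ 2 - K w * M s w ^+ 2)) - \int[P]_w (K w * A w t - K w * A w s).
  rewrite -RintegralB//; last 2 first.
  - rewrite (_ : _ \o _ = (fun w => (K w * M t w ^+ 2)%:E - (K w * M s w ^+ 2)%:E)%E)//.
    by apply: integrableB => //; exact: i2.
  - rewrite (_ : _ \o _ = (fun w => (K w * A w t)%:E - (K w * A w s)%:E)%E)//.
    by apply: integrableB => //; exact: iA.
  by apply: eq_Rintegral => w _; rewrite /compensated; ring.
rewrite RintegralB//; [|exact: i2|exact: i2].
under [X in _ - X = 0 -> _]eq_Rintegral do rewrite -mulrBr.
move/eqP; rewrite subr_eq0 => /eqP <-.
by congr (_ - _); apply: eq_Rintegral => w _; ring.
Qed.

Definition piece (l r : R) (h : Omega -> R) :=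
  [/\ 0 <= l, l <= r, r <= T, meas (F l) h & exists K, forall w, `|h w| <= K].

Local Notation PF := (g_sigma_algebraType (predictable_rectangle T F)).

Definition piece_val (l r : R) (h : Omega -> R) : PF -> R :=
  fun tw => h tw.2 * \1_(`]l, r]%classic) tw.1.

Lemma piece_val_bounded l r h K : (forall w, `|h w| <= K) -> forall tw, `|piece_val l r h tw| <= K.
Proof.
move=> hK tw; rewrite /piece_val normrM indicE.
case: (_ \in _); rewrite /= ?normr1 ?normr0 ?mulr1 ?mulr0 ?hK//.
by rewrite (le_trans _ (hK tw.2)).
Qed.

Lemma measurable_piece_val l r h : piece l r h -> measurable_fun setT (piece_val l r h).
Proof.
move=> [l0 lr rT mh _].
have lT : 0 <= l <= T by rewrite l0 (le_trans lr).
have mD : measurable (`]l, r]%classic `*` [set: Omega] : set PF).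
  by apply: measurable_rectangle => //; exact: (filtrationT filtF lT).
have -> : piece_val l r h = (fun tw : PF =>
    if tw \in (`]l, r]%classic `*` [set: Omega] : set PF) then h tw.2 else 0).
  apply/funext => -[t w]; rewrite /piece_val indicE/=.
  have -> : ((t, w) \in `]l, r]%classic `*` [set: Omega]) = (t \in `]l, r]%classic).
    by apply/idP/idP => [/set_mem[]/= h1 _|/set_mem h1]; apply/mem_set.
  by case: (_ \in _); rewrite ?mulr1 ?mulr0.
move=> _ Y mY; rewrite setTI.
have mDh : measurable (`]l, r]%classic `*` (h @^-1` Y) : set PF).
  by apply: measurable_rectangle => //; exact: (meas_set1 (filtration_adm filtF lT) mh).
have [Y0|Y0] := pselect (Y 0).
  rewrite (_ : _ @^-1` _ = (`]l, r]%classic `*` (h @^-1` Y)) `|` ~` (`]l, r]%classic `*` [set: Omega])).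
    by apply: measurableU => //; exact: measurableC.
  apply/seteqP; split => -[t w] /=.
    by case: ifPn => [/set_mem[]/= tlr _ hY|/negP tlr _]; [left|right => h1; apply/tlr/mem_set].
  case: ifPn => [/set_mem[]/= tlr _ [[]//|[]]//|//].
rewrite (_ : _ @^-1` _ = `]l, r]%classic `*` (h @^-1` Y))//.
apply/seteqP; split => -[t w] /=.
  by case: ifPn => [/set_mem[]/=|].
by move=> [tlr hY]; rewrite ifT//; apply/mem_set.
Qed.

Local Notation mu := (bracket_measure_of T0 filtF bracket_measurable bracket_integrable).

Lemma sqint_piece_val l r h : piece l r h -> sqint mu (piece_val l r h).
Proof.
move=> ph; have [_ _ _ _ [K hK]] := ph.
have := sqint_bounded (measurable_piece_val ph) (piece_val_bounded l r hK) (sqint_cst mu 1).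
by under eq_fun do rewrite mulr1.
Qed.

Lemma ge0_integral_piece l r h : piece l r h -> (forall w, 0 <= h w) ->
  \int[mu]_tw piece_val l r h tw = \int[P]_w (h w * (A w r - A w l)).
Proof.
move=> ph h0; have [l0 lr rT mh _] := ph.
rewrite /Rintegral; congr fine.
rewrite -(@ge0_integral_bracket _ _ _ P T F A T0 filtF bracket_measurable bracket_integrable
  (fun t w => piece_val l r h (t, w)))//; last 2 first.
- by move=> tw; rewrite /piece_val mulr_ge0// indicE.
- exact: measurable_piece_val.
apply: eq_integral => w _; rewrite /piece_val/=.
under eq_integral do rewrite EFinM.
rewrite ge0_integralZl//; last 2 first.
- by apply/measurable_EFinP; exact: measurable_indic.
- by rewrite lee_fin.
have mitv (a b : R) : measurable (`]a, b]%classic : set (measurableTypeR R)).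
  exact: measurable_itv.
rewrite integral_indic; [|exact: mitv|exact: mitv].
rewrite EFinM -lebesgue_stieltjes_itvoc//; congr (_ * lebesgue_stieltjes_measure _ _)%E.
apply/seteqP; split => t /=; rewrite !in_itv/=; first by case.
by move=> /andP[lt tr]; rewrite lt tr (le_lt_trans l0 lt) (le_trans tr).
Qed.

(** Both sides are linear in the coefficient: h is the difference of the nonnegative coefficients h
    + K and K, with K a bound of |h|. *)
Lemma integral_piece l r h : piece l r h ->
  \int[mu]_tw piece_val l r h tw = \int[P]_w (h w * (A w r - A w l)).
Proof.
move=> ph; have [l0 lr rT mh [K hK]] := ph.
have lT : 0 <= l <= T by rewrite l0 (le_trans lr).
have rT' : 0 <= r <= T by rewrite rT (le_trans l0).
have aF := filtration_adm filtF lT.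
have mh' := meas_measurable aF.2 mh.
have K0 : 0 <= K by rewrite (le_trans _ (hK point)).
have mhK : meas (F l) (fun w => h w + K).
  by have [sF _] := aF; apply/measP => //; apply: measurable_funD => //; exact/(measP _ sF).
have p1 : piece l r (fun w => h w + K).
  split => //; exists (K + K) => w; rewrite (le_trans (ler_normD _ _))// lerD//.
  by rewrite ger0_norm.
have p2 : piece l r (fun=> K).
  split => //; last by exists K => w; rewrite ger0_norm.
  by have [sF _] := aF; apply/measP => //; exact: measurable_cst.
have e2 := ge0_integral_piece p2 (fun=> K0).
have hK0 w : 0 <= h w + K by have := hK w; rewrite ler_norml => /andP[]; lra.
have e1 := ge0_integral_piece p1 hK0.
have ipv u : piece l r u -> mu.-integrable setT (EFin \o piece_val l r u).
  move=> pu; have := sqint_mul (sqint_piece_val pu) (sqint_cst mu 1).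
  by under eq_fun do rewrite mulr1.
have iA (u : Omega -> R) (b : R) : measurable_fun setT u -> (forall w, `|u w| <= b) ->
    P.-integrable setT (EFin \o (fun w => u w * (A w r - A w l))).
  move=> mu' ub; apply: (bounded_mul_integrable mu' ub).
  rewrite (_ : _ \o _ = (fun w => (A w r)%:E - (A w l)%:E)%E)//.
  by apply: integrableB => //; exact: bracket_integrable.
have -> : \int[mu]_tw piece_val l r h tw =
    \int[mu]_tw (piece_val l r (fun w => h w + K) tw - piece_val l r (fun=> K) tw).
  by apply: eq_Rintegral => tw _; rewrite /piece_val; ring.
rewrite RintegralB//; [|exact: ipv|exact: ipv].
rewrite e1 e2 -RintegralB//; last 2 first.
- apply: (iA _ (K + K)); first exact: measurable_funD.
  by move=> w; rewrite (le_trans (ler_normD _ _))// lerD// ger0_norm.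
- by apply: (iA _ K) => // w; rewrite ger0_norm.
by apply: eq_Rintegral => w _; ring.
Qed.

End martingale_bracket.

Section L2proj_sum.
Context d (Omega : measurableType d) (R : realType) (P : probability Omega R).

Lemma L2of_sum G n (X : 'I_n -> Omega -> R) : adm G ->
  (forall i, L2of P G (X i)) -> L2of P G (fun w => \sum_(i < n) X i w).
Proof.
move=> aG; elim: n X => [|n IH] X GX.
  by under eq_fun do rewrite big_ord0; exact: L2of_cst.
under eq_fun do rewrite big_ord_recr /=.
by apply: L2ofD => //; exact: IH.
Qed.

Lemma L2proj_sum G n (X V : 'I_n -> Omega -> R) : adm G -> (forall i, sqint P (X i)) ->
  (forall i, L2proj P G (X i) (V i)) ->
  L2proj P G (fun w => \sum_(i < n) X i w) (fun w => \sum_(i < n) V i w).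
Proof.
move=> aG sX pV; split; first by apply: L2of_sum => // i; exact: (pV i).1.
have sV i : sqint P (V i) by exact: (L2of_sqint (pV i).1).
move=> U GU; have sU := L2of_sqint GU.
rewrite dotBl//; [|exact: sqint_sum|exact: sqint_sum].
rewrite !dot_suml// -sumrB big1// => i _.
by have := (pV i).2 _ GU; rewrite dotBl.
Qed.

End L2proj_sum.

Section simple_integrals.
Context d (Omega : measurableType d) (R : realType) (P : probability Omega R).
Variables (T : R) (F : R -> set_system Omega) (M : R -> Omega -> R)
  (A : Omega -> cumulative R R).
Hypothesis T0 : 0 < T.
Hypothesis filtF : filtration T F.
Hypothesis martM : square_integrable_martingale P T F M.
Hypothesis bracketM : is_predictable_bracket P T F M A.

Local Notation PF := (g_sigma_algebraType (predictable_rectangle T F)).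
Local Notation mu := (bracket_measure_of T0 filtF
  (bracket_measurable martM bracketM) (bracket_integrable martM bracketM)).

Definition piece_int (l r : R) (h : Omega -> R) : Omega -> R :=
  fun w => h w * (M r w - M l w).

Lemma piece_int_L2of l r h t : piece T F l r h -> r <= t -> t <= T ->
  L2of P (F t) (piece_int l r h).
Proof.
move=> [l0 lr rT mh [K hK]] rt tT.
have ltT : 0 <= t <= T by rewrite tT (le_trans l0)// (le_trans lr).
apply: (L2of_bounded (filtration_adm filtF ltT) (measS (filtrationS filtF l0 (le_trans lr rt) tT) mh) hK).
apply: L2ofB; first exact: filtration_adm ltT.
  apply: L2ofS (martingale_L2of martM _); last by rewrite rT (le_trans l0).
  by apply: (filtrationS filtF) => //; rewrite (le_trans l0).
apply: L2ofS (martingale_L2of martM _); last by rewrite l0 (le_trans lr).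
by apply: (filtrationS filtF) => //; rewrite (le_trans lr).
Qed.

Lemma piece_int_sqint l r h : piece T F l r h -> sqint P (piece_int l r h).
Proof.
move=> ph; have [_ _ rT _ _] := ph.
exact: L2of_sqint (piece_int_L2of ph (lexx r) rT).
Qed.

(** The Itô isometry for single pieces, in polarized form. With l <= l', the product K = h h' is
    known at l', and the left side expands into four terms q s t = E[K M_s M_t]. *)
Lemma piece_pairing l r h l' r' h' : piece T F l r h -> piece T F l' r' h' ->
  dot P (piece_int l r h) (piece_int l' r' h') =
  dot mu (piece_val l r h) (piece_val l' r' h').
Proof.
wlog ll' : l r h l' r' h' / l <= l'.
  move=> W p p'; have [ll'|/ltW ll'] := leP l l'; first exact: W.
  by rewrite dotC [RHS]dotC; exact: W.
move=> p p'; have [l0 lr rT mh [K1 hK1]] := p; have [l'0 l'r' r'T mh' [K2 hK2]] := p'.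
have l'T := le_trans l'r' r'T.
have in01 s : l' <= s -> s <= T -> 0 <= s <= T by move=> h1 h2; rewrite h2 (le_trans l'0).
have lT : 0 <= l <= T by rewrite l0 (le_trans ll').
have rT' : 0 <= r <= T by rewrite rT (le_trans l0).
pose K w := h w * h' w.
have KB w : `|K w| <= K1 * K2 by rewrite normrM ler_pM.
have mK : meas (F l') K.
  have aF := filtration_adm filtF (in01 _ (lexx l') l'T); have [sF _] := aF.
  have mhl' := measS (filtrationS filtF l0 ll' l'T) mh.
  by apply/measP => //; apply: measurable_funM; exact/(measP _ sF).
pose q s t := dot P (fun w => K w * M s w) (M t).
have KM s t : l' <= t -> t <= T -> 0 <= s -> s <= t -> L2of P (F t) (fun w => K w * M s w).
  move=> l't tT s0 st.
  apply: (L2of_bounded (filtration_adm filtF (in01 _ l't tT)) (measS (filtrationS filtF l'0 l't tT) mK) KB).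
  apply: L2ofS (martingale_L2of martM _); last by rewrite s0 (le_trans st).
  exact: (filtrationS filtF).
(* The martingale property, tested with K M_s, which is known at u. *)
have qcol s u t : 0 <= s -> s <= u -> l' <= u -> u <= t -> t <= T -> q s t = q s u.
  move=> s0 su l'u ut tT; apply: (martingale_dot filtF martM) => //; first exact: le_trans su.
  by apply: KM => //; exact: le_trans tT.
have qC s t : q s t = q t s by apply: eq_Rintegral => w _; ring.
have sM s : 0 <= s <= T -> sqint P (M s) by exact: (martingale_sqint martM).
have mKO := meas_measurable (filtration_adm filtF (in01 _ (lexx l') l'T)).2 mK.
have sKM s : 0 <= s <= T -> sqint P (fun w => K w * M s w).
  by move=> sT; exact: sqint_bounded mKO KB (sM _ sT).
have -> : dot P (piece_int l r h) (piece_int l' r' h') = q r r' - q r l' - (q l r' - q l l').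
  have -> : dot P (piece_int l r h) (piece_int l' r' h') =
      dot P (fun w => K w * M r w - K w * M l w) (fun w => M r' w - M l' w).
    by apply: eq_Rintegral => w _; rewrite /piece_int /K; ring.
  have s1 := sM _ (in01 _ l'r' r'T); have s2 := sM _ (in01 _ (lexx l') l'T).
  by rewrite dotBl ?dotBr//; try exact: sqintB; exact: sKM.
rewrite (qcol l l' r')// subrr subr0.
(* If the first interval ends before the second begins, the remaining two terms cancel, and the
   product of the two integrands vanishes identically. *)
have [rl'|l'r] := leP r l'.
  rewrite (qcol r l' r')//; last by rewrite (le_trans l0).
  rewrite subrr /dot (@eq_Rintegral _ _ _ _ _ (cst 0)) ?Rintegral_cst ?mul0r//.
  move=> [t w] _; rewrite /piece_val/= !indicE.
  have [/set_mem/=|_] := boolP (t \in `]l, r]%classic); last by rewrite mulr0 mul0r.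
  rewrite in_itv/= => /andP[_ tr]; rewrite memNset ?mulr0//=.
  by rewrite in_itv/= ltNge (le_trans tr rl').
(* The intervals overlap in ]l', m]; the two terms left collapse to q m m - q l' l', the increment
   of E[K M^2] there. *)
pose m := Num.min r r'.
have l'm : l' <= m by rewrite le_min (ltW l'r).
have mT : m <= T by rewrite ge_min rT.
have -> : q r r' = q m m.
  rewrite /m; case: (leP r r') => [rr'|/ltW r'r].
    by rewrite (qcol r r r')//; [rewrite (le_trans l0)|exact: ltW].
  by rewrite qC (qcol r' r' r)//; rewrite (le_trans l'0).
rewrite qC (qcol l' l' r)//; last exact: ltW.
rewrite (bracket_increment filtF martM bracketM l'0 l'm mT mK KB).
have pK : piece T F l' m K by split => //; exists (K1 * K2).
rewrite -(integral_piece T0 filtF martM bracketM pK).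
apply: eq_Rintegral => -[t w] _; rewrite /piece_val/= /K mulrACA; congr (_ * _).
rewrite !indicE -natrM mulnb; congr (nat_of_bool _)%:R.
apply/idP/andP.
  move=> /set_mem/=; rewrite in_itv/= le_min => /andP[l't /andP[tr tr']].
  by split; apply/mem_set; rewrite /= in_itv/= ?l't ?tr ?tr' ?(le_lt_trans ll').
move=> [/set_mem/= + /set_mem/=]; rewrite !in_itv/= => /andP[_ tr] /andP[l't tr'].
by apply/mem_set; rewrite /= in_itv/= l't le_min tr.
Qed.

(** Stopping the elementary integral at t discards the part gained after t, which is orthogonal to
    F_t. The cases are t before, after or inside the interval. *)
Lemma piece_int_L2proj l r h t : piece T F l r h -> 0 <= t <= T ->
  L2proj P (F t) (piece_int l r h) (piece_int (Num.min l t) (Num.min r t) h).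
Proof.
move=> p tT; have [l0 lr rT mh [K hK]] := p.
have /andP[t0 tT'] := tT; have aF := filtration_adm filtF tT.
have lT : 0 <= l <= T by rewrite l0 (le_trans lr).
have rT' : 0 <= r <= T by rewrite rT (le_trans l0).
have sM s : 0 <= s <= T -> sqint P (M s) by exact: (martingale_sqint martM).
have mhO := meas_measurable (filtration_adm filtF lT).2 mh.
(* As h is known at l, hence at s, the product h U is a test function at time s. *)
have orth s U : l <= s -> s <= r -> L2of P (F s) U -> dot P (piece_int s r h) U = 0.
  move=> ls sr FU.
  have sT : 0 <= s <= T by rewrite (le_trans sr rT) (le_trans l0).
  have aFs := filtration_adm filtF sT; have sU := L2of_sqint FU.
  have FhU : L2of P (F s) (fun w => h w * U w).
    apply: L2of_bounded hK FU => //; apply: measS mh; apply: (filtrationS filtF) => //.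
    by case/andP : sT.
  have := martingale_dot filtF martM (proj1 (andP sT)) sr rT FhU.
  have shU := L2of_sqint FhU.
  move/eqP; rewrite -subr_eq0 -dotBr//; [|exact: sM|exact: sM].
  by move/eqP <-; apply: eq_Rintegral => w _; rewrite /piece_int; ring.
have [tl|lt] := leP t l.
  have tr := le_trans tl lr; rewrite (min_r tr).
  have -> : piece_int t t h = fun=> 0 by apply/funext => w; rewrite /piece_int subrr mulr0.
  split; first exact: L2of_cst.
  move=> U FU; rewrite (_ : (fun w => _) = piece_int l r h); last by apply/funext => w; rewrite subr0.
  apply: orth => //; apply: L2ofS FU; apply: (filtrationS filtF) => //; exact: le_trans rT.
have [tr|rt] := leP r t.
  split; first exact: piece_int_L2of p tr tT'.
  move=> U FU; rewrite (_ : (fun w => _) = fun=> 0) ?dot0l//.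
  by apply/funext => w; rewrite subrr.
have p' : piece T F l t h by split => //; [exact: ltW|exists K].
split; first exact: (piece_int_L2of p').
move=> U FU; rewrite (_ : (fun w => _) = piece_int t r h); last first.
  by apply/funext => w; rewrite /piece_int; ring.
by apply: orth => //; exact: ltW.
Qed.

Definition simple_proc (S : simple_process Omega R) : PF -> R :=
  fun tw => simple_val S tw.1 tw.2.

Lemma simple_piece S i : simple_predictable T F S ->
  piece T F (sp_left (s:=S) i) (sp_right (s:=S) i) (sp_coef (s:=S) i).
Proof. by move=> /(_ i). Qed.

Lemma simple_intE S : simple_predictable T F S ->
  simple_int M S T = fun w => \sum_(i < sp_size S)
    piece_int (sp_left (s:=S) i) (sp_right (s:=S) i) (sp_coef (s:=S) i) w.
Proof.
move=> Sp; apply/funext => w; apply: eq_bigr => i _.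
have [_ lr rT _ _] := Sp i.
by rewrite /piece_int !min_l// (le_trans lr).
Qed.

Lemma simple_procE S : simple_proc S = fun tw => \sum_(i < sp_size S)
    piece_val (T:=T) (F:=F) (sp_left (s:=S) i) (sp_right (s:=S) i) (sp_coef (s:=S) i) tw.
Proof. by []. Qed.

Lemma simple_int_sqint S : simple_predictable T F S -> sqint P (simple_int M S T).
Proof.
move=> Sp; rewrite simple_intE//; apply: sqint_sum => i.
exact: piece_int_sqint (simple_piece i Sp).
Qed.

Lemma simple_proc_sqint S : simple_predictable T F S -> sqint mu (simple_proc S).
Proof.
move=> Sp; rewrite simple_procE; apply: sqint_sum => i.
exact: sqint_piece_val (simple_piece i Sp).
Qed.

Lemma simple_pairing S S' : simple_predictable T F S -> simple_predictable T F S' ->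
  dot P (simple_int M S T) (simple_int M S' T) = dot mu (simple_proc S) (simple_proc S').
Proof.
move=> Sp Sp'; rewrite !simple_intE// !simple_procE.
rewrite !dot_suml//; last 4 first.
- by move=> i; exact: sqint_piece_val (simple_piece i Sp).
- by apply: sqint_sum => i; exact: sqint_piece_val (simple_piece i Sp').
- by move=> i; exact: piece_int_sqint (simple_piece i Sp).
- by apply: sqint_sum => i; exact: piece_int_sqint (simple_piece i Sp').
apply: eq_bigr => i _; rewrite dotC [RHS]dotC !dot_suml//.
- apply: eq_bigr => j _; exact: piece_pairing (simple_piece j Sp') (simple_piece i Sp).
- by move=> j; exact: sqint_piece_val (simple_piece j Sp').
- exact: sqint_piece_val (simple_piece i Sp).
- by move=> j; exact: piece_int_sqint (simple_piece j Sp').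
- exact: piece_int_sqint (simple_piece i Sp).
Qed.

Lemma simple_int_L2proj S t : simple_predictable T F S -> 0 <= t <= T ->
  L2proj P (F t) (simple_int M S T) (simple_int M S t).
Proof.
move=> Sp tT; rewrite simple_intE//; apply: L2proj_sum.
- exact: filtration_adm tT.
- by move=> i; exact: piece_int_sqint (simple_piece i Sp).
- by move=> i; exact: piece_int_L2proj (simple_piece i Sp) tT.
Qed.

Lemma simple_int0 S : simple_predictable T F S -> simple_int M S 0 = fun=> 0.
Proof.
move=> Sp; apply/funext => w; apply: big1 => i _.
have [l0 lr _ _ _] := Sp i.
by rewrite !min_r// ?subrr ?mulr0// (le_trans l0).
Qed.

End simple_integrals.

Section dist2_extra.
Context d (E : measurableType d) (R : realType) (mu : {measure set E -> \bar R}).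
Implicit Types (f g : E -> R).

Lemma dist2_lin f f' g g' c : sqint mu f -> sqint mu f' -> sqint mu g -> sqint mu g' ->
  dist2 mu (fun x => f x + c * g x) (fun x => f' x + c * g' x) <=
  2 * dist2 mu f f' + 2 * c ^+ 2 * dist2 mu g g'.
Proof.
move=> sf sf' sg sg'; have [su sv] := (sqintB sf sf', sqintB sg sg').
have := dot_ge0 mu (fun x => (f x - f' x) + - c * (g x - g' x)).
have -> : dist2 mu (fun x => f x + c * g x) (fun x => f' x + c * g' x) =
    dot mu (fun x => (f x - f' x) + c * (g x - g' x)) (fun x => (f x - f' x) + c * (g x - g' x)).
  by apply: eq_Rintegral => x _; ring.
have [s1 s2] := (sqint_lin c su sv, sqint_lin (- c) su sv).
rewrite !dot_linl// !dot_linr// /dist2.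
rewrite (dotC mu (fun x => g x - g' x) (fun x => f x - f' x)).
move: (dot _ _ _) (dot _ _ _) (dot _ _ _) => *; lra.
Qed.

Lemma dist2_eq0 f g : sqint mu f -> sqint mu g -> dist2 mu f g = 0 ->
  {ae mu, forall x, f x = g x}.
Proof.
move=> sf sg /(dot_eq0 (sqintB sf sg)); apply: filterS => x /eqP.
by rewrite subr_eq0 => /eqP.
Qed.

Lemma ae_dist2_eq0 f g : sqint mu f -> sqint mu g -> {ae mu, forall x, f x = g x} ->
  dist2 mu f g = 0.
Proof.
move=> sf sg fg; have s := sqintB sf sg.
rewrite /dist2 (eq_ae_dot s (sqint0 mu) s) ?dot0l//.
by apply: filterS fg => x ->; rewrite subrr.
Qed.

End dist2_extra.

Section simple_combinations.
Context d (Omega : measurableType d) (R : realType).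
Variables (T : R) (F : R -> set_system Omega).

Definition simple_one (l r : R) (h : Omega -> R) : simple_process Omega R :=
  @SimpleProcess _ Omega R 1 (fun=> l) (fun=> r) (fun=> h).

Lemma simple_one_predictable l r h : piece T F l r h -> simple_predictable T F (simple_one l r h).
Proof. by move=> p i. Qed.

Definition simple_nil : simple_process Omega R :=
  @SimpleProcess _ Omega R 0 (fun=> 0) (fun=> 0) (fun=> fun=> 0).

Definition simple_lin (c : R) (S S' : simple_process Omega R) : simple_process Omega R :=
  @SimpleProcess _ Omega R (sp_size S + sp_size S')
    (fun i => match fintype.split i with inl j => sp_left (s:=S) j | inr j => sp_left (s:=S') j end)
    (fun i => match fintype.split i with inl j => sp_right (s:=S) j | inr j => sp_right (s:=S') j end)
    (fun i => match fintype.split i with inl j => sp_coef (s:=S) j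
                               | inr j => fun w => c * sp_coef (s:=S') j w end).

Lemma simple_lin_predictable c S S' : filtration T F -> simple_predictable T F S ->
  simple_predictable T F S' -> simple_predictable T F (simple_lin c S S').
Proof.
move=> filtF Sp Sp' i; rewrite /simple_lin /=; case: (fintype.split i) => j; first exact: Sp.
have [l0 lr rT mh [K hK]] := Sp' j; split => //.
  have lT : 0 <= sp_left (s:=S') j <= T by rewrite l0 (le_trans lr).
  have [sF _] := filtration_adm filtF lT.
  rewrite -/(meas _ _); apply/measP => //; apply: measurable_funM => //.
  exact/(measP _ sF).
exists (`|c| * K) => w; rewrite normrM ler_wpM2l//.
Qed.

Lemma simple_val_lin c S S' t w :
  simple_val (simple_lin c S S') t w = simple_val S t w + c * simple_val S' t w.
Proof.
rewrite /simple_val /simple_lin /= big_split_ord /=; congr (_ + _).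
  apply: eq_bigr => i _.
  by rewrite (_ : fintype.split _ = inl i)//; exact: (unsplitK (inl i)).
rewrite mulr_sumr; apply: eq_bigr => i _.
by rewrite (_ : fintype.split _ = inr i) ?mulrA//; exact: (unsplitK (inr i)).
Qed.

End simple_combinations.

(** * The stochastic integral *)

Section ito.
Context d (Omega : measurableType d) (R : realType) (P : probability Omega R).
Variables (T : R) (F : R -> set_system Omega) (M : R -> Omega -> R)
  (A : Omega -> cumulative R R).
Hypothesis T0 : 0 < T.
Hypothesis filtF : filtration T F.
Hypothesis martM : square_integrable_martingale P T F M.
Hypothesis bracketM : is_predictable_bracket P T F M A.

Local Notation PF := (g_sigma_algebraType (predictable_rectangle T F)).
Local Notation mu := (bracket_measure_of T0 filtF
  (bracket_measurable martM bracketM) (bracket_integrable martM bracketM)).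
Local Notation sproc := (@simple_proc _ Omega R T F).

Lemma simple_isometry S S' : simple_predictable T F S -> simple_predictable T F S' ->
  dist2 P (simple_int M S T) (simple_int M S' T) = dist2 mu (sproc S) (sproc S').
Proof.
move=> Sp Sp'.
have sI := simple_int_sqint filtF martM Sp; have sI' := simple_int_sqint filtF martM Sp'.
have sS := simple_proc_sqint T0 filtF martM bracketM Sp.
have sS' := simple_proc_sqint T0 filtF martM bracketM Sp'.
rewrite !dist2E//.
by rewrite !(simple_pairing T0 filtF martM bracketM).
Qed.

Lemma bracket_measure_null (N : set PF) : (forall t w, 0 < t <= T -> ~ N (t, w)) -> mu N = 0%E.
Proof.
move=> N0; rewrite bracket_measureE integral0_eq// => w _.
rewrite bracket_sliceE (_ : _ `&` _ = set0) ?measure0//.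
by apply/seteqP; split => t //= [Nt]; rewrite in_itv/= => /N0/(_ Nt).
Qed.

Lemma simple_proc_one s t B : F s B ->
  sproc (simple_one s t (\1_B)) = \1_(`]s, t]%classic `*` B : set PF).
Proof.
move=> FB; apply/funext => -[u w]; rewrite /simple_proc /simple_val /= big_ord1 !indicE.
rewrite -natrM mulnb; congr (nat_of_bool _)%:R.
apply/andP/idP => [[/set_mem wB /set_mem ust]|/set_mem[/= ust wB]]; first exact/mem_set.
by split; apply/mem_set.
Qed.

Lemma indic_piece s t B : 0 <= s -> s <= t -> t <= T -> F s B -> piece T F s t (\1_B).
Proof.
move=> s0 st tT FB; split => //; last first.
  by exists 1 => w; rewrite indicE; case: (_ \in _); rewrite /= ?normr1 ?normr0.
have sT : 0 <= s <= T by rewrite s0 (le_trans st).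
exact: (L2of_indic P (filtration_adm filtF sT) FB).2.
Qed.

Definition simple_closure : set (PF -> R) :=
  [set f | sqint mu f /\ forall e : R, 0 < e ->
     exists2 S, simple_predictable T F S & dist2 mu f (sproc S) <= e].

Lemma simple_in_closure S : simple_predictable T F S -> simple_closure (sproc S).
Proof.
move=> Sp; have sS := simple_proc_sqint T0 filtF martM bracketM Sp.
split => // e e0; exists S => //.
by rewrite ae_dist2_eq0 ?ltW//; exact: aeW.
Qed.

Lemma simple_closure_subspace : subspace mu simple_closure.
Proof.
split.
- have -> : (fun=> 0) = sproc (simple_nil Omega R).
    by apply/funext => tw; rewrite /simple_proc /simple_val /= big_ord0.
  by apply: simple_in_closure => -[].
- by move=> f [].
- move=> f g c [sf fS] [sg gS]; split; first exact: sqint_lin.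
  move=> e e0.
  have d0 : 0 < 2 + 2 * c ^+ 2 by rewrite ltr_pwDl// mulr_ge0// sqr_ge0.
  have [S Sp fSe] := fS _ (divr_gt0 e0 d0); have [S' Sp' gSe] := gS _ (divr_gt0 e0 d0).
  exists (simple_lin c S S'); first exact: simple_lin_predictable.
  have -> : sproc (simple_lin c S S') = fun tw => sproc S tw + c * sproc S' tw.
    by apply/funext => tw; exact: simple_val_lin.
  have sS := simple_proc_sqint T0 filtF martM bracketM Sp.
  have sS' := simple_proc_sqint T0 filtF martM bracketM Sp'.
  apply: le_trans (dist2_lin c sf sS sg sS') _.
  move: fSe gSe; rewrite !ler_pdivlMr//.
  move: (dist2 _ _ _) (dist2 _ _ _) => x y h1 h2.
  have h3 : c ^+ 2 * (x * (2 + 2 * c ^+ 2)) <= c ^+ 2 * e by rewrite ler_wpM2l ?sqr_ge0.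
  rewrite -(ler_pM2r d0); lra.
Qed.

Lemma simple_closure_complete : L2complete mu simple_closure.
Proof.
move=> u uV uc.
have su n : sqint mu (u n) by case: (uV n).
have [phi /= [_ sf uf _]] := riesz_fischer su uc.
eexists; last exact: uf.
split => // e e0; have e4 : 0 < e / 4 by rewrite divr_gt0.
have [N /(_ N (leqnn N)) HN] := uf _ e4.
have [S Sp uS] := (uV N).2 _ e4; exists S => //.
have sS := simple_proc_sqint T0 filtF martM bracketM Sp.
apply: le_trans (dist2_tri sf (su N) sS) _.
rewrite (dist2C mu _ (u N)); move: HN uS.
move: (dist2 _ _ _) (dist2 _ _ _) => *; lra.
Qed.

(* A residual orthogonal to all simple processes has zero integral over every
   predictable rectangle, hence over every predictable set. *)
Lemma simple_dense (Z : PF -> R) : sqint mu Z -> simple_closure Z.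
Proof.
move=> sZ.
have [v Vv vZ] := projection simple_closure_subspace simple_closure_complete sZ.
have sv : sqint mu v by case: Vv.
have sr := sqintB sZ sv; pose rho tw := Z tw - v tw.
have ir : mu.-integrable setT (EFin \o rho).
  have := sqint_mul sr (sqint_cst mu 1).
  by under eq_fun do rewrite mulr1.
have zT : 0 <= (0 : R) <= T by rewrite lexx ltW.
have rect s t B : 0 <= s -> s <= t -> t <= T -> F s B ->
    (\int[mu]_(tw in `]s, t]%classic `*` B) (rho tw)%:E)%E = 0%E.
  move=> s0 st tT FB; rewrite dot_indic//; last exact: measurable_rectangle.
  rewrite -simple_proc_one// vZ//; apply: simple_in_closure.
  exact/simple_one_predictable/indic_piece.
have null (N : set PF) : measurable N -> (forall t w, 0 < t <= T -> ~ N (t, w)) ->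
    (\int[mu]_(tw in N) (rho tw)%:E)%E = 0%E.
  move=> mN N0; apply: null_set_integral => //; last exact: bracket_measure_null.
  by case/integrableP : ir => mr _; exact: measurable_funTS mr.
(* The whole space is not a predictable rectangle, but ]0, T] x Omega is one and its complement is
   null. *)
have total : (\int[mu]_(tw in setT) (rho tw)%:E)%E = 0%E.
  pose D0 : set PF := `]0, T]%classic `*` [set: Omega].
  have mD0 : measurable D0.
    by apply: measurable_rectangle => //; [exact: ltW|exact: (filtrationT filtF zT)].
  rewrite -(setUCr D0) integral_setU//; last 3 first.
  - exact: measurableC.
  - by rewrite setUCr; case/integrableP: ir.
  - by rewrite disj_set2E setICr.
  rewrite (rect 0 T)//; [|exact: ltW|exact: (filtrationT filtF zT)].
  rewrite null ?adde0//; first exact: measurableC.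
  by move=> t w tT; apply; split.
have key : forall D : set PF, measurable D -> (\int[mu]_(tw in D) (rho tw)%:E)%E = 0%E.
  apply: (@dynkin_induction _ PF _ (fun D => (\int[mu]_(tw in D) (rho tw)%:E)%E = 0%E) erefl
    (predictable_rectangleI T0 filtF)).
  - exact: total.
  - move=> _ [[B FB ->]|[s [t [B [s0 st tT FB ->]]]]]; last exact: rect.
    apply: null; first by apply: sub_sigma_algebra; left; exists B.
    by move=> t w /andP[t0 _] [/= t0']; rewrite t0' ltxx in t0.
  - move=> D mD D0; have mDC := measurableC mD.
    move: total.
    rewrite -(setUCr D) integral_setU//; last 2 first.
    - by rewrite setUCr; case/integrableP: ir.
    - by rewrite disj_set2E setICr.
    by rewrite D0 add0e.
  - move=> G mG tG G0; rewrite integral_bigcup//; last first.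
      by apply: integrableS ir => //; exact: bigcup_measurable.
    by rewrite eseries0// => i _ _; exact: G0.
have rho0 : {ae mu, forall tw, rho tw = 0}.
  have : ae_eq mu setT (EFin \o rho) (cst 0%E).
    apply: integral_ae_eq => // D _ mD; rewrite integral0; exact: key.
  by apply: filterS => tw /(_ I)[].
split => // e e0; have [S Sp vS] := Vv.2 _ (divr_gt0 e0 (ltr0Sn R 1)); exists S => //.
have sS := simple_proc_sqint T0 filtF martM bracketM Sp.
apply: le_trans (dist2_tri sZ sv sS) _.
rewrite (ae_dist2_eq0 sZ sv) ?mulr0 ?add0r; first by rewrite mulrC -ler_pdivlMr.
by apply: filterS rho0 => tw /eqP; rewrite subr_eq0 => /eqP.
Qed.

(* X is a version of the integral of Z over ]0, T], for Z on the predictable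
   sigma-algebra. *)
Definition ito (Z : PF -> R) (X : Omega -> R) :=
  [/\ sqint mu Z, sqint P X & forall e : R, 0 < e ->
    exists S, [/\ simple_predictable T F S, dist2 mu Z (sproc S) <= e &
                  dist2 P X (simple_int M S T) <= e]].

Lemma ito_ex (Z : PF -> R) : sqint mu Z -> exists X, ito Z X.
Proof.
move=> sZ; have [_ ZS] := simple_dense sZ.
have /choice[S SP] : forall n, exists S, simple_predictable T F S /\
    dist2 mu Z (sproc S) <= n.+1%:R^-1.
  by move=> n; have [|S] := ZS n.+1%:R^-1; [rewrite invr_gt0|exists S].
have Sp n : simple_predictable T F (S n) by case: (SP n).
have sS n := simple_proc_sqint T0 filtF martM bracketM (Sp n).
have sI n := simple_int_sqint filtF martM (Sp n).
have uc : L2cauchy P (fun n => simple_int M (S n) T).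
  move=> e e0; have [N _ HN] := near_infty_natSinv_lt (PosNum (divr_gt0 e0 (ltr0Sn R 3))).
  exists N => m n Nm Nn; rewrite simple_isometry//.
  apply: le_trans (dist2_tri (sS m) sZ (sS n)) _; rewrite (dist2C mu _ Z).
  have [_ h1] := SP m; have [_ h2] := SP n; have := HN m Nm; have := HN n Nn => /=.
  move: h1 h2; move: (m.+1%:R^-1) (n.+1%:R^-1) (dist2 _ _ _) (dist2 _ _ _) => *; lra.
have [phi /= [_ sX cX _]] := riesz_fischer sI uc.
exists (fun w => fine (limn_esup (fun k => (simple_int M (S (phi k)) T w)%:E))).
split => // e e0.
have [N _ HN] := near_infty_natSinv_lt (PosNum e0); have [N' HN'] := cX _ e0.
exists (S (maxn N N')); split => //; last by rewrite dist2C; exact/HN'/leq_maxr.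
have [_ h] := SP (maxn N N'); apply: le_trans h _; apply: ltW.
exact/HN/leq_maxl.
Qed.

Lemma ito_closed (Z : PF -> R) X (Zn : nat -> PF -> R) Xn : sqint mu Z -> sqint P X ->
  (forall n, ito (Zn n) (Xn n)) -> L2cvg mu Zn Z -> L2cvg P Xn X -> ito Z X.
Proof.
move=> sZ sX iZX ZZ XX; split => // e e0; have e4 : 0 < e / 4 by rewrite divr_gt0.
have [N HN] := ZZ _ e4; have [N' HN'] := XX _ e4; pose n := maxn N N'.
have {}HN := HN n (leq_maxl _ _); have {}HN' := HN' n (leq_maxr _ _).
have [sZn sXn /(_ _ e4)[S [Sp ZS XS]]] := iZX n.
have sS := simple_proc_sqint T0 filtF martM bracketM Sp.
have sI := simple_int_sqint filtF martM Sp.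
exists S; split => //.
  apply: le_trans (dist2_tri sZ sZn sS) _; rewrite (dist2C mu Z); move: HN ZS.
  by move: (dist2 _ _ _) (dist2 _ _ _) => *; lra.
apply: le_trans (dist2_tri sX sXn sI) _; rewrite (dist2C P X); move: HN' XS.
by move: (dist2 _ _ _) (dist2 _ _ _) => *; lra.
Qed.

(** A passage to the limit in one argument; applied twice, it extends the isometry from simple
    processes. The error is bounded by Cauchy-Schwarz on each side, and [b] absorbs the two squared
    norms. *)
Lemma ito_dot_limit (Z W : PF -> R) X Y : sqint mu W -> sqint P Y ->
  (forall S, simple_predictable T F S -> dot P (simple_int M S T) Y = dot mu (sproc S) W) ->
  ito Z X -> dot P X Y = dot mu Z W.
Proof.
move=> sW sY SYW [sZ sX H]; apply/eqP; rewrite -subr_eq0 -sqrf_eq0 eq_le sqr_ge0 andbT.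
apply/ler_addgt0Pr => e e0; rewrite add0r.
pose b := 2 * (dot P Y Y + dot mu W W) + 1.
have b0 : 0 < b by rewrite /b ltr_wpDl// mulr_ge0// addr_ge0// dot_ge0.
have [S [Sp ZS XS]] := H _ (divr_gt0 e0 b0).
have sS := simple_proc_sqint T0 filtF martM bracketM Sp.
have sI := simple_int_sqint filtF martM Sp.
have -> : dot P X Y - dot mu Z W = dot P (fun w => X w - simple_int M S T w) Y -
    dot mu (fun tw => Z tw - sproc S tw) W.
  by rewrite !dotBl// SYW//; ring.
have := cauchy_schwarz (sqintB sX sI) sY; have := cauchy_schwarz (sqintB sZ sS) sW.
rewrite -/(dist2 P X _) -/(dist2 mu Z _).
move: ZS XS; rewrite !ler_pdivlMr//.
have := dot_ge0 P Y; have := dot_ge0 mu W.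
have := dot_ge0 P (fun w => X w - simple_int M S T w).
have := dot_ge0 mu (fun tw => Z tw - sproc S tw).
rewrite -/(dist2 P X _) -/(dist2 mu Z _) /b.
move: (dot P (fun w => X w - _) Y) (dot mu (fun tw => Z tw - _) W) => u v.
move: (dist2 P _ _) (dist2 mu _ _) (dot P Y Y) (dot mu W W) => x y p q.
move=> y0 x0 q0 p0 hy hx hv hu.
have h : (u - v) ^+ 2 <= 2 * u ^+ 2 + 2 * v ^+ 2 by have := sqr_ge0 (u + v); nra.
apply: le_trans h _; nra.
Qed.

Lemma ito_dot (Z Z' : PF -> R) X X' : ito Z X -> ito Z' X' -> dot P X X' = dot mu Z Z'.
Proof.
move=> iZ iZ'; have [sZ' sX' _] := iZ'; have [sZ sX _] := iZ.
apply: ito_dot_limit => // S Sp.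
have sS := simple_proc_sqint T0 filtF martM bracketM Sp.
have sI := simple_int_sqint filtF martM Sp.
rewrite dotC [RHS]dotC; apply: ito_dot_limit => // S' Sp'.
exact: simple_pairing.
Qed.

Lemma ito_isometry (Z Z' : PF -> R) X X' : ito Z X -> ito Z' X' ->
  dist2 P X X' = dist2 mu Z Z'.
Proof.
move=> iZ iZ'; have [sZ' sX' _] := iZ'; have [sZ sX _] := iZ.
by rewrite !dist2E// (ito_dot iZ iZ) (ito_dot iZ iZ') (ito_dot iZ' iZ').
Qed.

(** Linearity follows from the isometry alone: the squared distance expands into scalar products,
    each equal to its counterpart under [mu], where the integrands coincide. *)
Lemma ito_lin (Z Z' Z'' : PF -> R) X X' X'' c : ito Z X -> ito Z' X' ->
  Z'' = (fun tw => Z tw + c * Z' tw) -> ito Z'' X'' ->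
  dist2 P X'' (fun w => X w + c * X' w) = 0.
Proof.
move=> iZ iZ' ZE iZ''.
have [sZ'' sX'' _] := iZ''; have [sZ' sX' _] := iZ'; have [sZ sX _] := iZ.
have sl := sqint_lin c sX sX'; have sl' := sqint_lin c sZ sZ'.
have : dist2 mu Z'' (fun tw => Z tw + c * Z' tw) = 0.
  by rewrite ZE ae_dist2_eq0//; exact: aeW.
rewrite !dist2E// !dot_linl// !dot_linr//.
rewrite (ito_dot iZ'' iZ'') (ito_dot iZ'' iZ) (ito_dot iZ'' iZ') (ito_dot iZ iZ)
  (ito_dot iZ iZ') (ito_dot iZ' iZ) (ito_dot iZ' iZ').
exact.
Qed.

End ito.

Section convergence_to_zero.
Variable R : realType.

Lemma cvg_EFin0 (a : nat -> R) : (forall n, 0 <= a n <= n.+1%:R^-1) ->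
  (a n)%:E @[n --> \oo] --> 0%E.
Proof.
move=> ha; apply: cvg_EFin; first exact: nearW.
apply: (@squeeze_cvgr _ _ _ _ (fun=> 0) (fun n => n.+1%:R^-1)).
- by apply: nearW => n; exact: ha.
- exact: cvg_cst.
- exact: cvg_harmonic.
Qed.

Lemma cvg0_eventually_le (u : nat -> \bar R) : u n @[n --> \oo] --> 0%E ->
  forall e : R, 0 < e -> exists N, forall n, (N <= n)%N -> (u n <= e%:E)%E.
Proof.
move=> /fine_cvgP[[N1 _ fin] /cvgrPdist_le h] e e0.
have [N2 _ H] := h _ e0; exists (maxn N1 N2) => n; rewrite geq_max => /andP[n1 n2].
rewrite -(fineK (fin _ n1)) lee_fin; apply: le_trans (ler_norm _) _.
by have := H _ n2; rewrite /= sub0r normrN.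
Qed.

End convergence_to_zero.

Lemma int_sqr_dist2 d (E : measurableType d) (R : realType) (mu : {measure set E -> \bar R})
  (f g : E -> R) : sqint mu f -> sqint mu g ->
  (\int[mu]_x ((f x - g x) ^+ 2)%:E)%E = (dist2 mu f g)%:E.
Proof.
by move=> sf sg; rewrite dotE; [|exact: sqintB|exact: sqintB].
Qed.

(** * The integral as a càdlàg process *)

Section stochastic_integral.
Context d (Omega : measurableType d) (R : realType) (P : probability Omega R).
Variables (T : R) (F : R -> set_system Omega) (M : R -> Omega -> R)
  (A : Omega -> cumulative R R).
Hypothesis T0 : 0 < T.
Hypothesis filtF : filtration T F.
Hypothesis usualF : usual_hypotheses P T F.
Hypothesis FT : F T = measurable.
Hypothesis martM : square_integrable_martingale P T F M.
Hypothesis bracketM : is_predictable_bracket P T F M A.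

Local Notation PF := (g_sigma_algebraType (predictable_rectangle T F)).
Local Notation mu := (bracket_measure_of T0 filtF
  (bracket_measurable martM bracketM) (bracket_integrable martM bracketM)).
Local Notation sproc := (@simple_proc _ Omega R T F).
Local Notation ito := (ito T0 filtF martM bracketM).
Local Notation stoch_int := (stoch_int P T F M A).

(** Predictability constrains Z on [0, T] only; the value 0 elsewhere makes it measurable on the
    whole of [PF]. *)
Definition on_PF (Z : R -> Omega -> R) : PF -> R :=
  (fun tw => Z tw.1 tw.2) \_ (`[0, T]%classic `*` [set: Omega]).

Lemma on_PFE Z t w : 0 <= t <= T -> on_PF Z (t, w) = Z t w.
Proof.
by move=> tT; rewrite /on_PF patchE mem_set//=; split => //=.
Qed.

Lemma bracket_sqr (f : R -> Omega -> R) (g : PF -> R) : measurable_fun setT g ->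
  (forall t w, 0 < t <= T -> f t w = g (t, w)) ->
  bracket_expectation P T A (fun t w => f t w ^+ 2) = (\int[mu]_tw (g tw ^+ 2)%:E)%E.
Proof.
move=> mg fg; apply: ge0_integral_bracket.
- by move=> tw; exact: sqr_ge0.
- exact: measurable_funX.
- by move=> t w tT; rewrite fg.
Qed.

Lemma L2_bracket_sqint Z : predictable T F Z -> (L2_bracket P T A Z <-> sqint mu (on_PF Z)).
Proof.
move=> /(predictable_measurable T0 filtF) mZ.
have -> : L2_bracket P T A Z <-> (\int[mu]_tw (on_PF Z tw ^+ 2)%:E < +oo)%E.
  rewrite /L2_bracket (@bracket_sqr _ (on_PF Z))//.
  by move=> t w /andP[t0 tT]; rewrite on_PFE// tT ltW.
split=> [h|[_ /integrable_lty]]; last exact.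
split => //; apply/integrableP; split.
  by apply/measurable_EFinP; exact: measurable_funX.
by under eq_integral do rewrite gee0_abs ?lee_fin ?sqr_ge0//.
Qed.

Lemma bracket_dist2 Z S : sqint mu (on_PF Z) -> simple_predictable T F S ->
  bracket_expectation P T A (fun t w => (Z t w - simple_val S t w) ^+ 2) =
  (dist2 mu (on_PF Z) (sproc S))%:E.
Proof.
move=> sZ Sp; have sS := simple_proc_sqint T0 filtF martM bracketM Sp.
rewrite (@bracket_sqr _ (fun tw => on_PF Z tw - sproc S tw)).
- exact: int_sqr_dist2.
- by apply: measurable_funB; [case: sZ|case: sS].
- by move=> t w /andP[t0 tT]; rewrite on_PFE// tT ltW.
Qed.

(** The process is the càdlàg version of the conditional expectations of the terminal integral.
    Elementary integrals at t are projections of terminal ones, so by contraction one sequence of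
    simple processes serves all times. *)
Lemma is_stoch_int_ex Z : sqint mu (on_PF Z) -> exists X, is_stoch_int P T F M A Z X.
Proof.
move=> sZ; have [XT [_ sX H]] := ito_ex sZ.
have TT : 0 <= T <= T by rewrite lexx ltW.
have FX : L2of P (F T) XT.
  by split => //; rewrite FT => B [Y mY <-]; case: sX => mX _; exact: mX.
have [N [cN NT NP]] := cadlag_version T0 filtF usualF FX.
exists N; split => //.
  by move=> t; rewrite in_itv/= => tT; have [[]] := NP t tT.
have /choice[S SP] : forall n, exists S, [/\ simple_predictable T F S,
    dist2 mu (on_PF Z) (sproc S) <= n.+1%:R^-1 & dist2 P XT (simple_int M S T) <= n.+1%:R^-1].
  by move=> n; apply: H; rewrite invr_gt0.
have Sp n : simple_predictable T F (S n) by have [] := SP n.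
exists S; split; first exact: Sp.
- rewrite (_ : (fun n => _) = fun n => (dist2 mu (on_PF Z) (sproc (S n)))%:E).
    by apply: cvg_EFin0 => n; have [_ h _] := SP n; rewrite dot_ge0.
  by apply/funext => n; exact: bracket_dist2.
- move=> t; rewrite in_itv/= => tT.
  have pS n := simple_int_L2proj filtF martM (Sp n) tT.
  rewrite (_ : (fun n => _) = fun n => (dist2 P (N t) (simple_int M (S n) t))%:E); last first.
    apply/funext => n; apply: int_sqr_dist2; first exact: L2of_sqint (NP t tT).1.
    exact: L2of_sqint (pS n).1.
  apply: cvg_EFin0 => n; have [_ _ h] := SP n; rewrite dot_ge0/=.
  apply: le_trans h; apply: L2proj_contract (NP t tT) (pS n) => //.
    exact: filtration_adm tT.
  exact: (simple_int_sqint filtF martM (Sp n)).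
Qed.

(** These facts hold for any process that meets the definition, hence for the arbitrary choice made
    by [stoch_int]. Each is inherited from the elementary integrals through L2 limits. *)
Lemma is_stoch_int_ito Z X : sqint mu (on_PF Z) -> is_stoch_int P T F M A Z X ->
  [/\ ito (on_PF Z) (X T), forall t, 0 <= t <= T -> L2proj P (F t) (X T) (X t) &
      {ae P, forall w, X 0 w = 0}].
Proof.
move=> sZ [cX aX [S [Sp ZS XS]]].
have TT : 0 <= T <= T by rewrite lexx ltW.
have zT : 0 <= (0 : R) <= T by rewrite lexx ltW.
have pS n t tT := @simple_int_L2proj _ _ _ P T F M filtF martM (S n) t (Sp n) tT.
have sS n t : 0 <= t <= T -> sqint P (simple_int M (S n) t).
  by move=> tT; exact: L2of_sqint (pS n t tT).1.
have XSe t : 0 <= t <= T -> forall e : R, 0 < e -> exists N, forall n, (N <= n)%N ->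
    (\int[P]_w ((X t w - simple_int M (S n) t w) ^+ 2)%:E <= e%:E)%E.
  by move=> tT; apply: cvg0_eventually_le; apply: XS; rewrite in_itv.
have FX t : 0 <= t <= T -> L2of P (F t) (X t).
  move=> tT; have mX : meas (F t) (X t) by apply: aX; rewrite in_itv.
  split => //; have [N /(_ N (leqnn N)) HN] := XSe t tT 1 ltr01.
  have mXO := meas_measurable (filtration_adm filtF tT).2 mX.
  have sd : sqint P (fun w => X t w - simple_int M (S N) t w).
    have md : measurable_fun setT (fun w => X t w - simple_int M (S N) t w).
      by apply: measurable_funB => //; case: (sS N t tT).
    split => //; apply/integrableP; split.
      by apply/measurable_EFinP; exact: measurable_funX.
    under eq_integral do rewrite gee0_abs ?lee_fin ?sqr_ge0//.
    by apply: le_lt_trans HN _; rewrite ltry.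
  have := sqintD sd (sS N t tT); congr sqint.
  by apply/funext => w; rewrite subrK.
have sX t : 0 <= t <= T -> sqint P (X t) by move=> tT; exact: L2of_sqint (FX t tT).
have XSd t : 0 <= t <= T -> forall e : R, 0 < e -> exists N, forall n, (N <= n)%N ->
    dist2 P (X t) (simple_int M (S n) t) <= e.
  move=> tT e e0; have [N HN] := XSe t tT e e0; exists N => n Nn.
  by rewrite -lee_fin -int_sqr_dist2; [exact: HN|exact: sX|exact: sS].
split.
- split => //; first exact: sX.
  move=> e e0; have [N HN] := XSd T TT e e0.
  have [N' HN'] := cvg0_eventually_le ZS e0.
  exists (S (maxn N N')); split; [exact: Sp| |exact/HN/leq_maxl].
  by rewrite -lee_fin -bracket_dist2//; exact/HN'/leq_maxr.
- move=> t tT; split; first exact: FX.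
  move=> U FU; have sU := L2of_sqint FU.
  apply/eqP; rewrite -sqrf_eq0 eq_le sqr_ge0 andbT.
  apply/ler_addgt0Pr => e e0; rewrite add0r.
  pose b := 4 * dot P U U + 1.
  have b0 : 0 < b by rewrite /b ltr_wpDl// mulr_ge0// dot_ge0.
  have [N HN] := XSd T TT _ (divr_gt0 e0 b0); have [N' HN'] := XSd t tT _ (divr_gt0 e0 b0).
  pose n := maxn N N'.
  have {}HN := HN n (leq_maxl _ _); have {}HN' := HN' n (leq_maxr _ _).
  have := (pS n t tT).2 _ FU.
  have sXT := sX T TT; have sXt := sX t tT; have sST := sS n T TT; have sSt := sS n t tT.
  rewrite !dotBl// => e1.
  have := cauchy_schwarz (sqintB sXT sST) sU; have := cauchy_schwarz (sqintB sXt sSt) sU.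
  rewrite -/(dist2 P (X T) _) -/(dist2 P (X t) _) !dotBl//.
  move: HN HN'; rewrite !ler_pdivlMr// /b; have := dot_ge0 P U.
  move: e1; move: (dist2 P (X T) _) (dist2 P (X t) _) => x y.
  move: (dot P U U) (dot P (X T) U) (dot P (X t) U) => p q r.
  move: (dot P (simple_int _ _ _) U) (dot P (simple_int _ _ _) U) => u v.
  move=> uv p0 hx hy h1 h2.
  have -> : q - r = (q - v) - (r - u) by lra.
  have h : ((q - v) - (r - u)) ^+ 2 <= 2 * (q - v) ^+ 2 + 2 * (r - u) ^+ 2.
    by have := sqr_ge0 ((q - v) + (r - u)); nra.
  apply: le_trans h _; nra.
- have sz := sqint0 P.
  apply: (dist2_eq0 (sX 0 zT) sz).
  apply/eqP; rewrite eq_le dot_ge0 andbT.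
  apply/ler_addgt0Pr => e e0; rewrite add0r.
  have [N /(_ N (leqnn N))] := XSd 0 zT e e0.
  by rewrite (simple_int0 M (Sp N)).
Qed.

Lemma stoch_intP Z : sqint mu (on_PF Z) -> is_stoch_int P T F M A Z (stoch_int Z).
Proof. by move=> sZ; apply: xgetPex; exact: is_stoch_int_ex. Qed.

End stochastic_integral.

(** * The decomposition under partial information *)

Section predictable_processes.
Context d (Omega : measurableType d) (R : realType).
Variables (T : R) (H : R -> set_system Omega).
Hypothesis T0 : 0 < T.
Hypothesis filtH : filtration T H.

Lemma eq_predictable (Z Z' : R -> Omega -> R) :
  (forall t w, 0 <= t <= T -> Z t w = Z' t w) -> predictable T H Z -> predictable T H Z'.
Proof.
move=> ZZ pZ B [Y mY <-]; apply: pZ; exists Y => //.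
by apply/seteqP; split => -[t w] /= [[tT I] ZY]; (split; first by split);
  move: tT ZY; rewrite in_itv/= => tT; rewrite ZZ.
Qed.

Lemma predictable_lin (Z Z' : R -> Omega -> R) c : predictable T H Z -> predictable T H Z' ->
  predictable T H (fun t w => Z t w + c * Z' t w).
Proof.
move=> /(predictable_measurable T0 filtH) mZ /(predictable_measurable T0 filtH) mZ'.
have pl := measurable_predictable T0
  (measurable_funD mZ (measurable_funM (measurable_cst c) mZ')).
apply: eq_predictable pl => t w tT /=.
by rewrite -/(@on_PF _ Omega R T H Z) -/(@on_PF _ Omega R T H Z') !on_PFE.
Qed.

Lemma on_PF_lin (Z Z' : R -> Omega -> R) c : @on_PF _ Omega R T H (fun t w => Z t w + c * Z' t w) =

  (fun tw => on_PF Z tw + c * on_PF Z' tw).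
Proof.
by apply/funext => tw; rewrite /on_PF !patchE; case: ifP; rewrite ?mulr0 ?addr0.
Qed.

Lemma predictableS (F : R -> set_system Omega) (Z : R -> Omega -> R) :
  (forall t, t \in `[0, T] -> H t `<=` F t) -> predictable T H Z -> predictable T F Z.
Proof.
move=> HF pZ B /pZ; apply: smallest_sub; first exact: smallest_sigma_algebra.
apply: subset_trans (@sub_sigma_algebra _ _ _) => _ [[C HC ->]|[s [t [C [s0 st tT HC ->]]]]].
  by left; exists C => //; apply: HF HC; rewrite in_itv/= lexx ltW.
right; exists s, t, C; split => //; apply: HF HC.
by rewrite in_itv/= s0 (le_trans st).
Qed.

End predictable_processes.

Section attainable.
Context d (Omega : measurableType d) (R : realType) (P : probability Omega R).
Variables (T : R) (F H : R -> set_system Omega) (M : R -> Omega -> R)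
  (A : Omega -> cumulative R R).
Hypothesis T0 : 0 < T.
Hypothesis filtF : filtration T F.
Hypothesis filtH : filtration T H.
Hypothesis martM : square_integrable_martingale P T F M.
Hypothesis bracketM : is_predictable_bracket P T F M A.

Local Notation mu := (bracket_measure_of T0 filtF
  (bracket_measurable martM bracketM) (bracket_integrable martM bracketM)).
Local Notation ito := (ito T0 filtF martM bracketM).
Local Notation onPF := (@on_PF _ Omega R T F).

Lemma ito_eq Z X X' : sqint P X' -> ito Z X -> dist2 P X X' = 0 -> ito Z X'.
Proof.
move=> sX' iZ XX; have [sZ sX _] := iZ.
apply: (@ito_closed _ _ _ _ _ _ _ _ T0 filtF martM bracketM _ _ (fun=> Z) (fun=> X)) => //.
  move=> e e0; exists 0 => n _; rewrite ae_dist2_eq0 ?ltW//; exact: aeW.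
by move=> e e0; exists 0 => n _; rewrite XX ltW.
Qed.

Lemma ito_lin_ex Z Z' X X' c : ito Z X -> ito Z' X' ->
  ito (fun tw => Z tw + c * Z' tw) (fun w => X w + c * X' w).
Proof.
move=> iZ iZ'; have [sZ sX _] := iZ; have [sZ' sX' _] := iZ'.
have [X'' iZ''] := ito_ex (sqint_lin c sZ sZ').
apply: (ito_eq _ iZ''); first exact: sqint_lin.
exact: ito_lin iZ iZ' erefl iZ''.
Qed.

(** Stated with the relation [ito] and not with the chosen version [stoch_int]: the set contains all
    versions of each terminal integral, hence is literally closed under linear combinations. *)
Definition attainable : set (Omega -> R) :=
  [set X | exists2 phi, predictable T H phi & ito (onPF phi) X].

Lemma attainable_subspace : subspace P attainable.
Proof.
split.
- exists (fun=> fun=> 0).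
    by apply: (@measurable_predictable _ _ _ _ _ T0 (fun=> 0)).
  have -> : onPF (fun=> fun=> 0) = fun=> 0.
    by apply/funext => tw; rewrite /on_PF patchE; case: ifP.
  have [X iX] := ito_ex (sqint0 mu).
  have := ito_lin_ex (-1) iX iX.
  have -> : (fun w => X w + -1 * X w) = fun=> 0 by apply/funext => w; ring.
  by congr ito; apply/funext => w; ring.
- by move=> X [phi _ []].
- move=> X X' c [phi pphi iX] [psi ppsi iX']; exists (fun t w => phi t w + c * psi t w).
    exact: predictable_lin.
  rewrite on_PF_lin; exact: ito_lin_ex.
Qed.

(** The isometry turns a Cauchy sequence of integrals into one of integrands. Their L2 limit is
    taken for a measure on F-predictable sets, but as a limsup of H-predictable functions it is
    H-predictable. *)
Lemma attainable_complete : L2complete P attainable.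
Proof.
move=> u uV uc.
have /choice[phi uphi] : forall n, exists phi, predictable T H phi /\ ito (onPF phi) (u n).
  by move=> n; have [phi p i] := uV n; exists phi.
have su n : sqint P (u n) by have [_ []] := uphi n.
have sphi n : sqint mu (onPF (phi n)) by have [_ []] := uphi n.
have phic : L2cauchy mu (fun n => onPF (phi n)).
  move=> e /uc[N HN]; exists N => m n Nm Nn.
  by rewrite -(ito_isometry (uphi m).2 (uphi n).2) HN.
have [k /= [_ sf uf _]] := riesz_fischer sphi phic.
have [k' /= [_ sX uX _]] := riesz_fischer su uc.
set f := (fun tw => fine _) in sf uf.
eexists; last exact: uX.
(* Outside [0, T] x Omega all terms of the limsup are 0, so the limit already has the value that
   [on_PF] imposes. *)
have fE : onPF (fun t w => f (t, w)) = f.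
  apply/funext => -[t w]; rewrite /on_PF patchE; case: ifPn => //= tw.
  rewrite /f (_ : (fun _ => _) = fun=> 0%E); last first.
    by apply/funext => n; rewrite /on_PF patchE (negbTE tw).
  by have [_ ->] := cvg_limn_einf_sup (cvg_cst (0%E : \bar R)).
exists (fun t w => f (t, w)); last first.
  rewrite fE; exact: ito_closed sf sX (fun n => (uphi n).2) uf uX.
have mf : measurable_fun (setT : set (g_sigma_algebraType (predictable_rectangle T H))) f.
  apply: measurableT_comp; first exact: fine_measurable.
  apply: measurable_fun_limn_esup => n; apply/measurable_EFinP.
  exact: (predictable_measurable T0 filtH (uphi (k n)).1).
exact: (measurable_predictable T0 mf).
Qed.

End attainable.

(** * Càdlàg processes and square-integrable martingales *)

Section cadlag_processes.
Context d (Omega : measurableType d) (R : realType) (P : probability Omega R).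
Variables (T : R).
Hypothesis T0 : 0 < T.

Lemma cvg_next_dyadic (f : R -> R) (t l : R) : 0 <= t < T -> f s @[s --> t^'+] --> l ->
  f (next_dyadic T t k) @[k --> \oo] --> l.
Proof.
move=> tT; apply: (cvg_comp (fun k => next_dyadic T t k) f) => B [/= e e0 HB].
have [N HN] := next_dyadic_near T0 tT e0.
exists N => // k /= /HN kt; have [_ tk _] := next_dyadicP T0 k tT.
by apply: HB => //=; rewrite distrC ger0_norm ?subr_ge0 ?ltW// ltrBlDl.
Qed.

(** One null set covers the countably many dyadic times, T among them; right-continuity extends the
    equality to the times before T. *)
Lemma cadlag_indistinguishable (X Y : R -> Omega -> R) : cadlag T X -> cadlag T Y ->
  (forall t, 0 <= t <= T -> {ae P, forall w, X t w = Y t w}) -> indistinguishable P T X Y.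
Proof.
move=> cX cY XY.
have dXY : {ae P, forall w, forall m, forall k, (k <= 2 ^ m)%N ->
    X (dyadic T m k) w = Y (dyadic T m k) w}.
  apply: ae_foralln => m; apply: ae_foralln => k.
  case: (leqP k (2 ^ m)) => [km|_]; last exact: aeW.
  by apply: filterS (XY _ (dyadic_itv T0 km)) => w.
apply: filterS dXY => w dXY t; rewrite in_itv/= => /andP[t0].
have dy s : dyadics T s -> X s w = Y s w by move=> [m [k [km ->]]]; exact: dXY.
rewrite le_eqVlt => /predU1P[->|tT].
  by apply: dy; exists 0, 1; rewrite dyadicT.
have tT' : 0 <= t < T by rewrite t0.
have tI : t \in `[0, T[ by rewrite in_itv/= t0.
have cx := cvg_next_dyadic tT' ((cX w).1 t tI).
have cy := cvg_next_dyadic tT' ((cY w).1 t tI).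
apply: (cvg_unique _ cx); first exact: Rhausdorff.
rewrite (_ : (fun k => _) = fun k => Y (next_dyadic T t k) w)//.
by apply/funext => k; apply: dy; have [] := next_dyadicP T0 k tT'.
Qed.

End cadlag_processes.

Section martingales.
Context d (Omega : measurableType d) (R : realType) (P : probability Omega R).
Variables (T : R) (F : R -> set_system Omega).
Hypothesis filtF : filtration T F.

Lemma L2proj_martingale (O : R -> Omega -> R) :
  (forall t, 0 <= t <= T -> L2of P (F t) (O t)) ->
  (forall s t, 0 <= s -> s <= t -> t <= T -> L2proj P (F s) (O t) (O s)) ->
  square_integrable_martingale P T F O.
Proof.
move=> FO pO; split; last by move=> t; rewrite in_itv/= => /FO[? _]; exact/Lfun2_sqint.
split.
- by move=> t; rewrite in_itv/= => /FO[].
- move=> t; rewrite in_itv/= => /FO[sO _].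
  have := sqint_mul sO (sqint_cst P 1).
  by under eq_fun do rewrite mulr1.
- move=> s t s0 st tT; apply: L2proj_cond_exp (pO s t s0 st tT).
    by apply: (filtration_adm filtF); rewrite s0 (le_trans st).
  by apply: L2of_sqint (FO t _); rewrite (le_trans s0).
Qed.

End martingales.

(** * Existence and uniqueness for the backward equation *)

Section partial_information.
Context d (Omega : measurableType d) (R : realType) (P : probability Omega R).
Variables (T : R) (F H : R -> set_system Omega) (M : R -> Omega -> R)
  (A : Omega -> cumulative R R) (xi : Omega -> R).
Hypothesis T0 : 0 < T.
Hypothesis filtF : filtration T F.
Hypothesis usualF : usual_hypotheses P T F.
Hypothesis FT : F T = measurable.
Hypothesis filtH : filtration T H.
Hypothesis HF : forall t, t \in `[0, T] -> H t `<=` F t.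
Hypothesis martM : square_integrable_martingale P T F M.
Hypothesis bracketM : is_predictable_bracket P T F M A.
Hypothesis sxi : sqint P xi.

Local Notation mu := (bracket_measure_of T0 filtF
  (bracket_measurable martM bracketM) (bracket_integrable martM bracketM)).
Local Notation ito := (ito T0 filtF martM bracketM).
Local Notation onPF := (@on_PF _ Omega R T F).
Local Notation I := (stoch_int P T F M A).
Local Notation solution := (bsde_solution P T F H M A xi).

Let zT : 0 <= (0 : R) <= T.
Proof. by rewrite lexx ltW. Qed.

Let TT : 0 <= T <= T.
Proof. by rewrite lexx ltW. Qed.

Lemma integrand_sqint Z : predictable T H Z -> L2_bracket P T A Z -> sqint mu (onPF Z).
Proof.
by move=> /(predictableS T0 HF) pZ /(L2_bracket_sqint T0 filtF martM bracketM pZ).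
Qed.

Lemma stoch_int_ito Z : sqint mu (onPF Z) ->
  [/\ ito (onPF Z) (I Z T), forall t, 0 <= t <= T -> L2proj P (F t) (I Z T) (I Z t) &
      {ae P, forall w, I Z 0 w = 0}].
Proof. by move=> sZ; apply: is_stoch_int_ito sZ (stoch_intP usualF FT sZ). Qed.

Lemma orthogonalityP (O : R -> Omega -> R) : sqint P (O T) ->
  orthogonality P T F H M A O <-> forall phi, predictable T H phi ->
    L2_bracket P T A phi -> dot P (O T) (I phi T) = 0.
Proof.
move=> sO; have EO phi : predictable T H phi -> L2_bracket P T A phi ->
    ('E_P[fun w => (O T w * I phi T w)%R] = (dot P (O T) (I phi T))%:E)%E.
  move=> pphi Lphi; have [[_ sI _] _ _] := stoch_int_ito (integrand_sqint pphi Lphi).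
  by rewrite unlock dotE.
split=> h phi pphi Lphi; last by rewrite EO// h.
by have := h phi pphi Lphi; rewrite EO// => -[].
Qed.

(** By the equation, xi - Y_t is the sum of the increments of the integral and of O over [t, T],
    both orthogonal to F_t. The equation also gives Y_t its square integrability, which is not part
    of the definition of a solution. *)
Lemma solution_L2proj Y Z t : solution Y Z -> 0 <= t <= T -> L2proj P (F t) xi (Y t).
Proof.
move=> [_ aY pZ LZ [Q [martO _ _ eqY]]] tT; have /andP[t0 tT'] := tT.
have [[_ sIT _] pI _] := stoch_int_ito (integrand_sqint pZ LZ).
have [FIt It] := pI t tT; have [FOt Ot] := martingale_L2proj filtF martO t0 tT' (lexx T).
have sOT := martingale_sqint martO TT.
have [sIt sOt] := (L2of_sqint FIt, L2of_sqint FOt).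
have sV : sqint P (fun w => xi w - (I Z T w - I Z t w) - (Q T w - Q t w)).
  by apply: sqintB (sqintB sOT sOt); apply: sqintB (sqintB sIT sIt).
have VY : {ae P, forall w, xi w - (I Z T w - I Z t w) - (Q T w - Q t w) = Y t w}.
  by apply: filterS eqY => w ->//; rewrite in_itv.
have FY : L2of P (F t) (Y t).
  have mY : meas (F t) (Y t) by apply: aY; rewrite in_itv.
  split => //; apply: eq_ae_sqint sV _ VY.
  exact: meas_measurable (filtration_adm filtF tT).2 mY.
split => // U FU; have sU := L2of_sqint FU.
rewrite dotBl//; last exact: L2of_sqint FY.
rewrite -(eq_ae_dot sV (L2of_sqint FY) sU VY) -dotBl//.
have -> : (fun w => xi w - (xi w - (I Z T w - I Z t w) - (Q T w - Q t w))) =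
    (fun w => (I Z T w - I Z t w) + (Q T w - Q t w)) by apply/funext => w; ring.
by rewrite dotDl//; [rewrite It// Ot// addr0|exact: sqintB|exact: sqintB].
Qed.

Lemma solution_exists : exists Y Z, solution Y Z.
Proof.
have [v [Z pZ iZv] vP] := projection
  (attainable_subspace T0 filtF filtH martM bracketM)
  (@attainable_complete _ _ _ _ _ _ _ _ _ T0 filtF filtH martM bracketM) sxi.
have [sZ sv _] := iZv; have [iZ pI _] := stoch_int_ito sZ; have [_ sIT _] := iZ.
(* The projection is some version of the terminal integral; by the isometry it agrees almost surely
   with the chosen one. *)
have vI : {ae P, forall w, v w = I Z T w}.
  by apply: dist2_eq0 => //; rewrite (ito_isometry iZv iZ) ae_dist2_eq0//; exact: aeW.
have sr := sqintB sxi sIT.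
have rP X : attainable H T0 filtF martM bracketM X -> dot P (fun w => xi w - I Z T w) X = 0.
  move=> aX; have [_ _ [_ sX _]] := aX.
  by have := vP X aX; rewrite !dotBl// (eq_ae_dot sv sIT sX vI).
have Fr : L2of P (F T) (fun w => xi w - I Z T w).
  by split => //; rewrite FT => B [D mD <-]; case: sr => mr _; exact: mr.
have [N [cN NT pN]] := cadlag_version T0 filtF usualF Fr.
have [cI aI _] := stoch_intP usualF FT sZ.
have aF t tT := @filtration_adm _ _ _ _ _ filtF t tT.
have FN0 t : 0 <= t <= T -> L2of P (F t) (N 0).
  move=> /andP[t0 tT]; apply: L2ofS (pN 0 zT).1; exact: (filtrationS filtF).
have FQ t : 0 <= t <= T -> L2of P (F t) (fun w => N t w - N 0 w).
  by move=> tT; apply: L2ofB (FN0 t tT); [exact: aF|case: (pN t tT)].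
have martQ : square_integrable_martingale P T F (fun t w => N t w - N 0 w).
  apply: L2proj_martingale => // s t s0 st tT.
  have sT : 0 <= s <= T by rewrite s0 (le_trans st).
  have tT' : 0 <= t <= T by rewrite (le_trans s0).
  split; first exact: FQ.
  move=> U FU.
  have FF : F s `<=` F t by exact: (filtrationS filtF).
  have [_ h] := L2proj_tower (aF s sT) (aF t tT') FF sr (pN t tT') (pN s sT).
  rewrite -[RHS](h U FU); congr dot; apply/funext => w; ring.
exists (fun t w => I Z t w + N t w), Z; split => //.
- by move=> w; have [r l] := cI w; have [r' l'] := cN w; split => t tT;
    [apply: cvgD; [exact: r|exact: r']|apply: is_cvgD; [exact: l|exact: l']].
- move=> t; rewrite in_itv/= => tT.
  by have [] := L2ofD (aF t tT) (pI t tT).1 (pN t tT).1.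
- exact/(L2_bracket_sqint T0 filtF martM bracketM (predictableS T0 HF pZ)).
exists (fun t w => N t w - N 0 w); split => //.
- by apply: aeW => w; rewrite subrr.
- apply/orthogonalityP; first exact: L2of_sqint (FQ T TT).
  move=> phi pphi Lphi; have sphi := integrand_sqint pphi Lphi.
  have [iphi pIphi I0] := stoch_int_ito sphi; have [_ sIphi _] := iphi.
  have [sN0 sNT] := (L2of_sqint (pN 0 zT).1, L2of_sqint (pN T TT).1).
  rewrite dotBl// NT rP; last by exists phi.
  have [FI0 PI0] := pIphi 0 zT; have sI0 := L2of_sqint FI0.
  (* [N 0] is a test function at time 0, where the projection of the terminal integral of [phi] is
     its initial value 0. *)
  have := PI0 _ (pN 0 zT).1; rewrite dotBl// (eq_ae_dot sI0 (sqint0 P) sN0 I0) dot0l subr0 dotC.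
  by move=> ->; rewrite subr0.
(* [N T] is exactly the residual, so the equation holds at every w. *)
- by apply: aeW => w t _; rewrite NT; ring.
Qed.

Lemma solution_unique_Z Y Z Y' Z' : (forall t, 0 <= t <= T -> {ae P, forall w, Y t w = Y' t w}) ->
  solution Y Z -> solution Y' Z' -> bracket_ae_eq P T A Z Z'.
Proof.
have alg (x a b c e : R) : x - a - b = x - c - e -> e - b = a - c by move=> *; lra.
move=> YY' [_ _ pZ LZ [Q [martO O0 orthO eqY]]] [_ _ pZ' LZ' [Q' [martO' O0' orthO' eqY']]].
have [sZ sZ'] := (integrand_sqint pZ LZ, integrand_sqint pZ' LZ').
have [iZ _ I0] := stoch_int_ito sZ; have [iZ' _ I0'] := stoch_int_ito sZ'.
have [[_ sI _] [_ sI' _]] := (iZ, iZ').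
pose phi t w := Z t w + (-1) * Z' t w.
have pphi : predictable T H phi := predictable_lin T0 filtH pZ pZ'.
have sphi : sqint mu (onPF phi) by rewrite /phi on_PF_lin; exact: sqint_lin.
have Lphi : L2_bracket P T A phi.
  exact/(L2_bracket_sqint T0 filtF martM bracketM (predictableS T0 HF pphi)).
have [iphi _ _] := stoch_int_ito sphi; have [_ sIphi _] := iphi.
have sO := martingale_sqint martO TT; have sO' := martingale_sqint martO' TT.
have Y0 (U : R -> Omega -> R) V (L : R -> Omega -> R) :
    {ae P, forall w, forall t, t \in `[0, T] ->
      U t w = xi w - (I V T w - I V t w) - (L T w - L t w)} ->
    {ae P, forall w, L 0 w = 0} -> {ae P, forall w, I V 0 w = 0} ->
    {ae P, forall w, U 0 w = xi w - I V T w - L T w}.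
  move=> eqU L0 J0; apply: filterS3 eqU L0 J0 => w eqU L0 J0.
  by rewrite eqU ?in_itv//= L0 J0 !subr0.
have dI : {ae P, forall w, Q' T w - Q T w = I Z T w - I Z' T w}.
  apply: filterS3 (YY' 0 zT) (Y0 _ _ _ eqY O0 I0) (Y0 _ _ _ eqY' O0' I0') => w -> -> e.
  exact: alg e.
have ZZ' : dist2 mu (onPF Z) (onPF Z') = 0.
  rewrite -(ito_isometry iZ iZ').
  have sd := sqintB sI sI'; have sdO := sqintB sO' sO.
  have phiI : {ae P, forall w, I phi T w = I Z T w - I Z' T w}.
    have h := ito_lin iZ iZ' (on_PF_lin _ _ Z Z' (-1)) iphi.
    apply: filterS (dist2_eq0 sIphi (sqint_lin _ sI sI') h) => w ->.
    by rewrite mulN1r.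
  (* One factor of the squared norm is replaced by the difference of the orthogonal terms, the other
     by the integral of [phi], an admissible integrand in both orthogonality conditions. *)
  rewrite /dist2 -(eq_ae_dot sdO sd sd dI) dotC -(eq_ae_dot sIphi sd sdO phiI) dotC dotBl//.
  move: (orthO) (orthO') => /(orthogonalityP sO) -> // /(orthogonalityP sO') -> //.
  by rewrite subrr.
have := dist2_eq0 sZ sZ' ZZ' => aeZ.
pose N : set (g_sigma_algebraType (predictable_rectangle T F)) :=
  [set tw | onPF Z tw != onPF Z' tw].
have mN : measurable N.
  have [/measurable_EFinP mZ _] := sZ; have [/measurable_EFinP mZ' _] := sZ'.
  have := measurable_neqe measurableT mZ mZ'; by rewrite setTI.
rewrite /bracket_ae_eq (@ge0_integral_bracket _ _ _ P T F A T0 filtF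
  (bracket_measurable martM bracketM) (bracket_integrable martM bracketM) _ (\1_N))//.
- rewrite integral_indic// setIT; apply: measure_negligible => //.
  by apply: negligibleS aeZ => tw /= /eqP.
- by move=> t w /andP[t0 tT]; rewrite !indicE; congr (nat_of_bool _)%:R;
    apply/idP/idP => /set_mem /= h; apply/mem_set; move: h; rewrite /N/= !on_PFE// tT ltW.
Qed.

End partial_information.

Theorem theorem3p3 (d : measure_display) (Omega : measurableType d) (R : realType)
    (P : probability Omega R) (T : R) (T_gt0 : 0 < T)
    (F H : R -> set_system Omega)
    (filtF : filtration T F) (usualF : usual_hypotheses P T F)
    (FT : F T = measurable)
    (filtH : filtration T H) (usualH : usual_hypotheses P T H)
    (HF : forall t, t \in `[0, T] -> H t `<=` F t)
    (M : R -> Omega -> R) (A : Omega -> cumulative R R)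
    (cadlagM : cadlag T M) (martM : square_integrable_martingale P T F M)
    (bracketM : is_predictable_bracket P T F M A)
    (xi : Omega -> R) (xiL2 : xi \in Lfun P 2%:E) :
  exists Y Z : R -> Omega -> R,
    bsde_solution P T F H M A xi Y Z /\
    forall Y' Z' : R -> Omega -> R,
      bsde_solution P T F H M A xi Y' Z' ->
      indistinguishable P T Y Y' /\ bracket_ae_eq P T A Z Z'.
Proof.
have sxi : sqint P xi by exact/Lfun2_sqint.
have [Y [Z sol]] := solution_exists T_gt0 filtF usualF FT filtH HF martM bracketM sxi.
exists Y, Z; split => // Y' Z' sol'.
have YY' t : 0 <= t <= T -> {ae P, forall w, Y t w = Y' t w}.
  move=> tT.
  have pY := solution_L2proj T_gt0 filtF usualF FT HF martM bracketM sxi sol tT.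
  have pY' := solution_L2proj T_gt0 filtF usualF FT HF martM bracketM sxi sol' tT.
  by apply: (L2proj_uniq (filtration_adm filtF tT) sxi sxi _ pY pY'); exact: aeW.
have [cY cY'] : cadlag T Y /\ cadlag T Y' by split; [case: sol|case: sol'].
split; first exact: cadlag_indistinguishable.
exact: (solution_unique_Z T_gt0 filtF usualF FT filtH HF martM bracketM YY' sol sol').
Qed.
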